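(* Let $(L^k,g)$ and $(M^n,h)$ be oriented Riemannian manifolds with $2\le k\le n$ and $L$ compact. Let $\alpha\in\Omega^k(M)$ be a closed calibration and let $u\colon (L,g)\to(M,h)$ be a Smith immersion with respect to $\alpha$. Then $u$ is $k$-harmonic in the sense that it is a critical point of the $k$-energy $E_k$.
   Context: A form $\alpha\in\Omega^k(M)$ is a calibration if $\alpha(e_1,\dots,e_k)\le 1$ for all orthonormal $e_1,\dots,e_k\in T_xM$, $x\in M$; it is a closed calibration if also $d\alpha=0$. $|du|^2=\operatorname{tr}_g(u^*h)$. A smooth map $u\colon(L^k,g)\to(M^n,h)$ is a Smith immersion with respect to $\alpha$ if $u^*\alpha=\frac{1}{(\sqrt k)^k}|du|^k\,\mathrm{vol}_L$ and $u^*h=\frac1k|du|^2g$ at all points of $L$ (the first equation implies the second; $du$ is allowed to vanish at some points). For a smooth map $u$ with compact domain $L$, $E_k(u)=\frac{1}{(\sqrt k)^k}\int_L|du|^k\,\mathrm{vol}_L$; $u$ is a critical point of $E_k$ if $\frac{d}{dt}\big|_{t=0}E_k(u_t)=0$ for every smooth one-parameter family of maps $u_t\colon L\to M$ with $u_0=u$. *)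

(* Defs.v *)
From HB Require Import structures.
From mathcomp Require Import all_boot all_order all_algebra.
From mathcomp Require Import all_classical all_reals all_analysis.

Set Implicit Arguments.
Unset Strict Implicit.
Unset Printing Implicit Defensive.

Import Order.TTheory GRing.Theory Num.Theory.
Import numFieldNormedType.Exports.

Local Open Scope classical_set_scope.
Local Open Scope ring_scope.

(* Only meant for open U in a finite-dimensional V, where continuity of all
   iterated directional derivatives is equivalent to the usual notion. *)
Fixpoint diff_class (R : realType) (V W : normedModType R) (r : nat)
    (U : set V) (f : V -> W) : Prop :=
  (forall x, U x -> {for x, continuous f}) /\
  match r with
  | 0%N => True
  | s.+1 => forall v : V, (forall x, U x -> derivable f x v) /\
                          diff_class s U ('D_v f)
  end.

Definition smooth_on (R : realType) (V W : normedModType R)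
    (U : set V) (f : V -> W) : Prop := forall r, diff_class r U f.

(* The values of [to] off [dom] and of [inv] off [img] are irrelevant. *)
Record chart (R : realType) (n : nat) (T : topologicalType) := Chart {
  dom : set T;
  img : set 'rV[R]_n;
  to :> T -> 'rV[R]_n;
  inv : 'rV[R]_n -> T;
  open_dom : open dom;
  open_img : open img;
  to_img : forall x, dom x -> img (to x);
  inv_dom : forall y, img y -> dom (inv y);
  toK : forall x, dom x -> inv (to x) = x;
  invK : forall y, img y -> to (inv y) = y;
  to_continuous : forall x, dom x -> {for x, continuous to};
  inv_continuous : forall y, img y -> {for y, continuous inv} }.

(* Row-vector convention, as for [jacobian]: v in the chart c becomes
   v *m transition c d x in the chart d. *)
Definition transition (R : realType) (n : nat) (T : topologicalType)
    (c d : chart R n T) (x : T) : 'M[R]_n := jacobian (d \o inv c) (c x).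

(* The atlas need not be maximal. The tangent space at x is 'rV[R]_n, a vector
   being given by its coordinates in the chart [chart_at x]. *)
Record manifold (R : realType) (n : nat) := Manifold {
  carrier :> topologicalType;
  manifold_hausdorff : hausdorff_space carrier;
  manifold_second_countable : @second_countable carrier;
  atlas : set (chart R n carrier);
  chart_at : carrier -> chart R n carrier;
  chart_at_atlas : forall x, atlas (chart_at x);
  chart_at_dom : forall x, dom (chart_at x) x;
  atlas_smooth : forall c d, atlas c -> atlas d ->
    smooth_on [set y | img c y /\ dom d (inv c y)] (d \o inv c) }.

(* In dimension at least 1, an orientation is the same thing as a positively
   oriented atlas (up to positive compatibility). *)
Definition oriented (R : realType) (n : nat) (M : manifold R n) : Prop :=
  forall c d : chart R n M, atlas c -> atlas d ->
    forall x, dom c x -> dom d x -> 0 < \det (transition c d x).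

Record riem_metric (R : realType) (n : nat) (M : manifold R n) := RiemMetric {
  metric_at :> M -> 'M[R]_n;
  metric_sym : forall x, (metric_at x)^T = metric_at x;
  metric_pos : forall x (v : 'rV[R]_n), v != 0 ->
    0 < (v *m metric_at x *m v^T) 0 0;
  metric_smooth : forall c : chart R n M, atlas c ->
    smooth_on (img c) (fun y => let x := inv c y in
      let J := transition c (chart_at x) x in J *m metric_at x *m J^T) }.

(* A k-tuple of vectors is the matrix of its rows. *)
Definition multilinear (R : realType) (k n : nat)
    (w : 'M[R]_(k, n) -> R) : Prop :=
  forall (A B C : 'M[R]_(k, n)) (i : 'I_k) (b c : R),
    row i A = b *: row i B + c *: row i C ->
    row' i B = row' i A -> row' i C = row' i A -> w A = b * w B + c * w C.

Definition alternating (R : realType) (k n : nat)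
    (w : 'M[R]_(k, n) -> R) : Prop :=
  forall (A : 'M[R]_(k, n)) (i j : 'I_k),
    i != j -> row i A = row j A -> w A = 0.

Definition in_chart (R : realType) (k n : nat) (M : manifold R n)
    (w : M -> 'M[R]_(k, n) -> R) (c : chart R n M)
    (y : 'rV[R]_n) (V : 'M[R]_(k, n)) : R :=
  let x := inv c y in w x (V *m transition c (chart_at x) x).

Record kform (R : realType) (k n : nat) (M : manifold R n) := KForm {
  form_at :> M -> 'M[R]_(k, n) -> R;
  form_multilinear : forall x, multilinear (form_at x);
  form_alternating : forall x, alternating (form_at x);
  form_smooth : forall c : chart R n M, atlas c -> forall V : 'M[R]_(k, n),
    smooth_on (img c) (fun y => in_chart form_at c y V) }.

(* dw(v_0,...,v_k) = sum_i (-1)^i D_{v_i} (w(v_0,...,^v_i,...,v_k)) in the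
   coordinates of the chart at x, the v_i being extended as constants. *)
Definition ext_d (R : realType) (k n : nat) (M : manifold R n)
    (w : M -> 'M[R]_(k, n) -> R) (x : M) (V : 'M[R]_(k.+1, n)) : R :=
  \sum_(i < k.+1) (-1) ^+ i *
    'D_(row i V) (fun y => in_chart w (chart_at x) y (row' i V)) (chart_at x x).

Definition calibration (R : realType) (k n : nat) (M : manifold R n)
    (h : riem_metric M) (a : kform k M) : Prop :=
  forall (x : M) (e : 'M[R]_(k, n)), e *m h x *m e^T = 1%:M -> a x e <= 1.

Definition closed_calibration (R : realType) (k n : nat) (M : manifold R n)
    (h : riem_metric M) (a : kform k M) : Prop :=
  calibration h a /\ forall x V, ext_d a x V = 0.

Definition smooth_map (R : realType) (k n : nat) (L : manifold R k)
    (M : manifold R n) (u : L -> M) : Prop :=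
  continuous u /\
  forall (c : chart R k L) (d : chart R n M), atlas c -> atlas d ->
    smooth_on [set y | img c y /\ dom d (u (inv c y))] (d \o u \o inv c).

Definition smooth_family (R : realType) (k n : nat) (L : manifold R k)
    (M : manifold R n) (eps : R) (u : R -> L -> M) : Prop :=
  (forall t x, `|t| < eps ->
     {for (t, x), continuous (fun p : R * L => u p.1 p.2)}) /\
  forall (c : chart R k L) (d : chart R n M), atlas c -> atlas d ->
    smooth_on
      [set p : R * 'rV[R]_k |
        [/\ `|p.1| < eps, img c p.2 & dom d (u p.1 (inv c p.2))]]
      (fun p => d (u p.1 (inv c p.2))).

Definition differential (R : realType) (k n : nat) (L : manifold R k)
    (M : manifold R n) (u : L -> M) (x : L) : 'M[R]_(k, n) :=
  jacobian (chart_at (u x) \o u \o inv (chart_at x)) (chart_at x x).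

Definition pull_metric (R : realType) (k n : nat) (L : manifold R k)
    (M : manifold R n) (u : L -> M) (h : riem_metric M) (x : L) : 'M[R]_k :=
  differential u x *m h (u x) *m (differential u x)^T.

Definition pull_form (R : realType) (k n l : nat) (L : manifold R k)
    (M : manifold R n) (u : L -> M) (a : kform l M) (x : L)
    (V : 'M[R]_(l, k)) : R := a (u x) (V *m differential u x).

Definition du_norm (R : realType) (k n : nat) (L : manifold R k)
    (M : manifold R n) (g : riem_metric L) (h : riem_metric M) (u : L -> M)
    (x : L) : R :=
  Num.sqrt (\tr (invmx (g x) *m pull_metric u h x)).

(* The charts in [atlas] are positively oriented when [oriented L] holds. *)
Definition vol (R : realType) (k : nat) (L : manifold R k) (g : riem_metric L)
    (x : L) (V : 'M[R]_k) : R := Num.sqrt (\det (g x)) * \det V.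

Definition smith_immersion (R : realType) (k n : nat) (L : manifold R k)
    (M : manifold R n) (g : riem_metric L) (h : riem_metric M) (a : kform k M)
    (u : L -> M) : Prop :=
  smooth_map u /\
  forall x : L,
    (forall V : 'M[R]_k, pull_form u a x V =
       (Num.sqrt k%:R ^+ k)^-1 * du_norm g h u x ^+ k * vol g x V) /\
    pull_metric u h x = (k%:R^-1 * du_norm g h u x ^+ 2) *: g x.

Record unity_partition (R : realType) (k : nat) (L : manifold R k) :=
  UnityPartition {
  pu_size : nat;
  pu_chart : 'I_pu_size -> chart R k L;
  pu_fun : 'I_pu_size -> L -> R;
  pu_atlas : forall i, atlas (pu_chart i);
  pu_smooth : forall i c, atlas c -> smooth_on (img c) (pu_fun i \o inv c);
  pu_ge0 : forall i x, 0 <= pu_fun i x;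
  pu_support : forall i,
    closure [set x | pu_fun i x != 0] `<=` dom (pu_chart i);
  pu_sum : forall x, \sum_i pu_fun i x = 1 }.

(* Lebesgue integral over R^n, for continuous compactly supported f. *)
Fixpoint iterated_integral (R : realType) (n : nat) :
    ('rV[R]_n -> R) -> R :=
  match n with
  | 0%N => fun f => f 0
  | m.+1 => fun f => \int[lebesgue_measure]_(s in [set: R])
      iterated_integral (fun y : 'rV[R]_m => f (row_mx (s%:M : 'M[R]_1) y))
  end.

(* Integral of a top-degree form over a compact oriented manifold, as
   sum_i int_{R^k} (c_i^{-1})^*(rho_i w); it does not depend on the partition
   of unity (rho_i), whose members are subordinate to positive charts c_i. *)
Definition integral_form (R : realType) (k : nat) (L : manifold R k)
    (P : unity_partition L) (w : L -> 'M[R]_k -> R) : R :=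
  \sum_(i < pu_size P) iterated_integral
    ((fun y => pu_fun i (inv (pu_chart i) y) * in_chart w (pu_chart i) y 1%:M)
       \_ (img (pu_chart i))).

Definition k_energy (R : realType) (k n : nat) (L : manifold R k)
    (M : manifold R n) (P : unity_partition L) (g : riem_metric L)
    (h : riem_metric M) (u : L -> M) : R :=
  (Num.sqrt k%:R ^+ k)^-1 *
  integral_form P (fun x V => du_norm g h u x ^+ k * vol g x V).

Definition k_harmonic (R : realType) (k n : nat) (L : manifold R k)
    (M : manifold R n) (P : unity_partition L) (g : riem_metric L)
    (h : riem_metric M) (u : L -> M) : Prop :=
  forall (eps : R) (F : R -> L -> M), 0 < eps -> smooth_family eps F ->
    F 0 = u ->
    is_derive (0 : R) (1 : R) (fun t => k_energy P g h (F t)) (0 : R).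

(* Main.v *)
(* For a variation [F] of the Smith immersion [u], let [e_t] be the density of the k-energy and
   [a_t] the density of the pullback of the calibration by [F t]. The calibration condition
   together with AM-GM gives [a_t <= e_t] pointwise, with equality at [t = 0] by the Smith
   equation; hence both have the same derivative at [t = 0]. As the calibration is closed, the
   derivative of [a_t] is an exact form [d beta] with [beta] the contraction by the velocity
   field, and its integral over the compact manifold vanishes: integrating by parts in each
   chart against a partition of unity [rho_i] leaves the top-degree forms [d rho_i /\ beta],
   whose integrals do not depend on the chart used to compute them, and whose sum is
   [d 1 /\ beta = 0].

   The change of variables formula behind the last step is itself obtained from the identity for
   closed forms: the integral of [f (phi x) \det (D phi)] is invariant under homotopies of [phi]
   that keep the support of [f] compact, so [phi] can be deformed locally to its linear part, and
   the linear part to the identity. *)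

Require Import Defs.
From HB Require Import structures.
From mathcomp Require Import all_boot all_order all_algebra perm.
From mathcomp Require Import all_classical all_reals all_analysis.
From mathcomp Require Import ring lra.

Set Implicit Arguments.
Unset Strict Implicit.
Unset Printing Implicit Defensive.

Import Order.TTheory GRing.Theory Num.Theory.
Import numFieldNormedType.Exports.
(* [functions] also declares [inv] and [invK]. *)
Import Defs.

Local Open Scope classical_set_scope.
Local Open Scope ring_scope.

(** * Calculus of iterated directional derivatives *)

(** [diff_class] records only iterated directional derivatives, and [iterated_integral] only nested
    one-dimensional integrals. The Fréchet chain rule, symmetry of second derivatives, linearity of
    the integral and differentiation under it are therefore derived from scratch; for continuous
    compactly supported functions, uniform continuity replaces dominated convergence. Two obstacles
    shape the rest. First, [|du|^k] must be C^1 in time even where [du] vanishes; this is where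
    [2 <= k] enters. Second, integration by parts leaves the i-th boundary term in the i-th chart,
    so the terms cannot be added pointwise. Each is multiplied by the sum of all [rho_l], and the
    (i, l) product, supported in both charts, is moved from chart i to chart l, where the sum over i
    vanishes. Change of variables serves only this move, so a version for C^1 functions supported in
    the overlap and maps of positive Jacobian is enough. Tangent vectors are written in [chart_at],
    which may jump from point to point; hence every density is rewritten in fixed charts before it
    is differentiated. *)

Section DiffClass.
Context {R : realType}.
Implicit Types V W : normedModType R.

Lemma diff_class_continuous r V W (U : set V) (f : V -> W) x :
  diff_class r U f -> U x -> {for x, continuous f}.
Proof. by case: r => [|r] [cf _] Ux; exact: cf. Qed.

Lemma diff_class_derivable r V W (U : set V) (f : V -> W) x v :
  diff_class r.+1 U f -> U x -> derivable f x v.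
Proof. by case=> _ /(_ v)[df _]; exact: df. Qed.

Lemma diff_class_derive r V W (U : set V) (f : V -> W) v :
  diff_class r.+1 U f -> diff_class r U ('D_v f).
Proof. by case=> _ /(_ v)[]. Qed.

Lemma diff_class_pred r V W (U : set V) (f : V -> W) :
  diff_class r.+1 U f -> diff_class r U f.
Proof.
elim: r f => [|r IH] f /= [cf df]; split=> // v.
by split; [case: (df v)|apply: IH; case: (df v)].
Qed.

Lemma diff_class_le r s V W (U : set V) (f : V -> W) :
  (r <= s)%N -> diff_class s U f -> diff_class r U f.
Proof.
move=> /subnK <-; elim: (s - r)%N => // m IH.
by rewrite addSn => /diff_class_pred.
Qed.

Lemma diff_class_sub r V W (U U' : set V) (f : V -> W) :
  U' `<=` U -> diff_class r U f -> diff_class r U' f.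
Proof.
move=> sub; elim: r f => [|r IH] f [cf df]; split=> //; first by move=> x /sub/cf.
  by move=> x /sub/cf.
by move=> v; have [df1 df2] := df v; split; [move=> x /sub/df1|exact: IH].
Qed.

Lemma near_eq_continuous (T : topologicalType) (S : topologicalType)
    (f g : T -> S) x :
  (\near x, f x = g x) -> {for x, continuous f} -> {for x, continuous g}.
Proof.
move=> fg cf; rewrite /prop_for /continuous_at -(nbhs_singleton fg).
by apply: cvg_trans cf; exact: near_eq_cvg.
Qed.

Lemma near_eq_in_open (T : topologicalType) (S : Type) (U : set T)
    (f g : T -> S) x : open U -> (forall x, U x -> f x = g x) -> U x ->
  \near x, f x = g x.
Proof.
by move=> oU fg Ux; apply: filterS (open_nbhs_nbhs (conj oU Ux)).
Qed.

Lemma eq_diff_class r V W (U : set V) (f g : V -> W) : open U ->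
  (forall x, U x -> f x = g x) -> diff_class r U f -> diff_class r U g.
Proof.
move=> oU; elim: r f g => [|r IH] f g fg [cf df]; split=> //.
- by move=> x Ux; apply: near_eq_continuous (cf _ Ux); exact: near_eq_in_open Ux.
- by move=> x Ux; apply: near_eq_continuous (cf _ Ux); exact: near_eq_in_open Ux.
move=> v; have [df1 df2] := df v; split.
  by move=> x Ux; apply: near_eq_derivable (df1 _ Ux); exact: near_eq_in_open Ux.
apply: IH df2 => x Ux; apply: near_eq_derive; exact: near_eq_in_open Ux.
Qed.

Lemma diff_class_cst r V W (U : set V) (c : W) : diff_class r U (fun=> c).
Proof.
elim: r c => [|r IH] c; split=> //; try by move=> x _; exact: cst_continuous.
move=> v; split; first by move=> x _; exact: derivable_cst.
rewrite (_ : 'D_v _ = fun=> 0); first exact: IH.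
by apply/funext => x; rewrite derive_cst.
Qed.

Lemma diff_classD r V W (U : set V) (f g : V -> W) : open U ->
  diff_class r U f -> diff_class r U g -> diff_class r U (fun x => f x + g x).
Proof.
move=> oU; elim: r f g => [|r IH] f g [cf df] [cg dg]; split=> //;
  try by move=> x Ux; apply: continuousD; [exact: cf|exact: cg].
move=> v; have [df1 df2] := df v; have [dg1 dg2] := dg v; split.
  by move=> x Ux; apply: derivableD; [exact: df1|exact: dg1].
apply: (eq_diff_class oU _ (IH _ _ df2 dg2)) => x Ux.
by rewrite (deriveD (df1 _ Ux) (dg1 _ Ux)).
Qed.

Lemma diff_class_sum r V W (U : set V) (I : Type) (s : seq I) (P : pred I)
    (f : I -> V -> W) : open U -> (forall i, P i -> diff_class r U (f i)) ->
  diff_class r U (fun x => \sum_(i <- s | P i) f i x).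
Proof.
move=> oU df; elim: s => [|i s IH].
  by apply: (eq_diff_class oU _ (diff_class_cst r U 0)) => x _; rewrite big_nil.
case: (boolP (P i)) => Pi.
  apply: (eq_diff_class oU _ (diff_classD oU (df _ Pi) IH)) => x _.
  by rewrite big_cons Pi.
by apply: (eq_diff_class oU _ IH) => x _; rewrite big_cons (negbTE Pi).
Qed.

Lemma diff_classM r V (U : set V) (f g : V -> R) : open U ->
  diff_class r U f -> diff_class r U g -> diff_class r U (fun x => f x * g x).
Proof.
move=> oU; elim: r f g => [|r IH] f g df dg.
  case: df dg => [cf _] [cg _]; split=> // x Ux.
  by apply: continuousM; [exact: cf|exact: cg].
have [pf pg] := (diff_class_pred df, diff_class_pred dg).
case: df dg => [cf df] [cg dg]; split.
  by move=> x Ux; apply: continuousM; [exact: cf|exact: cg].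
move=> v; have [df1 df2] := df v; have [dg1 dg2] := dg v; split.
  by move=> x Ux; apply: derivableM; [exact: df1|exact: dg1].
apply: (eq_diff_class oU _ (diff_classD oU (IH _ _ pf dg2) (IH _ _ pg df2))).
by move=> x Ux; rewrite (deriveM (df1 _ Ux) (dg1 _ Ux)).
Qed.

Lemma diff_class_prod r V (U : set V) (I : Type) (s : seq I)
    (f : I -> V -> R) : open U -> (forall i, diff_class r U (f i)) ->
  diff_class r U (fun x => \prod_(i <- s) f i x).
Proof.
move=> oU df; elim: s => [|i s IH].
  by apply: (eq_diff_class oU _ (@diff_class_cst r V R U 1)) => x _; rewrite big_nil.
apply: (eq_diff_class oU _ (diff_classM oU (df i) IH)) => x _.
by rewrite big_cons.
Qed.

Lemma diff_classN r V (U : set V) (f : V -> R) : open U ->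
  diff_class r U f -> diff_class r U (fun x => - f x).
Proof.
move=> oU df; apply: (eq_diff_class oU _ (diff_classM oU (@diff_class_cst r V R U (-1)) df)).
by move=> x _; rewrite mulN1r.
Qed.

Lemma diff_classB r V (U : set V) (f g : V -> R) : open U ->
  diff_class r U f -> diff_class r U g -> diff_class r U (fun x => f x - g x).
Proof. by move=> oU df dg; apply: diff_classD => //; exact: diff_classN. Qed.

Lemma le_mx_norm m n (M : 'M[R]_(m, n)) i j : `|M i j| <= `|M|.
Proof. by rewrite [leRHS]/Num.Def.normr /= mx_normrE (le_bigmax _ _ (i, j)). Qed.

Lemma mx_norm_le m n (M : 'M[R]_(m, n)) c :
  0 <= c -> (forall i j, `|M i j| <= c) -> `|M| <= c.
Proof.
move=> c0 Mc; rewrite [leLHS]/Num.Def.normr /= mx_normrE.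
by apply: bigmax_le => // -[i j] _ /=.
Qed.

Lemma continuous_mxP (T : topologicalType) m n (f : T -> 'M[R]_(m, n)) x :
  {for x, continuous f} <-> forall i j, {for x, continuous (fun y => f y i j)}.
Proof.
split=> [cf i j|cf].
  apply: (@continuous_comp _ _ _ f (fun M : 'M[R]_(m, n) => M i j)) => //.
  exact: coord_continuous.
apply/cvgrPdist_le => /= e e0.
near=> y; apply: mx_norm_le; first exact: ltW.
move=> i j; rewrite !mxE; move: i j; near: y.
apply: filter_forall => i; apply: filter_forall => j.
by have /cvgrPdist_le := cf i j; exact.
Unshelve. all: by end_near. Qed.

Lemma diff_class_mxP r V m n (U : set V) (f : V -> 'M[R]_(m, n)) : open U ->
  diff_class r U f <-> forall i j, diff_class r U (fun x => f x i j).
Proof.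
move=> oU; elim: r f => [|r IH] f.
  split=> [[cf _] i j|cf]; split=> // x Ux.
    by move/continuous_mxP: (cf x Ux).
  by apply/continuous_mxP => i j; case: (cf i j) => + _; apply.
split=> [[cf df] i j|df].
  split; first by move=> x Ux; move/continuous_mxP: (cf x Ux).
  move=> v; have [df1 df2] := df v; split.
    by move=> x Ux; move/derivable_mxP: (df1 x Ux).
  have {df2} := (IH _).1 df2 i j; apply: eq_diff_class => // x Ux.
  by rewrite derive_mx ?mxE//; exact: df1.
split.
  by move=> x Ux; apply/continuous_mxP => i j; case: (df i j) => + _; apply.
move=> v; have df1 x : U x -> derivable f x v.
  by move=> Ux; apply/derivable_mxP => i j; exact: diff_class_derivable (df i j) Ux.
split=> //; apply/IH => i j.
apply: eq_diff_class (diff_class_derive v (df i j)) => // x Ux.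
by rewrite derive_mx ?mxE//; exact: df1.
Qed.

(** An affine substitution leaves the difference quotients literally unchanged, with direction
    [l0 v]. So the class passes through [l] between arbitrary normed spaces, without chain rule or
    Fréchet differentiability. *)
Lemma diff_class_affine r V V' W (U : set V) (f : V -> W) (l l0 : V' -> V) :
  (forall x v (t : R), l (t *: v + x) = t *: l0 v + l x) -> continuous l ->
  diff_class r U f -> diff_class r (l @^-1` U) (f \o l).
Proof.
move=> ll cl; elim: r f => [|r IH] f [cf df]; split=> //;
  try by move=> x Ux; apply: continuous_comp; [exact: cl|exact: cf].
move=> v; have [df1 df2] := df (l0 v).
have E x : (fun h : R => h^-1 *: ((f \o l \o shift x) (h *: v) - (f \o l) x)) =
    (fun h : R => h^-1 *: ((f \o shift (l x)) (h *: l0 v) - f (l x))).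
  by apply/funext => h /=; rewrite ll.
split; first by move=> x Ux; rewrite /derivable E; exact: df1.
rewrite (_ : 'D_v _ = 'D_(l0 v) f \o l); first exact: IH.
by apply/funext => x; rewrite /derive E.
Qed.

Lemma derive_affine V V' W (f : V -> W) (l : V' -> V) x v w :
  (forall t : R, l (t *: v + x) = t *: w + l x) ->
  'D_v (f \o l) x = 'D_w f (l x).
Proof.
move=> ll; rewrite /derive; set g1 := fun h => _; set g2 := fun h => _.
by suff -> : g1 = g2 by []; apply/funext => h; rewrite /g1 /g2 /= ll.
Qed.

Lemma derivable_affine V V' W (f : V -> W) (l : V' -> V) x v w :
  (forall t : R, l (t *: v + x) = t *: w + l x) ->
  derivable f (l x) w -> derivable (f \o l) x v.
Proof.
move=> ll; rewrite /derivable; set g1 := fun h => _; set g2 := fun h => _.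
by suff -> : g1 = g2 by []; apply/funext => h; rewrite /g1 /g2 /= ll.
Qed.

(** Only [f] is Fréchet differentiable; [g] merely has a derivative along [v]. Restricting [g] to
    the line through [x] gives a curve on [R], where derivability and differentiability coincide and
    the usual chain rule applies. *)
Lemma is_derive_comp_diff V V' W (f : V -> W) (g : V' -> V) x v :
  derivable g x v -> differentiable f (g x) ->
  is_derive x v (f \o g) ('D_('D_v g x) f (g x)).
Proof.
move=> dg df; pose c (h : R) := g (h *: v + x).
have c0 : c 0 = g x by rewrite /c scale0r add0r.
have dc : differentiable c 0.
  exact: ((derivable1_diffP _ _).1 ((derivable1P _ _ _).1 dg)).
have Dc : 'D_1 c 0 = 'D_v g x.
  rewrite (@derive_affine _ _ _ g (fun h : R => h *: v + x) 0 1 v).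
    by rewrite scale0r add0r.
  by move=> t; rewrite scale0r add0r addr0 [t *: 1]mulr1.
have dfc : differentiable (f \o c) 0 by apply: differentiable_comp; rewrite ?c0.
apply: DeriveDef; first by apply/derivable1P/derivable1_diffP.
rewrite -[X in 'D_v _ X]add0r -(scale0r v).
rewrite -(@derive_affine _ _ _ (f \o g) (fun h : R => h *: v + x) 0 1 v).
  rewrite [LHS]deriveE// (_ : _ \o _ = f \o c)//.
  by rewrite diff_comp ?c0//= -(deriveE _ dc) Dc [RHS]deriveE.
by move=> t; rewrite scale0r add0r addr0 [t *: 1]mulr1.
Qed.

Lemma dir_mvt V (f : V -> R) (p v : V) (a : R) :
  (forall s : R, `|s| <= `|a| -> derivable f (s *: v + p) v) ->
  exists2 s : R, `|s| <= `|a| & f (a *: v + p) - f p = a * 'D_v f (s *: v + p).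
Proof.
have key (q : V) (b : R) : 0 <= b ->
    (forall s : R, 0 <= s <= b -> derivable f (s *: v + q) v) ->
    exists2 s : R, 0 <= s <= b &
      f (b *: v + q) - f q = b * 'D_v f (s *: v + q).
  move=> b0 df; pose g (s : R) := f (s *: v + q).
  have ll (s : R) (t : R) : (t *: (1 : R) + s) *: v + q = t *: v + (s *: v + q).
    by rewrite [t *: 1]mulr1 scalerDl addrA.
  have gd s : s \in `[0, b] -> is_derive s (1 : R) g ('D_v f (s *: v + q)).
    rewrite in_itv /= => sb; apply: DeriveDef.
      by apply: (derivable_affine (w := v) (ll s)); exact: df.
    by rewrite (derive_affine f (ll s)).
  have gd' s : s \in `]0, b[ -> is_derive s (1 : R) g ('D_v f (s *: v + q)).
    by move=> sb; apply: gd; exact: subset_itv_oo_cc.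
  have gc : {within `[0, b], continuous g}.
    by apply: derivable_within_continuous => s /gd[].
  have [s sb E] := @MVT_segment R g (fun s => 'D_v f (s *: v + q)) 0 b b0 gd' gc.
  exists s; first by move: sb; rewrite in_itv.
  by move: E; rewrite /g scale0r add0r subr0 mulrC.
move=> df; have [a0|/ltW a0] := leP 0 a.
  have [|s sb E] := key p a a0.
    by move=> s /andP[s0 sa]; apply: df; rewrite !ger0_norm.
  by exists s => //; case/andP: sb => s0 sa; rewrite !ger0_norm.
(* For negative [a] the segment is traversed from its other end, with length [- a]. *)
have [||s /andP[s0 sb] E] := key (a *: v + p) (- a); first by rewrite oppr_ge0.
  move=> s /andP[s0 sb]; rewrite addrA -scalerDl; apply: df.
  by rewrite !ler0_norm ?lerN2; lra.
exists (s + a); first by rewrite !ler0_norm ?lerN2; lra.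
move: E; rewrite !addrA -!scalerDl addNr scale0r add0r => E.
by apply: oppr_inj; rewrite opprB E mulNr.
Qed.

Lemma rV_sum_delta n (v : 'rV[R]_n) : v = \sum_j v 0 j *: delta_mx 0 j.
Proof.
by rewrite {1}[v]row_sum_delta.
Qed.

(** Walk from [x] to [h + x] changing one coordinate at a time, use the mean value theorem on each
    leg, and compare the partial derivative found there with its value at [x], to which it is close
    by continuity. *)
Lemma diff_class1_approx n (U : set 'rV[R]_n) (f : 'rV[R]_n -> R) x e :
  open U -> diff_class 1 U f -> U x -> 0 < e ->
  \forall h \near (0 : 'rV[R]_n),
    `|f (h + x) - f x - \sum_j h 0 j * 'D_(delta_mx 0 j) f x| <= e * `|h|.
Proof.
move=> oU df Ux e0.
(* Each of the [n] legs contributes an error of at most [d * |h|]; the [+ 1] keeps the denominator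
   positive for [n = 0]. *)
pose d := e / (n%:R + 1).
have n1 : 0 < n%:R + 1 :> R by rewrite ltr_wpDl.
have d0 : 0 < d by rewrite divr_gt0.
have : \forall y \near x, U y /\ forall j : 'I_n,
    `|'D_(delta_mx 0 j) f x - 'D_(delta_mx 0 j) f y| <= d.
  near=> y; split; first by near: y; exact: (open_nbhs_nbhs (conj oU Ux)).
  near: y; apply: filter_forall => j.
  have /cvgrPdist_le := diff_class_continuous (diff_class_derive (delta_mx 0 j) df) Ux.
  exact.
move=> /nbhs_ballP[r /= r0 br]; near=> h.
have hr : `|h| < r.
  near: h; apply/nbhs_ballP; exists r => //= h.
  by rewrite -ball_normE /= sub0r normrN.
pose p (j : nat) : 'rV[R]_n := x + \row_i (if (i < j)%N then h 0 i else 0).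
have pS (j : 'I_n) : p j.+1 = h 0 j *: delta_mx 0 j + p j.
  apply/rowP => i; rewrite !mxE eqxx/= addrCA; congr (_ + _).
  rewrite ltnS -(inj_eq val_inj)/=; case: ltngtP => [||/val_inj ->];
    by rewrite ?mulr0 ?add0r ?mulr1 ?addr0.
have pball (j : 'I_n) s : `|s| <= `|h 0 j| -> ball x r (s *: delta_mx 0 j + p j).
  move=> sh; rewrite -ball_normE /=; apply: le_lt_trans hr.
  apply: mx_norm_le => // i0 i; rewrite !ord1 !mxE eqxx/=.
  rewrite (_ : x 0 i - _ = - (s * (i == j)%:R + if (i < j)%N then h 0 i else 0)); last by ring.
  rewrite normrN -(inj_eq val_inj)/=; case: ltngtP => _.
  - by rewrite mulr0 add0r le_mx_norm.
  - by rewrite mulr0 add0r normr0.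
  - by rewrite mulr1 addr0 (le_trans sh)// le_mx_norm.
have step (j : 'I_n) : exists2 y, ball x r y &
    f (p j.+1) - f (p j) = h 0 j * 'D_(delta_mx 0 j) f y.
  have [|s sh E] := @dir_mvt _ f (p j) (delta_mx 0 j) (h 0 j).
    move=> s sh; have [Us _] := br _ (pball _ _ sh).
    exact: (diff_class_derivable df Us).
  by exists (s *: delta_mx 0 j + p j); [exact: pball|rewrite pS].
have p0 : p 0 = x by apply/rowP => i; rewrite !mxE addr0.
have pn : p n = h + x by apply/rowP => i; rewrite !mxE ltn_ord addrC.
rewrite -pn -[in X in _ - X - _]p0 -(telescope_sumr (f \o p))// big_mkord -sumrB.
apply: (le_trans (ler_norm_sum _ _ _)).
apply: (@le_trans _ _ (\sum_(j < n) d * `|h|)).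
  apply: ler_sum => j _ /=; have [y yr ->] := step j.
  rewrite -mulrBr normrM mulrC; apply: ler_pM => //; last exact: le_mx_norm.
  by rewrite distrC; have [_] := br _ yr; apply.
rewrite sumr_const card_ord -mulr_natl mulrA ler_wpM2r// /d mulrCA.
by rewrite ger_pMr// ler_pdivrMr// mul1r lerDl.
Unshelve. all: by end_near. Qed.

Lemma differentiable_remainder V W (f : V -> W) x (df : {linear V -> W}) :
  continuous df ->
  (forall e, 0 < e -> \forall h \near (0 : V),
    `|f (h + x) - f x - df h| <= e * `|h|) -> differentiable f x.
Proof.
move=> cdf approx.
have E : f \o shift x = cst (f x) + df +o_ 0 id.
  apply/eqaddoP => e e0; have := approx _ e0.
  by apply: filterS => h; rewrite !fctE /= opprD addrA.
by apply/diff_locallyP; rewrite (diff_unique cdf E).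
Qed.

Lemma diff_class1_differentiable_real n (U : set 'rV[R]_n) (f : 'rV[R]_n -> R) x :
  open U -> diff_class 1 U f -> U x -> differentiable f x.
Proof.
move=> oU df Ux.
pose d (h : 'rV[R]_n) : R := \sum_j h 0 j * 'D_(delta_mx 0 j) f x.
have lin_d : linear d.
  move=> a u v; rewrite /d scaler_sumr -big_split/=; apply: eq_bigr => j _.
  by rewrite !mxE mulrDl -mulrA.
pose dM := GRing.isLinear.Build _ _ _ _ _ lin_d.
pose dL : {linear _ -> _} := HB.pack d dM.
apply: (@differentiable_remainder _ _ _ _ dL); last first.
  by move=> e e0; exact: (diff_class1_approx oU df Ux e0).
have cd : diff_class 0 setT d.
  apply: diff_class_sum => [|j _]; first exact: openT.
  apply: diff_classM; [exact: openT| |exact: diff_class_cst].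
  by split=> // y _; exact: coord_continuous.
by move=> y; exact: (diff_class_continuous cd).
Qed.

Lemma diff_class1_differentiable m n (U : set 'rV[R]_n) (f : 'rV[R]_n -> 'rV[R]_m) x :
  open U -> diff_class 1 U f -> U x -> differentiable f x.
Proof.
move=> oU /(diff_class_mxP 1 f oU) df Ux.
rewrite (_ : f = \sum_(j < m) (fun y => f y 0 j *: delta_mx 0 j)).
  apply: differentiable_sum => j; apply: differentiableZl.
  exact: diff_class1_differentiable_real (df 0 j) Ux.
by apply/funext => y; rewrite fct_sumE -rV_sum_delta.
Qed.

Lemma derive_comp_coord V n W (f : 'rV[R]_n -> W) (g : V -> 'rV[R]_n) x v :
  derivable g x v -> differentiable f (g x) ->
  is_derive x v (f \o g)
    (\sum_j 'D_v (fun y => g y 0 j) x *: 'D_(delta_mx 0 j) f (g x)).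
Proof.
move=> dg df; have D := is_derive_comp_diff dg df.
apply: is_derive_eq; rewrite deriveE// derive_mx//.
rewrite [X in 'd f _ X]rV_sum_delta linear_sum; apply: eq_bigr => j _.
by rewrite linearZZ; congr (_ *: _); rewrite ?mxE// deriveE.
Qed.

(** The chain rule writes a directional derivative of [f \o g] as a sum of products of derivatives
    of the coordinates of [g] and partial derivatives of [f] composed with [g], all of class one
    lower, so induction on [r] closes. *)
Lemma diff_class_comp r V n (U : set V) (O : set 'rV[R]_n) (f : 'rV[R]_n -> R)
    (g : V -> 'rV[R]_n) : open U -> open O -> (forall x, U x -> O (g x)) ->
  diff_class r U g -> diff_class r O f -> diff_class r U (f \o g).
Proof.
move=> oU oO gO; elim: r f g gO => [|r IH] f g gO dg df.
  split=> // x Ux; apply: continuous_comp; first exact: diff_class_continuous dg Ux.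
  exact: diff_class_continuous df (gO _ Ux).
have dfx x : U x -> differentiable f (g x).
  by move=> Ux; apply: (diff_class1_differentiable_real oO _ (gO _ Ux)); exact: diff_class_le df.
split.
  move=> x Ux; apply: continuous_comp; first exact: diff_class_continuous dg Ux.
  exact: diff_class_continuous df (gO _ Ux).
move=> v; have D x (Ux : U x) := derive_comp_coord (@diff_class_derivable _ _ _ _ _ x v dg Ux) (dfx x Ux).
split; first by move=> x /D[].
apply: (@eq_diff_class _ _ _ U (fun x => \sum_j 'D_v (fun y => g y 0 j) x *
    ('D_(delta_mx 0 j) f \o g) x)) => //.
  by move=> x Ux; have [_ ->] := D x Ux.
apply: diff_class_sum => // j _; apply: diff_classM => //.
  by apply: diff_class_derive; move/diff_class_mxP: dg; apply.
apply: IH => //; first exact: diff_class_pred.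
exact: diff_class_derive.
Qed.

Let ler_distD_half (p q s e : R) :
  `|p - s| <= e / 2 -> `|q - s| <= e / 2 -> `|p - q| <= e.
Proof. by rewrite !ler_norml => /andP[? ?] /andP[? ?]; apply/andP; split; lra. Qed.

Let subr_ACA (p q s t : R) : p - q - (s - t) = p - s - (q - t).
Proof. by ring. Qed.

(** The mixed second difference of [f] over a small parallelogram with sides [a *: v] and [a *: w]
    does not depend on the order of [v] and [w]. Two uses of the mean value theorem, in either
    order, make it [a ^+ 2] times a mixed derivative at a nearby point, and continuity at [x]
    identifies the two. *)
Lemma derive_sym V (U : set V) (f : V -> R) x v w :
  open U -> diff_class 2 U f -> U x -> 'D_v ('D_w f) x = 'D_w ('D_v f) x.
Proof.
move=> oU df Ux; apply/eqP; rewrite -subr_eq0 -normr_le0; apply/ler_addgt0Pl => e e0.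
rewrite addr0.
have ball2 v' w' : \forall y \near x, `|'D_v' ('D_w' f) x - 'D_v' ('D_w' f) y| <= e / 2.
  have /cvgrPdist_le := diff_class_continuous
    (diff_class_derive v' (diff_class_derive w' df)) Ux.
  by apply; rewrite divr_gt0.
have : \forall y \near x, [/\ U y, `|'D_v ('D_w f) x - 'D_v ('D_w f) y| <= e / 2 &
    `|'D_w ('D_v f) x - 'D_w ('D_v f) y| <= e / 2].
  have B1 := ball2 v w; have B2 := ball2 w v.
  have B0 := open_nbhs_nbhs (conj oU Ux).
  by apply: filterS (filterI B0 (filterI B1 B2)) => y [? []].
move=> /nbhs_ballP[r /= r0 br].
pose N := `|v| + `|w| + 1.
have N0 : 0 < N by rewrite ltr_wpDl// addr_ge0.
(* The parallelogram stays in the ball of radius [r], since [a * (|v| + |w|) <= r / 2]. *)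
pose a := r / 2 / N.
have a0 : 0 < a by rewrite !divr_gt0.
have inb s t : `|s| <= a -> `|t| <= a -> ball x r (s *: v + (t *: w + x)).
  move=> sa ta; rewrite -ball_normE /= addrA opprD addrCA subrr addr0 normrN.
  apply: (le_lt_trans (ler_normD _ _)); rewrite !normrZ.
  apply: (@le_lt_trans _ _ (a * N)).
    rewrite /N !mulrDr mulr1; have := ler_wpM2r (normr_ge0 v) sa.
    by have := ler_wpM2r (normr_ge0 w) ta; lra.
  by rewrite /a divfK ?gt_eqF//; lra.
have an : `|a| = a by rewrite gtr0_norm.
have key v' w' : (forall s t, `|s| <= a -> `|t| <= a -> ball x r (s *: v' + (t *: w' + x))) ->
    exists2 y, ball x r y & f (a *: v' + (a *: w' + x)) - f (a *: v' + x)
      - (f (a *: w' + x) - f x) = a * (a * 'D_w' ('D_v' f) y).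
  move=> inb'.
  pose g y := f (y + a *: w') - f y.
  have dg s : `|s| <= `|a| -> is_derive (s *: v' + x) v' g
      ('D_v' f (a *: w' + (s *: v' + x)) - 'D_v' f (s *: v' + x)).
    rewrite an => sa.
    have U1 : U (a *: w' + (s *: v' + x)).
      by rewrite addrCA; have [] := br _ (inb' s a sa _); rewrite ?an.
    have U2 : U (s *: v' + x).
      have := br _ (inb' s 0 sa _); rewrite normr0 (ltW a0) => /(_ isT)[].
      by rewrite scale0r add0r.
    have ll (t : R) : (t *: v' + (s *: v' + x)) + a *: w' =
        t *: v' + ((s *: v' + x) + a *: w') by rewrite -[LHS]addrA.
    have E : (s *: v' + x) + a *: w' = a *: w' + (s *: v' + x) by rewrite addrC.
    have d1 : is_derive (s *: v' + x) v' (f \o (fun y => y + a *: w'))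
        ('D_v' f (a *: w' + (s *: v' + x))).
      apply: DeriveDef; first by apply: (derivable_affine ll);
        rewrite E; exact: diff_class_derivable df U1.
      by rewrite (derive_affine f ll) E.
    have d2 : is_derive (s *: v' + x) v' f ('D_v' f (s *: v' + x)).
      by apply: DeriveDef => //; exact: diff_class_derivable df U2.
    exact: is_deriveB.
  have [|s sa E] := @dir_mvt _ g x v' a; first by move=> s /dg[].
  have [|t ta E2] := @dir_mvt _ ('D_v' f) (s *: v' + x) w' a.
    move=> t; rewrite an in sa *; move=> ta.
    rewrite addrCA; have [U1 _ _] := br _ (inb' s t sa ta).
    exact: (diff_class_derivable (diff_class_derive v' df) U1).
  exists (t *: w' + (s *: v' + x)).
    by rewrite addrCA; apply: inb'; rewrite -an.
  have [_ Eg] := dg s sa; move: E; rewrite Eg E2 => <-.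
  by rewrite /g -[a *: v' + x + _]addrA [x + _]addrC; ring.
have [y1 b1 E1] := key v w inb.
have [|y2 b2 E2] := key w v; first by move=> s t sa ta; rewrite addrCA; exact: inb.
have [_ B1 _] := br _ b2; have [_ _ B2] := br _ b1.
have E : 'D_w ('D_v f) y1 = 'D_v ('D_w f) y2.
  apply: (mulfI (lt0r_neq0 a0)); apply: (mulfI (lt0r_neq0 a0)).
  apply: (etrans (esym E1)); apply: etrans E2.
  by rewrite (addrCA (a *: w) (a *: v) x); exact: subr_ACA.
move: B1 B2; rewrite E; move: ('D_v _ x) ('D_w _ x) ('D_v _ y2) => p q s.
exact: ler_distD_half.
Unshelve. all: by end_near. Qed.

End DiffClass.

(** * Iterated integrals of compactly supported functions *)

(** The radius is explicit so that several functions can share one cube, on which the integral is at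
    most [(2 * r) ^+ m] times a sup bound. *)
Definition csupp (R : realType) (V : normedModType R) (r : R) (f : V -> R) :=
  continuous f /\ forall y, r < `|y| -> f y = 0.

Section Csupp.
Context {R : realType} {V : normedModType R}.
Implicit Types (f g : V -> R) (r : R).

Lemma csupp_le r r' f : r <= r' -> csupp r f -> csupp r' f.
Proof. by move=> rr' [cf sf]; split=> // y /(le_lt_trans rr')/sf. Qed.

Lemma csuppD r f g : csupp r f -> csupp r g -> csupp r (fun y => f y + g y).
Proof.
move=> [cf sf] [cg sg]; split=> [y|y ry]; last by rewrite sf// sg// addr0.
by apply: continuousD; [exact: cf|exact: cg].
Qed.

Lemma csuppZ r a f : csupp r f -> csupp r (fun y => a * f y).
Proof.
move=> [cf sf]; split=> [y|y ry]; last by rewrite sf// mulr0.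
by apply: continuousM; [exact: cst_continuous|exact: cf].
Qed.

Lemma csuppB r f g : csupp r f -> csupp r g -> csupp r (fun y => f y - g y).
Proof.
move=> cf /(csuppZ (-1)) cg; have := csuppD cf cg.
by congr csupp; apply/funext => y; rewrite mulN1r.
Qed.

Lemma csupp0 r : csupp r (fun _ : V => 0 : R).
Proof. by split=> // y; exact: cst_continuous. Qed.

Lemma csupp_sum (I : Type) (s : seq I) (P : pred I) r (F : I -> V -> R) :
  (forall i, P i -> csupp r (F i)) -> csupp r (fun y => \sum_(i <- s | P i) F i y).
Proof.
move=> cF; elim: s => [|i s IH].
  by rewrite (_ : (fun _ => _) = fun=> 0); [exact: csupp0|apply/funext => y; rewrite big_nil].
rewrite (_ : (fun _ => _) = fun y => (if P i then F i y else 0) + \sum_(i <- s | P i) F i y).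
  by apply: csuppD => //; case: (boolP (P i)) => [/cF//|_]; exact: csupp0.
by apply/funext => y; rewrite big_cons; case: ifP; rewrite ?add0r.
Qed.

End Csupp.

Section Integral1.
Context {R : realType}.
Implicit Types (f g : R -> R) (r : R).

Local Notation mu := (@lebesgue_measure R).

Lemma csupp_Rintegral_itv r f : csupp r f ->
  \int[mu]_(s in [set: R]) f s = \int[mu]_(s in `[- r, r]) f s.
Proof.
move=> [_ sf]; rewrite [RHS]Rintegral_mkcond; congr Rintegral.
apply/funext => s; rewrite patchE; case: ifPn => // /negP sr.
apply: sf; rewrite ltNge; apply/negP => sr'; apply: sr.
by rewrite inE /= in_itv/= -ler_norml.
Qed.

Lemma csupp_integrable r f : csupp r f ->
  mu.-integrable `[- r, r] (EFin \o f).
Proof.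
move=> [cf _]; apply: continuous_compact_integrable.
  exact: segment_compact.
exact: continuous_subspaceT.
Qed.

Lemma csupp_RintegralD r f g : csupp r f -> csupp r g ->
  \int[mu]_(s in [set: R]) (f s + g s) =
  \int[mu]_(s in [set: R]) f s + \int[mu]_(s in [set: R]) g s.
Proof.
move=> cf cg; rewrite (csupp_Rintegral_itv (csuppD cf cg)).
rewrite (csupp_Rintegral_itv cf) (csupp_Rintegral_itv cg).
by rewrite RintegralD//; exact: csupp_integrable.
Qed.

Lemma csupp_RintegralZ r a f : csupp r f ->
  \int[mu]_(s in [set: R]) (a * f s) = a * \int[mu]_(s in [set: R]) f s.
Proof.
move=> cf; rewrite (csupp_Rintegral_itv (csuppZ a cf)).
rewrite (csupp_Rintegral_itv cf).
by rewrite RintegralZl//; exact: csupp_integrable.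
Qed.

Lemma csupp_Rintegral_bound r f (c : R) : 0 <= r -> csupp r f ->
  (forall s, `|f s| <= c) -> `|\int[mu]_(s in [set: R]) f s| <= c * (2 * r).
Proof.
move=> r0 cf fc; rewrite (csupp_Rintegral_itv cf).
apply: le_trans; first by apply: le_normr_Rintegral => //; exact: csupp_integrable.
have cn : csupp r (fun s => `|f s|).
  case: cf => cf sf; split=> [s|s rs]; last by rewrite sf// normr0.
  by apply: (@continuous_comp _ _ _ f (fun x : R => `|x|)); [exact: cf|exact: norm_continuous].
apply: (@le_trans _ _ (\int[mu]_(s in `[- r, r]) c)).
  apply: le_Rintegral => //; first exact: csupp_integrable.
  apply: continuous_compact_integrable; first exact: segment_compact.
  by apply: continuous_subspaceT => s; exact: cst_continuous.
rewrite Rintegral_cst//= lebesgue_measure_itv/= lte_fin.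
case: ifPn => [_|]; first by rewrite -EFinB/= opprK; lra.
by rewrite /= mulr0 => _; rewrite mulr_ge0 ?mulr_ge0// (le_trans _ (fc 0)).
Qed.

End Integral1.

Section IteratedIntegral.
Context {R : realType}.

Definition rV_cons m (s : R) (y : 'rV[R]_m) : 'rV[R]_m.+1 :=
  row_mx (s%:M : 'M[R]_1) y.

Lemma rV_cons0 m s (y : 'rV[R]_m) : rV_cons s y 0 0 = s.
Proof.
rewrite /rV_cons (_ : 0 = lshift m (0 : 'I_1)); last exact: val_inj.
by apply: etrans (row_mxEl _ _ _ _) _; rewrite mxE eqxx.
Qed.

Lemma rV_consS m s (y : 'rV[R]_m) j : rV_cons s y 0 (lift ord0 j) = y 0 j.
Proof.
rewrite /rV_cons (_ : lift ord0 j = rshift 1 j); last exact: val_inj.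
by apply: etrans (row_mxEr _ _ _ _) _.
Qed.

Lemma rV_cons_linear m (a s t : R) (y z : 'rV[R]_m) :
  rV_cons (a * s + t) (a *: y + z) = a *: rV_cons s y + rV_cons t z.
Proof.
apply/rowP => i; rewrite [RHS]mxE [X in _ = X + _]mxE.
by case: (unliftP ord0 i) => [j|] ->; rewrite ?rV_consS ?rV_cons0// !mxE.
Qed.

Lemma rV_cons_continuous m :
  continuous (fun p : R * 'rV[R]_m => rV_cons p.1 p.2).
Proof.
move=> p; apply/continuous_mxP => i j; rewrite ord1.
case: (unliftP ord0 j) => [j'|] ->.
  under [X in {for _, continuous X}]eq_fun do rewrite rV_consS.
  apply: (@continuous_comp _ _ _ snd (fun y : 'rV[R]_m => y 0 j')).
    exact: cvg_snd.
  exact: coord_continuous.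
under [X in {for _, continuous X}]eq_fun do rewrite rV_cons0.
exact: cvg_fst.
Qed.

Lemma rV_cons_normr m s (y : 'rV[R]_m) : `|y| <= `|rV_cons s y|.
Proof.
by apply: mx_norm_le => // i j; rewrite ord1 -(rV_consS s) le_mx_norm.
Qed.

Lemma rV_cons_norml m s (y : 'rV[R]_m) : `|s| <= `|rV_cons s y|.
Proof. by rewrite -{1}(rV_cons0 s y) le_mx_norm. Qed.

Lemma pair_continuousr (S T : topologicalType) (s : S) (y : T) :
  {for y, continuous (fun y => (s, y))}.
Proof.
move=> P [[A B] /= [sA yB] AB]; apply: filterS yB => z Bz; apply: AB; split=> //=.
exact: nbhs_singleton sA.
Qed.

Lemma pair_continuousl (S T : topologicalType) (s : S) (y : T) :
  {for s, continuous (fun s => (s, y))}.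
Proof.
move=> P [[A B] /= [sA yB] AB]; apply: filterS sA => z Bz; apply: AB; split=> //=.
exact: nbhs_singleton yB.
Qed.

Lemma csupp_rV_cons m r (f : 'rV[R]_m.+1 -> R) s : csupp r f ->
  csupp r (fun y => f (rV_cons s y)).
Proof.
move=> [cf sf]; split=> [y|y ry].
  apply: (@continuous_comp _ _ _ (fun y => rV_cons s y) f); last exact: cf.
  apply: (@continuous_comp _ _ _ (fun y => (s, y)) (fun p : R * 'rV[R]_m => rV_cons p.1 p.2)).
    exact: pair_continuousr.
  exact: rV_cons_continuous.
by apply: sf; exact: lt_le_trans ry (rV_cons_normr _ _).
Qed.

Lemma closed_ball0_compact n (r : R) : compact [set y : 'rV[R]_n | `|y| <= r].
Proof.
apply: bounded_closed_compact.
  by exists r; split; [exact: num_real|move=> x rx y /= /le_trans -> //; exact: ltW].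
apply: (@closed_comp _ _ (fun y : 'rV[R]_n => `|y|) [set x : R | x <= r]).
  by move=> y _; exact: norm_continuous.
exact: closed_le.
Qed.

(** A tube-lemma argument: the estimate holds on a product neighbourhood of each [(s0, y)], and
    compactness of [K] leaves one neighbourhood of [s0] for all [y]. *)
Lemma compact_unif_continuous (S T : topologicalType) (K : set T) (g : S * T -> R) s0 (e : R) :
  compact K -> (forall y, K y -> {for (s0, y), continuous g}) -> 0 < e ->
  \forall s \near s0, forall y, K y -> `|g (s0, y) - g (s, y)| <= e.
Proof.
move=> cK cg e0.
pose P (s : S) (y : T) := `|g (s0, y) - g (s, y)| <= e.
have := (compact_near_coveringP K).1 cK S (nbhs s0) P _; apply=> y Ky.
have e20 : 0 < e / 2 by rewrite divr_gt0.
have /cvgrPdist_le/(_ _ e20) : {for (s0, y), continuous g} by exact: cg.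
move=> [[A B] /= [As By] AB].
exists (B, A) => //= -[y' s'] /= [By' As'].
rewrite /P -(subrKA (g (s0, y))) (splitr e) (le_trans (ler_normD _ _))//.
rewrite lerD//; last by have := AB (s', y') (conj As' By').
by rewrite distrC; apply: (AB (s0, y')); split=> //=; exact: nbhs_singleton.
Qed.

Local Notation mu := (@lebesgue_measure R).

Lemma iterated_integralS m (f : 'rV[R]_m.+1 -> R) : iterated_integral f =
  \int[mu]_(s in [set: R]) iterated_integral (fun y => f (rV_cons s y)).
Proof. by []. Qed.

Lemma iterated_integral0 m : iterated_integral (fun _ : 'rV[R]_m => 0 : R) = 0.
Proof.
elim: m => [//|m IH]; rewrite iterated_integralS IH.
by rewrite Rintegral_cst ?mul0r.
Qed.

(** The outer integral is tractable only if the inner one depends continuously on [s]. Linearity and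
    the sup bound in dimension [m] are hypotheses because this lemma serves the induction that
    proves them. *)
Lemma iterated_integral_slice m : (forall r (f g : 'rV[R]_m -> R), csupp r f -> csupp r g ->
    iterated_integral (fun y => f y + g y) = iterated_integral f + iterated_integral g) ->
  (forall r a (f : 'rV[R]_m -> R), csupp r f ->
    iterated_integral (fun y => a * f y) = a * iterated_integral f) ->
  (forall r (c : R) (f : 'rV[R]_m -> R), 0 <= r -> csupp r f -> (forall y, `|f y| <= c) ->
    `|iterated_integral f| <= c * (2 * r) ^+ m) ->
  forall r (f : 'rV[R]_m.+1 -> R), 0 < r -> csupp r f ->
    csupp r (fun s : R => iterated_integral (fun y => f (rV_cons s y))).
Proof.
move=> hD hZ hb r f r0 cf; split; last first.
  move=> s rs; rewrite (_ : (fun _ => _) = fun=> 0) ?iterated_integral0//.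
  apply/funext => y; case: cf => _; apply.
  exact: lt_le_trans rs (rV_cons_norml _ _).
move=> s0; apply/cvgrPdist_le => /= e e0.
pose d := e / (2 * r) ^+ m.
have p0 : 0 < (2 * r) ^+ m by rewrite exprn_gt0// mulr_gt0.
have d0 : 0 < d by rewrite divr_gt0.
have := @compact_unif_continuous _ _ _ (fun p => f (rV_cons p.1 p.2)) s0 _
  (@closed_ball0_compact m r) _ d0.
have cc y : {for (s0, y), continuous (fun p : R * 'rV[R]_m => f (rV_cons p.1 p.2))}.
  apply: (@continuous_comp _ _ _ (fun p : R * 'rV[R]_m => rV_cons p.1 p.2) f).
    exact: rV_cons_continuous.
  by case: cf => + _; exact.
move=> /(_ (fun y _ => cc y)); apply: filterS => s /= fs.
have cf1 := csupp_rV_cons s0 cf; have cf2 := csupp_rV_cons s cf.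
have -> : iterated_integral (fun y => f (rV_cons s0 y)) -
    iterated_integral (fun y => f (rV_cons s y)) =
    iterated_integral (fun y => f (rV_cons s0 y) + -1 * f (rV_cons s y)).
  by rewrite (hD r)//; [rewrite (hZ r)// mulN1r|exact: csuppZ].
apply: (le_trans (hb r d _ (ltW r0) _ _)); last by rewrite /d divfK ?gt_eqF.
  by apply: csuppD => //; exact: csuppZ.
move=> y; rewrite mulN1r; have [yr|ry] := leP `|y| r; first exact: fs.
case: cf => _ sf; rewrite !sf ?subr0 ?normr0 ?ltW//;
  exact: lt_le_trans ry (rV_cons_normr _ _).
Qed.

(** The three facts go by a common induction: in dimension [m.+1] each needs the slices to integrate
    to a continuous function, and that takes all three in dimension [m]. *)
Lemma iterated_integral_linear m : [/\
  forall r (f g : 'rV[R]_m -> R), csupp r f -> csupp r g ->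
    iterated_integral (fun y => f y + g y) = iterated_integral f + iterated_integral g,
  forall r a (f : 'rV[R]_m -> R), csupp r f ->
    iterated_integral (fun y => a * f y) = a * iterated_integral f &
  forall r (c : R) (f : 'rV[R]_m -> R), 0 <= r -> csupp r f -> (forall y, `|f y| <= c) ->
    `|iterated_integral f| <= c * (2 * r) ^+ m].
Proof.
elim: m => [|m [hD hZ hb]]; first by split=> // r c f _ _ fc; rewrite expr0 mulr1; exact: fc.
(* The slice lemma asks for a positive radius, hence [Num.max r 1]. *)
have sl r (f : 'rV[R]_m.+1 -> R) : csupp r f -> csupp (Num.max r 1)
    (fun s : R => iterated_integral (fun y => f (rV_cons s y))).
  move=> cf; apply: iterated_integral_slice => //; first by rewrite lt_max ltr01 orbT.
  by apply: csupp_le cf; rewrite le_max lexx.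
split.
- move=> r f g cf cg; rewrite !iterated_integralS.
  rewrite -(csupp_RintegralD (sl _ _ cf) (sl _ _ cg)).
  congr Rintegral; apply/funext => s.
  by rewrite (hD r)//; exact: csupp_rV_cons.
- move=> r a f cf; rewrite !iterated_integralS -(csupp_RintegralZ _ (sl _ _ cf)).
  congr Rintegral; apply/funext => s.
  by rewrite (hZ r)//; exact: csupp_rV_cons.
move=> r c f r0 cf fc; rewrite iterated_integralS exprSr (mulrA c).
have c0 : 0 <= c by apply: le_trans (fc 0).
apply: csupp_Rintegral_bound => // [|s]; last first.
  by apply: hb => //; exact: csupp_rV_cons.
split; first by case: (sl _ _ cf).
move=> s rs; rewrite (_ : (fun _ => _) = fun=> 0) ?iterated_integral0//.
apply/funext => y; case: cf => _; apply.
exact: lt_le_trans rs (rV_cons_norml _ _).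
Qed.

Lemma iterated_integralD m r (f g : 'rV[R]_m -> R) : csupp r f -> csupp r g ->
  iterated_integral (fun y => f y + g y) = iterated_integral f + iterated_integral g.
Proof. by have [h _ _] := iterated_integral_linear m; exact: h. Qed.

Lemma iterated_integralZ m r a (f : 'rV[R]_m -> R) : csupp r f ->
  iterated_integral (fun y => a * f y) = a * iterated_integral f.
Proof. by have [_ h _] := iterated_integral_linear m; exact: h. Qed.

Lemma iterated_integralB m r (f g : 'rV[R]_m -> R) : csupp r f -> csupp r g ->
  iterated_integral (fun y => f y - g y) = iterated_integral f - iterated_integral g.
Proof.
move=> cf cg; rewrite -mulN1r -(iterated_integralZ _ cg).
rewrite -(iterated_integralD cf (csuppZ _ cg)); congr iterated_integral.
by apply/funext => y; rewrite mulN1r.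
Qed.

Lemma iterated_integral_bound m r (c : R) (f : 'rV[R]_m -> R) :
  0 <= r -> csupp r f -> (forall y, `|f y| <= c) ->
  `|iterated_integral f| <= c * (2 * r) ^+ m.
Proof. by have [_ _ h] := iterated_integral_linear m; exact: h. Qed.

Lemma iterated_integral_sum m (I : Type) (s : seq I) (P : pred I) r
    (F : I -> 'rV[R]_m -> R) : (forall i, P i -> csupp r (F i)) ->
  iterated_integral (fun y => \sum_(i <- s | P i) F i y) =
  \sum_(i <- s | P i) iterated_integral (F i).
Proof.
move=> cF; elim: s => [|i s IH].
  rewrite big_nil -[RHS](iterated_integral0 m); congr iterated_integral.
  by apply/funext => y; rewrite big_nil.
rewrite big_cons; have := csupp_sum s cF; case: (boolP (P i)) => [Pi cs|Pi cs].
  rewrite -IH -(iterated_integralD (cF _ Pi) cs); congr iterated_integral.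
  by apply/funext => y; rewrite big_cons Pi.
rewrite -IH; congr iterated_integral.
by apply/funext => y; rewrite big_cons (negbTE Pi).
Qed.

Lemma csupp_iterated_integral m r (f : 'rV[R]_m.+1 -> R) : 0 < r -> csupp r f ->
  csupp r (fun s : R => iterated_integral (fun y => f (rV_cons s y))).
Proof. by have [h1 h2 h3] := iterated_integral_linear m; exact: iterated_integral_slice. Qed.

Lemma is_derive_remainder (F : R -> R) (t0 c : R) :
  (forall e, 0 < e -> \forall h \near (0 : R), `|F (h + t0) - F t0 - h * c| <= e * `|h|) ->
  is_derive t0 (1 : R) F c.
Proof.
move=> approx.
have cv : (fun h : R => h^-1 *: ((F \o shift t0) (h *: (1 : R)) - F t0)) @ 0^' --> c.
  apply/cvgrPdist_le => /= e e0.
  have ap := approx _ e0.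
  near=> h.
  have h0 : h != 0 by near: h; exact: nbhs_dnbhs_neq.
  have Fh : `|F (h + t0) - F t0 - h * c| <= e * `|h|.
    by near: h; apply: nbhs_dnbhs; exact: ap.
  rewrite [h *: 1]mulr1 [h^-1 *: _](_ : _ = h^-1 * (F (h + t0) - F t0))//.
  have -> : c - h^-1 * (F (h + t0) - F t0) = - (h^-1 * (F (h + t0) - F t0 - h * c)).
    by rewrite (mulrBr h^-1 _ (h * c)) mulKf// opprB.
  by rewrite normrN normrM normfV mulrC ler_pdivrMr ?normr_gt0.
apply: DeriveDef; first by apply/cvg_ex; exists c.
exact/cvg_lim.
Unshelve. all: by end_near. Qed.

Definition partial_C1 (V : normedModType R) (v : V) (f : V -> R) (p : V) :=
  \forall q \near p, [/\ derivable f q v, {for q, continuous f} &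
    {for q, continuous ('D_v f)}].

(** * Differentiation under the iterated integral *)

Section DeriveUnderIntegral.
Variables (n : nat) (f : R * 'rV[R]_n -> R) (t0 r : R) (K : set 'rV[R]_n).
Hypothesis r0 : 0 < r.
Hypothesis cK : compact K.
Hypothesis K_bounded : forall y, K y -> `|y| <= r.
Hypothesis f_supp : \forall t \near t0, forall y, ~ K y -> f (t, y) = 0.
Hypothesis f_C1 : forall y, K y -> @partial_C1 (R * 'rV[R]_n)%type (1, 0) f (t0, y).

Let Df := 'D_(1, 0) f.

Let time_line (t : R) (y : 'rV[R]_n) (a : R) :
  (fun s : R => (s, y)) (a *: 1 + t) = a *: ((1, 0) : R * 'rV[R]_n) + (t, y).
Proof. by rewrite -[RHS]/(a *: 1 + t, a *: 0 + y) scaler0 add0r. Qed.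

Let near_good : \forall t \near t0, forall y, K y ->
  [/\ derivable f (t, y) (1, 0), {for (t, y), continuous f} &
    {for (t, y), continuous Df}].
Proof.
pose P t y := [/\ derivable f (t, y) (1, 0), {for (t, y), continuous f} &
    {for (t, y), continuous Df}].
have := (compact_near_coveringP K).1 cK R (nbhs t0) P _; apply=> y Ky.
have [[A B] /= [As By] AB] := f_C1 Ky.
by exists (B, A) => //= -[y' s'] /= [By' As']; exact: (AB (s', y')).
Qed.

Let Df_supp y : ~ K y -> Df (t0, y) = 0.
Proof.
move=> Ky; rewrite /Df -(derive_affine f (time_line t0 y)).
rewrite (near_eq_derive (g := fun=> 0 : R)) ?derive_cst//.
by apply: filterS f_supp => t /(_ y Ky).
Qed.

Let closedK : closed K.
Proof. exact: compact_closed. Qed.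

Let csupp_of (g : 'rV[R]_n -> R) : (forall y, K y -> {for y, continuous g}) ->
  (forall y, ~ K y -> g y = 0) -> csupp r g.
Proof.
move=> cg gK; split=> [y|y ry]; last first.
  by apply: gK => /K_bounded; rewrite leNgt ry.
have [Ky|Ky] := pselect (K y); first exact: cg.
apply: (@near_eq_continuous _ _ (fun=> 0 : R)); last exact: cst_continuous.
have : nbhs y (~` K) by apply: open_nbhs_nbhs; split=> //; exact: closed_openC.
by apply: filterS => z Kz; rewrite gK.
Qed.

Lemma near_csupp : \forall t \near t0, csupp r (fun y => f (t, y)).
Proof.
apply: filterS (filterI near_good f_supp) => t [gt st]; apply: csupp_of => // y Ky.
apply: (@continuous_comp _ _ _ (fun y => (t, y)) f); first exact: pair_continuousr.
by have [] := gt y Ky.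
Qed.

Lemma csupp_partial : csupp r (fun y => Df (t0, y)).
Proof.
apply: csupp_of => // y Ky.
apply: (@continuous_comp _ _ _ (fun y => (t0, y)) Df); first exact: pair_continuousr.
by have [] := nbhs_singleton near_good y Ky.
Qed.

(** The remainder of the integral is the integral of the pointwise remainders. These vanish off [K];
    on [K] the mean value theorem in time turns them into a variation of [Df], uniformly small by
    compactness. *)
Lemma is_derive_iterated_integral : is_derive t0 (1 : R)
  (fun t => iterated_integral (fun y => f (t, y)))
  (iterated_integral (fun y => Df (t0, y))).
Proof.
apply: is_derive_remainder => e e0.
pose d := e / (2 * r) ^+ n.
have p0 : 0 < (2 * r) ^+ n by rewrite exprn_gt0// mulr_gt0.
have d0 : 0 < d by rewrite divr_gt0.
have cDf y : K y -> {for (t0, y), continuous Df}.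
  by move=> /(nbhs_singleton near_good)[].
have unif := compact_unif_continuous cK cDf d0.
have : \forall t \near t0, [/\ csupp r (fun y => f (t, y)),
    (forall y, ~ K y -> f (t, y) = 0),
    (forall y, K y -> derivable f (t, y) (1, 0)) &
    (forall y, K y -> `|Df (t0, y) - Df (t, y)| <= d)].
  apply: filterS (filterI (filterI near_csupp f_supp) (filterI near_good unif)).
  by move=> t [[? ?] [g ?]]; split=> // y /g[].
move=> /nbhs_ballP[eta /= eta0 good].
apply/nbhs_ballP; exists eta => //= h; rewrite -ball_normE /= sub0r normrN => he.
have goodt s : `|s| <= `|h| -> ball t0 eta (s + t0).
  move=> sh; rewrite -ball_normE /= opprD addrCA subrr addr0 normrN.
  exact: le_lt_trans he.
have [cfh sfh _ _] := good _ (goodt h (lexx _)).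
have [cf0 sf0 _ _] : [/\ csupp r (fun y => f (t0, y)),
    (forall y, ~ K y -> f (t0, y) = 0),
    (forall y, K y -> derivable f (t0, y) (1, 0)) &
    (forall y, K y -> `|Df (t0, y) - Df (t0, y)| <= d)].
  by have := good _ (goodt 0 _); rewrite add0r; apply; rewrite normr0.
have c1 := csuppB cfh cf0; have c2 := csuppZ h csupp_partial.
rewrite -(iterated_integralB cfh cf0) -(iterated_integralZ h csupp_partial).
rewrite -(iterated_integralB c1 c2).
have -> : e * `|h| = (d * `|h|) * (2 * r) ^+ n.
  by rewrite mulrAC /d divfK// gt_eqF.
apply: iterated_integral_bound => [||y]; [exact: ltW|exact: csuppB|].
have [Ky|Ky] := pselect (K y); last first.
  by rewrite sfh// sf0// Df_supp// mulr0 !subr0 normr0 mulr_ge0// ltW.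
have [s sh E] : exists2 s : R, `|s| <= `|h| &
    f (h + t0, y) - f (t0, y) = h * Df (s + t0, y).
  have [|s sh E] := @dir_mvt _ _ (fun s : R => f (s, y)) t0 1 h.
    move=> s sh; apply: (derivable_affine (time_line _ y)).
    have [_ _ dd _] := good _ (goodt s sh).
    by have := dd y Ky; rewrite [s *: 1]mulr1.
  exists s => //; move: E; rewrite (derive_affine f (time_line _ y)).
  by rewrite [s *: 1]mulr1 [h *: 1]mulr1.
rewrite E -mulrBr normrM mulrC ler_wpM2r// distrC.
by have [_ _ _] := good _ (goodt s sh); apply.
Qed.

End DeriveUnderIntegral.

Lemma csupp_Rintegral_derive (G : R -> R) r :
  0 < r -> csupp r G -> (forall s, derivable G s 1) -> csupp r ('D_1 G) ->
  \int[mu]_(s in [set: R]) 'D_1 G s = 0.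
Proof.
(* [csupp] asserts vanishing only strictly beyond [r], so the end points are moved out to
   [r + 1]. *)
move=> r0 cG dG cD; pose q := r + 1.
have rq : r <= q by rewrite lerDl.
rewrite (csupp_Rintegral_itv (csupp_le rq cD)) /Rintegral.
have q0 : - q < q by rewrite /q; lra.
have cG' : {within `[- q, q], continuous ('D_1 G)}.
  by apply: continuous_subspaceT; case: cD.
have dG' : derivable_oo_LRcontinuous G (- q) q.
  split; first by move=> s _; exact: dG.
    by apply: cvg_at_right_filter; case: cG => + _; apply.
  by apply: cvg_at_left_filter; case: cG => + _; apply.
rewrite (continuous_FTC2 q0 cG' dG'); last by move=> s _; rewrite derive1E.
have rn : r < `|q| by rewrite gtr0_norm /q; lra.
by case: cG => _ sG; rewrite !sG ?normrN//= subrr.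
Qed.

Lemma diff_class_csupp (V : normedModType R) s r (f : V -> R) :
  diff_class s setT f -> (forall y, r < `|y| -> f y = 0) -> csupp r f.
Proof. by move=> df sf; split=> // y; exact: (diff_class_continuous df). Qed.

Lemma diff_class_derive_supp (V : normedModType R) r (f : V -> R) v :
  (forall y, r < `|y| -> f y = 0) -> forall y, r < `|y| -> 'D_v f y = 0.
Proof.
move=> sf y ry; rewrite (near_eq_derive (g := fun=> 0 : R)) ?derive_cst//.
have : nbhs y [set z | r < `|z|].
  apply: open_nbhs_nbhs; split=> //.
  apply: (@open_comp _ _ (fun y : V => `|y|) [set x : R | r < x]).
    by move=> z _; exact: norm_continuous.
  exact: open_gt.
by apply: filterS => z /sf.
Qed.

(** The divergence theorem without boundary. A derivative in a later coordinate is handled inside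
    each slice by induction; for the first coordinate, the inner integral of the derivative is the
    derivative of the inner integral, and the fundamental theorem of calculus concludes. *)
Lemma iterated_integral_derive m r (f : 'rV[R]_m -> R) (j : 'I_m) :
  0 < r -> diff_class 1 setT f -> (forall y, r < `|y| -> f y = 0) ->
  iterated_integral ('D_(delta_mx 0 j) f) = 0.
Proof.
move=> r0; elim: m f j => [|m IH] f j df sf; first by case: j.
rewrite iterated_integralS; case: (unliftP ord0 j) => [j'|] ->.
  transitivity (\int[mu]_(s in [set: R]) 0); last by rewrite Rintegral_cst ?mul0r.
  congr Rintegral; apply/funext => s.
  have E a (v x : 'rV[R]_m) : rV_cons s (a *: v + x) =
      a *: rV_cons 0 v + rV_cons s x by rewrite -rV_cons_linear mulr0 add0r.
  rewrite -[RHS](IH (f \o rV_cons s) j').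
  - congr iterated_integral; apply/funext => y.
    rewrite (@derive_affine _ _ _ _ f (rV_cons s) y (delta_mx 0 j')
      (rV_cons 0 (delta_mx 0 j'))); last by move=> t; exact: E.
    congr ('D_ _ f _); apply/rowP => i; rewrite mxE eqxx/=.
    case: (unliftP ord0 i) => [i'|] ->; last by rewrite rV_cons0 -val_eqE.
    by rewrite rV_consS mxE eqxx (inj_eq lift_inj).
  - apply: (@diff_class_affine _ _ _ _ _ setT f (rV_cons s) (rV_cons 0)) => //.
    move=> y; apply: (@continuous_comp _ _ _ (fun y => (s, y))
      (fun p : R * 'rV[R]_m => rV_cons p.1 p.2)).
      exact: pair_continuousr.
    exact: rV_cons_continuous.
  by move=> y ry; apply: sf; exact: lt_le_trans ry (rV_cons_normr _ _).
pose F (p : R * 'rV[R]_m) := f (rV_cons p.1 p.2).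
pose G s := iterated_integral (fun y => F (s, y)).
have E t (y : 'rV[R]_m) a : rV_cons (a * 1 + t) (a *: 0 + y) =
    a *: delta_mx 0 ord0 + rV_cons t y.
  rewrite rV_cons_linear; congr (a *: _ + _); apply/rowP => i; rewrite [RHS]mxE eqxx/=.
  case: (unliftP ord0 i) => [i'|] ->; last by rewrite rV_cons0.
  by rewrite rV_consS mxE -val_eqE.
have DF p : 'D_(1, 0) F p = 'D_(delta_mx 0 ord0) f (rV_cons p.1 p.2).
  rewrite (@derive_affine _ _ _ _ f (fun p : R * 'rV[R]_m => rV_cons p.1 p.2) _ _
    (delta_mx 0 ord0))// => t; exact: E.
have cc (g : 'rV[R]_m.+1 -> R) : continuous g ->
    continuous (fun p : R * 'rV[R]_m => g (rV_cons p.1 p.2)).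
  move=> cg p; apply: (@continuous_comp _ _ _
    (fun p : R * 'rV[R]_m => rV_cons p.1 p.2) g); last exact: cg.
  exact: rV_cons_continuous.
have dG s : is_derive s (1 : R) G
    (iterated_integral (fun y => 'D_(1, 0) F (s, y))).
  apply: (is_derive_iterated_integral r0 (@closed_ball0_compact m r)) => //.
    near=> t; move=> y /negP; rewrite -ltNge => ry.
    by apply: sf; exact: lt_le_trans ry (rV_cons_normr _ _).
  move=> y _; near=> p; split.
  - apply: (@derivable_affine _ _ _ _ f (fun p : R * 'rV[R]_m => rV_cons p.1 p.2) _ _
      (delta_mx 0 ord0)); first by move=> t; exact: E.
    exact: (diff_class_derivable df).
  - by apply: cc => z; exact: (diff_class_continuous df).
  - rewrite (_ : 'D_(1, 0) F = fun p => 'D_(delta_mx 0 ord0) f (rV_cons p.1 p.2));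
      last exact/funext.
    by apply: (cc ('D_(delta_mx 0 ord0) f)) => z;
      exact: (diff_class_continuous (diff_class_derive _ df)).
have cD : csupp r ('D_(delta_mx 0 ord0) f).
  exact: (diff_class_csupp (diff_class_derive _ df) (diff_class_derive_supp _ sf)).
have DG : 'D_1 G = fun s => iterated_integral
    (fun y => 'D_(delta_mx 0 ord0) f (rV_cons s y)).
  by apply/funext => s; have [_ ->] := dG s; congr iterated_integral;
    apply/funext => y; rewrite DF.
rewrite -[RHS](@csupp_Rintegral_derive G r)//.
- by rewrite DG.
- exact: (csupp_iterated_integral r0 (diff_class_csupp df sf)).
by rewrite DG; exact: (csupp_iterated_integral r0 cD).
Unshelve. all: by end_near. Qed.

End IteratedIntegral.

(** * Alternating forms and the calibration inequality *)

Section SetRow.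
Context {R : comRingType}.

Definition setrow k n (W : 'M[R]_(k, n)) (j : 'I_k) (X : 'rV[R]_n) : 'M[R]_(k, n) :=
  \matrix_(i, l) if i == j then X 0 l else W i l.

Variables (k n : nat).
Implicit Types (W : 'M[R]_(k, n)) (i j : 'I_k) (X Y : 'rV[R]_n).

Lemma row_setrow W j X : row j (setrow W j X) = X.
Proof. by apply/rowP => l; rewrite !mxE eqxx. Qed.

Lemma row_setrow_neq W i j X : i != j -> row i (setrow W j X) = row i W.
Proof. by move=> /negbTE ij; apply/rowP => l; rewrite !mxE ij. Qed.

Lemma row'_setrow W j X : row' j (setrow W j X) = row' j W.
Proof. by apply/matrixP => i l; rewrite !mxE eq_sym (negbTE (neq_lift _ _)). Qed.

Lemma setrow_row W j : setrow W j (row j W) = W.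
Proof. by apply/matrixP => i l; rewrite !mxE; case: eqP => [->|]. Qed.

Lemma setrow_setrow W j X Y : setrow (setrow W j X) j Y = setrow W j Y.
Proof. by apply/matrixP => i l; rewrite !mxE; case: eqP. Qed.

Lemma setrowC W i j X Y : i != j ->
  setrow (setrow W i X) j Y = setrow (setrow W j Y) i X.
Proof.
move=> ij; apply/matrixP => a l; rewrite !mxE.
by have [->|aj] := eqVneq a j; rewrite // eq_sym (negbTE ij).
Qed.

End SetRow.

Section Alternating.
Context {R : realType}.

Section Forms.
Variables (k n : nat) (w : 'M[R]_(k, n) -> R).
Hypothesis wl : multilinear w.
Implicit Types (W : 'M[R]_(k, n)) (i j : 'I_k) (X Y : 'rV[R]_n).

Lemma multilinear_setrow W j a b X Y :
  w (setrow W j (a *: X + b *: Y)) = a * w (setrow W j X) + b * w (setrow W j Y).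
Proof. by apply: (wl (i := j)); rewrite ?row_setrow ?row'_setrow. Qed.

Lemma multilinear_setrowD W j X Y :
  w (setrow W j (X + Y)) = w (setrow W j X) + w (setrow W j Y).
Proof. by have := multilinear_setrow W j 1 1 X Y; rewrite !scale1r !mul1r. Qed.

Lemma multilinear_setrowZ W j a X :
  w (setrow W j (a *: X)) = a * w (setrow W j X).
Proof.
by have := multilinear_setrow W j a 0 X X; rewrite scale0r addr0 mul0r addr0.
Qed.

Lemma multilinear_setrow0 W j : w (setrow W j 0) = 0.
Proof. by have := multilinear_setrowZ W j 0 0; rewrite scale0r mul0r. Qed.

Lemma multilinear_setrow_sum W j (I : Type) (s : seq I) (c : I -> R) (X : I -> 'rV[R]_n) :
  w (setrow W j (\sum_(i <- s) c i *: X i)) = \sum_(i <- s) c i * w (setrow W j (X i)).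
Proof.
elim: s => [|i s IH]; first by rewrite !big_nil multilinear_setrow0.
by rewrite !big_cons multilinear_setrowD multilinear_setrowZ IH.
Qed.

Lemma multilinear_expand_row W j :
  w W = \sum_l W j l * w (setrow W j (delta_mx 0 l)).
Proof.
rewrite -[in LHS](setrow_row W j) [X in setrow W j X]row_sum_delta.
by rewrite multilinear_setrow_sum; apply: eq_bigr => l _; rewrite mxE.
Qed.

(** Rows are expanded one at a time into basis vectors; the list [s] in the proof holds the rows not
    yet expanded. *)
Lemma multilinear_basis0 :
  (forall f : 'I_k -> 'I_n, w (\matrix_(i, j) (f i == j)%:R) = 0) -> forall W, w W = 0.
Proof.
move=> w0.
suff H (s : seq 'I_k) W : (forall i, i \notin s -> exists l, row i W = delta_mx 0 l) -> w W = 0.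
  by move=> W; apply: (H (enum 'I_k)) => i; rewrite mem_enum.
elim: s W => [|j s IH] W Ws.
  have /choice[f fW] : forall i, exists l, row i W = delta_mx 0 l.
    by move=> i; exact: Ws.
  rewrite -(w0 f); congr w; apply/matrixP => i l.
  by have /rowP/(_ l) := fW i; rewrite !mxE eqxx/= eq_sym.
rewrite (multilinear_expand_row W j) big1// => l _.
rewrite IH ?mulr0// => i si; have [->|ij] := eqVneq i j.
  by exists l; rewrite row_setrow.
by rewrite row_setrow_neq//; apply: Ws; rewrite inE negb_or ij.
Qed.

Hypothesis wa : alternating w.

(** Polarization: expand the value on two equal rows [X + Y], which is zero. *)
Lemma alternating_swap W i j X Y : i != j ->
  w (setrow (setrow W i X) j Y) = - w (setrow (setrow W i Y) j X).
Proof.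
move=> ij; apply/eqP; rewrite -addr_eq0; apply/eqP.
have diag Z : w (setrow (setrow W i Z) j Z) = 0.
  by apply: (wa ij); rewrite row_setrow row_setrow_neq// row_setrow.
have := diag (X + Y); rewrite multilinear_setrowD.
rewrite !(setrowC _ _ _ ij) !multilinear_setrowD -!(setrowC _ _ _ ij).
by rewrite !diag add0r addr0 addrC.
Qed.

Lemma alternating_cross W i j X Y : j != i ->
  w (setrow (setrow W j X) i Y) = - w (setrow (setrow W i X) j Y).
Proof. by move=> ji; rewrite alternating_swap// (setrowC W Y X ji). Qed.

Lemma alternating_xrow W i j : i != j -> w (xrow i j W) = - w W.
Proof.
move=> ij; rewrite -[in RHS](setrow_row W j) -[in RHS](setrow_row W i).
rewrite row_setrow_neq 1?eq_sym// alternating_swap// opprK; congr w.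
apply/matrixP => a l; rewrite !mxE.
have [->|aj] := eqVneq a j; first by rewrite tpermR.
have [->|ai] := eqVneq a i; first by rewrite tpermL.
by rewrite tpermD// eq_sym.
Qed.

Lemma alternating_row_perm (s : 'S_k) W : w (row_perm s W) = (-1) ^+ s * w W.
Proof.
have [ts -> dts] := prod_tpermP s; elim: ts dts W => [_|t ts IH] /=.
  by move=> W; rewrite big_nil odd_perm1 mul1r row_perm1.
move=> /andP[dt /IH{}IH] W.
rewrite big_cons odd_mul_tperm dt row_permM -/(xrow _ _ _) alternating_xrow//.
by rewrite IH signr_addb expr1 mulN1r mulNr.
Qed.

End Forms.

Lemma det_multilinear k : multilinear (@determinant R k).
Proof. by move=> A B C i b c; exact: determinant_multilinear. Qed.

Lemma det_alternating k : alternating (@determinant R k).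
Proof.
by move=> A i j ij AE; apply: (determinant_alternate ij) => l; have /rowP/(_ l) := AE; rewrite !mxE.
Qed.

Lemma multilinear_mulmxl k m n (w : 'M[R]_(k, n) -> R) (W : 'M[R]_(m, n)) :
  multilinear w -> multilinear (fun J => w (J *m W)).
Proof.
move=> wl A B C i b c AE BE CE; apply: (wl _ _ _ i).
- by rewrite !row_mul AE mulmxDl -!scalemxAl.
- by rewrite !row'Esub -!mul_rowsub_mx -!row'Esub BE.
- by rewrite !row'Esub -!mul_rowsub_mx -!row'Esub CE.
Qed.

Lemma alternating_mulmxl k m n (w : 'M[R]_(k, n) -> R) (W : 'M[R]_(m, n)) :
  alternating w -> alternating (fun J => w (J *m W)).
Proof. by move=> wa A i j ij AE; apply: (wa _ i j ij); rewrite !row_mul AE. Qed.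

(** The difference of the two sides is multilinear and alternating in [J] and vanishes at the
    identity, hence at every matrix of basis rows: by alternation if a row repeats, by the sign rule
    if it permutes the identity. Both the volume factor of a metric and the Jacobian of a chart
    change come out of a form this way. *)
Lemma alternating_mulmx k n (w : 'M[R]_(k, n) -> R) (J : 'M[R]_k) (W : 'M[R]_(k, n)) :
  multilinear w -> alternating w -> w (J *m W) = \det J * w W.
Proof.
move=> wl wa; apply/eqP; rewrite -subr_eq0; apply/eqP.
pose psi (A : 'M[R]_k) := w (A *m W) - \det A * w W.
have ml := multilinear_mulmxl W wl; have ma := alternating_mulmxl W wa.
have psil : multilinear psi.
  move=> A B C i b c AE BE CE; rewrite /psi.
  rewrite (ml A B C i b c)// (determinant_multilinear AE BE CE); ring.
have psia : alternating psi.
  by move=> A i j ij AE; rewrite /psi (ma _ i j)// (det_alternating ij)// mul0r subr0.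
have psi1 : psi 1%:M = 0 by rewrite /psi mul1mx det1 mul1r subrr.
apply: (multilinear_basis0 psil) => f.
have [fi|] := boolP (injectiveb f); last first.
  rewrite /injectiveb => /dinjectivePn[i _ [j /andP[ji _] fij]].
  by apply: (psia _ i j); [rewrite eq_sym|apply/rowP => l; rewrite !mxE fij].
have -> : \matrix_(i, j) (f i == j)%:R = row_perm (perm (injectiveP _ fi)) 1%:M :> 'M[R]_k.
  by apply/matrixP => i j; rewrite !mxE permE.
by rewrite (alternating_row_perm psil psia) psi1 mulr0.
Qed.

Section DifferentiateForm.
Variables (V : normedModType R) (k n : nat) (w : 'rV[R]_n -> 'M[R]_(k, n) -> R).
Variables (O : set 'rV[R]_n).
Hypothesis oO : open O.
Hypothesis wl : forall z, multilinear (w z).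

(** Regularity of [w] is known only for each constant tuple [A]. The rows that may vary, listed by
    [s], are expanded one by one in the basis until the tuple is constant and only composition with
    [Phi] remains. *)
Lemma diff_class_form r (U : set V) (Phi : V -> 'rV[R]_n) (W : V -> 'M[R]_(k, n)) :
  open U -> (forall q, U q -> O (Phi q)) -> (forall A, diff_class r O (w ^~ A)) ->
  diff_class r U Phi -> diff_class r U W -> diff_class r U (fun q => w (Phi q) (W q)).
Proof.
move=> oU PhiO dw dPhi.
suff H (s : seq 'I_k) (X : V -> 'M[R]_(k, n)) : diff_class r U X ->
    (forall i, i \notin s -> exists l, forall q, row i (X q) = l) ->
    diff_class r U (fun q => w (Phi q) (X q)).
  by move=> dW; apply: (H (enum 'I_k)) => // i; rewrite mem_enum.
elim: s X => [|j s IH] X dX Xs.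
  have Xc q : X q = X 0.
    by apply/row_matrixP => i; have [//|l Hl] := Xs i; rewrite !Hl.
  apply: (@eq_diff_class _ _ _ _ _ (w ^~ (X 0) \o Phi)) => //.
    by move=> q _ /=; rewrite [in RHS]Xc.
  exact: diff_class_comp (dw _).
apply: (@eq_diff_class _ _ _ _ _
    (fun q => \sum_l X q j l * w (Phi q) (setrow (X q) j (delta_mx 0 l)))) => //.
  by move=> q _; rewrite -(multilinear_expand_row (wl _)).
apply: diff_class_sum => // l _; apply: diff_classM => //.
  by move/diff_class_mxP: dX; apply.
apply: IH => [|i si].
  apply/diff_class_mxP => // a b; have [aj|aj] := eqVneq a j.
    apply: eq_diff_class (diff_class_cst r U ((delta_mx 0 l : 'rV[R]_n) 0 b)) => // q _.
    by rewrite [RHS]mxE aj eqxx.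
  move/diff_class_mxP: dX => /(_ oU a b); apply: eq_diff_class => // q _.
  by rewrite [RHS]mxE (negbTE aj).
have [->|ij] := eqVneq i j; first by exists (delta_mx 0 l) => q; rewrite row_setrow.
have [|x Xx] := Xs i; first by rewrite inE negb_or ij.
by exists x => q; rewrite row_setrow_neq.
Qed.

(** A product rule: one term for the moving base point and one for each moving row. The induction
    again replaces varying rows by basis vectors; a constant row contributes nothing to the sum over
    [j]. *)
Lemma is_derive_form (Phi : V -> 'rV[R]_n) (W : V -> 'M[R]_(k, n)) p v :
  (forall A, diff_class 1 O (w ^~ A)) -> O (Phi p) ->
  derivable Phi p v -> derivable W p v ->
  is_derive p v (fun q => w (Phi q) (W q))
    ('D_('D_v Phi p) (w ^~ (W p)) (Phi p) +
     \sum_j w (Phi p) (setrow (W p) j (row j ('D_v W p)))).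
Proof.
move=> dw OPhi dPhi.
have dwx A : differentiable (w ^~ A) (Phi p).
  exact: (diff_class1_differentiable_real oO (dw A) OPhi).
suff H (s : seq 'I_k) (X : V -> 'M[R]_(k, n)) : derivable X p v ->
    (forall i, i \notin s -> exists l, forall q, row i (X q) = l) ->
    is_derive p v (fun q => w (Phi q) (X q))
      ('D_('D_v Phi p) (w ^~ (X p)) (Phi p) +
       \sum_j w (Phi p) (setrow (X p) j (row j ('D_v X p)))).
  by move=> dW; apply: (H (enum 'I_k)) => // i; rewrite mem_enum.
have const_row (Z : V -> 'M[R]_(k, n)) i l : derivable Z p v ->
    (forall q, row i (Z q) = l) -> row i ('D_v Z p) = 0.
  move=> dX Xi; apply/rowP => b; rewrite (derive_mx dX) !mxE.
  rewrite (_ : (fun _ => _) = fun=> l 0 b); first by rewrite derive_cst.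
  by apply/funext => q; have /rowP/(_ b) := Xi q; rewrite mxE.
elim: s X => [|j s IH] X dX Xs.
  have Xc q : X q = X p.
    apply/row_matrixP => i; have [//|l Hl] := Xs i; by rewrite !Hl.
  rewrite big1 ?addr0; last first.
    move=> i _; have [//|l Hl] := Xs i.
    by rewrite (const_row _ _ _ dX Hl) multilinear_setrow0.
  rewrite (_ : (fun _ => _) = (w ^~ (X p) \o Phi)).
    exact: is_derive_comp_diff.
  by apply/funext => q /=; rewrite [in LHS]Xc.
pose Y l q := setrow (X q) j (delta_mx 0 l).
have dXe a b : derivable (fun q => X q a b) p v by move/derivable_mxP: dX; apply.
have dY l : derivable (Y l) p v.
  apply/derivable_mxP => a b; have [aj|aj] := eqVneq a j.
    rewrite (_ : (fun _ => _) = fun=> (delta_mx 0 l : 'rV[R]_n) 0 b).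
      exact: derivable_cst.
    by apply/funext => q; rewrite mxE aj eqxx.
  rewrite (_ : (fun _ => _) = fun q => X q a b)//.
  by apply/funext => q; rewrite mxE (negbTE aj).
have DYj l : row j ('D_v (Y l) p) = 0.
  by apply: (const_row (Y l) j (delta_mx 0 l) (dY l)) => q; exact: row_setrow.
have DYi l i : i != j -> row i ('D_v (Y l) p) = row i ('D_v X p).
  move=> ij; apply/rowP => b; rewrite (derive_mx (dY l)) (derive_mx dX) !mxE; congr ('D_v _ p).
  by apply/funext => q; rewrite mxE (negbTE ij).
have IHl l : is_derive p v (fun q => w (Phi q) (Y l q))
      ('D_('D_v Phi p) (w ^~ (Y l p)) (Phi p) +
       \sum_(i | i != j) w (Phi p) (setrow (Y l p) i (row i ('D_v X p)))).
  have := IH _ (dY l) _; rewrite (bigD1 j)//= DYj (multilinear_setrow0 (wl _)) add0r.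
  rewrite (eq_bigr (fun i => w (Phi p) (setrow (Y l p) i (row i ('D_v X p)))));
    last by move=> i ij; rewrite DYi.
  apply=> i si; have [->|ij] := eqVneq i j.
    by exists (delta_mx 0 l) => q; rewrite row_setrow.
  have [|x Xx] := Xs i; first by rewrite inE negb_or ij.
  by exists x => q; rewrite row_setrow_neq.
have E : (fun q => w (Phi q) (X q)) =
    \sum_(l < n) (fun q => X q j l * w (Phi q) (Y l q)).
  by apply/funext => q; rewrite fct_sumE [LHS](multilinear_expand_row (wl _) _ j).
have dl l : is_derive p v (fun q => X q j l * w (Phi q) (Y l q))
    (X p j l * ('D_('D_v Phi p) (w ^~ (Y l p)) (Phi p) +
       \sum_(i | i != j) w (Phi p) (setrow (Y l p) i (row i ('D_v X p)))) +
     w (Phi p) (Y l p) * 'D_v (fun q => X q j l) p).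
  have [d1 <-] := IHl l; apply: DeriveDef; first exact: derivableM.
  exact: deriveM.
rewrite E; have D : is_derive p v (\sum_(l < n) (fun q => X q j l * w (Phi q) (Y l q)))
    (\sum_l (X p j l * ('D_('D_v Phi p) (w ^~ (Y l p)) (Phi p) +
       \sum_(i | i != j) w (Phi p) (setrow (Y l p) i (row i ('D_v X p)))) +
     w (Phi p) (Y l p) * 'D_v (fun q => X q j l) p)).
  by apply: is_derive_sum => l; exact: dl.
apply: (is_derive_eq D).
(* Linearity in row [j] recombines the terms over [l] into the base-point derivative, the term of
   row [j] and the terms of the other rows. *)
have -> : 'D_('D_v Phi p) (w ^~ (X p)) (Phi p) =
    \sum_l X p j l * 'D_('D_v Phi p) (w ^~ (Y l p)) (Phi p).
  rewrite (_ : w ^~ (X p) = \sum_l (fun z => X p j l * w z (Y l p))); last first.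
    by apply/funext => z; rewrite fct_sumE [LHS](multilinear_expand_row (wl _) _ j).
  have dd l : derivable (w ^~ (Y l p)) (Phi p) ('D_v Phi p) by exact: diff_derivable.
  rewrite derive_sum; last by move=> l; exact: derivableM (derivable_cst _ _ _) (dd l).
  by apply: eq_bigr => l _; rewrite (deriveM (derivable_cst _ _ _) (dd l)) derive_cst [_ *: 0]mulr0 addr0.
rewrite (bigD1 j)//= big_split/=; under eq_bigr do rewrite mulrDr.
rewrite big_split/= -addrA; congr (_ + _); rewrite addrC; congr (_ + _).
  rewrite [X in setrow _ _ X]row_sum_delta (multilinear_setrow_sum (wl _)).
  by apply: eq_bigr => l _; rewrite mulrC (derive_mx dX) !mxE.
under eq_bigr do rewrite mulr_sumr.
rewrite exchange_big/=; apply: eq_bigr => i ij.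
rewrite [RHS](multilinear_expand_row (wl _) _ j); apply: eq_bigr => l _.
by rewrite [X in _ = X * _]mxE eq_sym (negbTE ij) setrowC.
Qed.

End DifferentiateForm.

End Alternating.

(** * Cholesky factors and the calibration inequality *)

Section Calibration.
Context {R : realType}.

Definition posdef k (S : 'M[R]_k) :=
  S^T = S /\ forall v : 'rV[R]_k, v != 0 -> 0 < (v *m S *m v^T) 0 0.

Lemma posdef_schur k (a : R) (b : 'rV[R]_k) (c : 'cV[R]_k) (C : 'M[R]_k) :
  posdef (block_mx (a%:M : 'M[R]_1) b c C) ->
  [/\ 0 < a, c = b^T & posdef (C - a^-1 *: (b^T *m b))].
Proof.
move=> [sym pos]; move: sym; rewrite tr_block_mx => /eq_block_mx[_ cb bc CC].
have a0 : 0 < a.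
  have := pos (row_mx (1%:M : 'M[R]_1) 0); rewrite tr_row_mx mul_row_block.
  rewrite !mul1mx !mul0mx !addr0 mul_row_col trmx0 mulmx0 addr0 trmx1 mulmx1.
  rewrite mxE eqxx mulr1n; apply.
  apply/eqP => /matrixP/(_ 0 (lshift k 0)); rewrite row_mxEl !mxE eqxx.
  by move/eqP; rewrite oner_eq0.
have cE := esym bc.
split=> //; split.
  by rewrite linearB/= linearZ/= trmx_mul trmxK CC.
(* This [s] completes the square: at [(s, v)] the quadratic form takes the value of the Schur
   complement at [v]. *)
move=> v v0; pose s : 'M[R]_1 := - (a^-1 *: (v *m b^T)).
have := pos (row_mx s v); rewrite tr_row_mx mul_row_block mul_row_col cE.
have -> : s *m a%:M + v *m b^T = 0.
  rewrite mul_mx_scalar /s scalerN scalerA mulfV ?gt_eqF// scale1r addNr//.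
rewrite mul0mx add0r /s mulNmx -scalemxAl addrC mulmxDl mulNmx.
rewrite [in X in _ -> X]mulmxBr mulmxBl -scalemxAr -!scalemxAl !mulmxA; apply.
apply: contra v0 => /eqP/(congr1 (@rsubmx _ _ _ _)).
by rewrite row_mxKr => ->; rewrite -(linear0 (@rsubmx R 1 1 k)) eqxx.
Qed.

(** Recursion on the Schur complement. The factor supplies orthonormal frames for both metrics, and
    its triangular shape makes the determinant a product of diagonal entries. *)
Lemma cholesky k (S : 'M[R]_k) : posdef S ->
  exists B : 'M[R]_k, [/\ is_trig_mx B, forall i, 0 < B i i & B *m B^T = S].
Proof.
elim: k S => [|k IH] S; first by exists 0; split=> [|[]//|]; [apply/is_trig_mxP => -[]|apply/matrixP => -[]].
move=> pS; rewrite -(@submxK _ 1 k 1 k S) in pS *.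
move: pS; rewrite [ulsubmx _]mx11_scalar; set a := (ulsubmx _) 0 0.
set b := ursubmx _; set c := dlsubmx _; set C := drsubmx _.
move=> /posdef_schur[a0 cE /IH[B' [tB dB BE]]]; rewrite {}cE.
pose q := Num.sqrt a.
have q0 : 0 < q by rewrite sqrtr_gt0.
have qq : q * q = a by rewrite -expr2 sqr_sqrtr ?ltW.
pose A : 'M[R]_(1 + k) := block_mx (q%:M : 'M[R]_1) 0 (q^-1 *: b^T) B'.
have tA : is_trig_mx A.
  by rewrite is_trig_block_mx//; apply/and3P; split=> //; apply/is_trig_mxP => i j; rewrite !ord1.
have dA (i : 'I_(1 + k)) : 0 < A i i.
  case: (split_ordP i) => j ->; first by rewrite block_mxEul !ord1 mxE eqxx.
  by rewrite block_mxEdr.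
have AE : A *m A^T = block_mx a%:M b b^T C.
  rewrite tr_block_mx mulmx_block trmx0 !mul0mx !mulmx0 !addr0 tr_scalar_mx.
  rewrite linearZ/= trmxK -scalar_mxM qq -scalemxAr mul_scalar_mx scalerA mulVf ?gt_eqF//.
  rewrite scale1r -scalemxAl mul_mx_scalar scalerA mulVf ?gt_eqF// scale1r.
  rewrite -scalemxAl -scalemxAr scalerA -invfM qq BE; congr block_mx.
  by rewrite addrC subrK.
by exists A.
Qed.

(** After squaring, this is AM-GM for the numbers [B i i ^+ 2]: their product is [\det B ^+ 2], and
    their sum is at most the trace, which also contains the squares of the off-diagonal entries. *)
Lemma det_le_trace k (B : 'M[R]_k) : (0 < k)%N -> is_trig_mx B -> (forall i, 0 < B i i) ->
  \det B <= (Num.sqrt k%:R ^+ k)^-1 * Num.sqrt (\tr (B *m B^T)) ^+ k.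
Proof.
move=> k0 tB dB.
have dB0 : 0 <= \det B by rewrite det_trig// prodr_ge0// => i _; exact: ltW.
have kR : 0 < k%:R :> R by rewrite ltr0n.
have T0 : \sum_i B i i ^+ 2 <= \tr (B *m B^T).
  apply: ler_sum => i _; rewrite !mxE (bigD1 i)//= !mxE -expr2 lerDl.
  by apply: sumr_ge0 => j _; rewrite mxE -expr2 sqr_ge0.
have S0 : 0 <= \sum_i B i i ^+ 2 by apply: sumr_ge0 => i _; exact: sqr_ge0.
rewrite mulrC ler_pdivlMr ?exprn_gt0 ?sqrtr_gt0//.
rewrite -(@ler_pXn2r _ 2)// ?nnegrE ?mulr_ge0 ?exprn_ge0 ?sqrtr_ge0//.
rewrite exprMn -!exprM ![(k * 2)%N]mulnC !exprM !sqr_sqrtr; last 2 first.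
- exact: le_trans S0 T0.
- exact: ltW.
apply: (@le_trans _ _ ((\sum_i B i i ^+ 2) ^+ k)); last first.
  by apply: lerXn2r => //; rewrite nnegrE// (le_trans S0 T0).
rewrite det_trig// -prodrXl.
have := @leif_AGM R 'I_k predT (fun i => B i i ^+ 2) _.
rewrite cardT size_enum_ord => /(_ _)[|+ _]; first by move=> i _; rewrite /= sqr_ge0.
by rewrite expr_div_n ler_pdivlMr ?exprn_gt0.
Qed.

Lemma invmx_unique k (A B : 'M[R]_k) : A *m B = 1%:M -> invmx A = B.
Proof.
move=> AB; have [uA _] := mulmx1_unit AB.
by rewrite -[LHS]mulmx1 -AB mulKmx.
Qed.

(* With [B] the Cholesky factor of [V h V^T], [B^-1 V] is orthonormal, so [w V <= \det B],
   and AM-GM on the diagonal of [B] bounds [\det B] by the trace. *)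
Lemma calibration_le_trace k n (h : 'M[R]_n) (w : 'M[R]_(k, n) -> R) (V : 'M[R]_(k, n)) :
  (0 < k)%N -> posdef h -> multilinear w -> alternating w ->
  (forall e, e *m h *m e^T = 1%:M -> w e <= 1) ->
  w V <= (Num.sqrt k%:R ^+ k)^-1 * Num.sqrt (\tr (V *m h *m V^T)) ^+ k.
Proof.
move=> k0 [hs hp] wl wa wcal.
have RHS0 (x : R) : 0 <= (Num.sqrt k%:R ^+ k)^-1 * Num.sqrt x ^+ k.
  by rewrite mulr_ge0 ?invr_ge0 ?exprn_ge0 ?sqrtr_ge0.
(* If the rows of [V] are dependent, the Gram matrix is singular and has no Cholesky factor with
   positive diagonal; but then alternation gives [w V = 0]. *)
have [[r r0 rV]|nr] := pselect (exists2 r : 'rV[R]_k, r != 0 & r *m V = 0).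
  suff -> : w V = 0 by [].
  have /existsP[i ri] : [exists i, r 0 i != 0].
    apply: contraR r0; rewrite negb_exists => /forallP r0.
    by apply/eqP/rowP => i; rewrite mxE; apply/eqP; have := r0 i; rewrite negbK.
  have := multilinear_setrow_sum wl V i (enum 'I_k) (fun l => r 0 l) (fun l => row l V).
  rewrite (_ : \sum_(l <- _) _ = r *m V); last first.
    by rewrite mulmx_sum_row big_enum.
  rewrite rV (multilinear_setrow0 wl) big_enum/= (bigD1 i)//= setrow_row big1 ?addr0.
    by move/esym/eqP; rewrite mulf_eq0 (negbTE ri) => /eqP.
  move=> l li; rewrite (wa _ i l) ?mulr0// 1?eq_sym//.
  by rewrite row_setrow row_setrow_neq.
have pS : posdef (V *m h *m V^T).
  split; first by rewrite !trmx_mul hs trmxK mulmxA.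
  move=> r r0; have := hp (r *m V); rewrite trmx_mul !mulmxA; apply.
  by apply/eqP => rV; apply: nr; exists r.
have [B [tB dB BE]] := cholesky pS.
have detB : 0 < \det B by rewrite det_trig// prodr_gt0.
have uB : B \in unitmx by rewrite unitmxE unitfE gt_eqF.
rewrite -{1}(mulKVmx uB V) (alternating_mulmx _ _ wl wa).
have we : w (invmx B *m V) <= 1.
  apply: wcal; rewrite trmx_mul -!mulmxA (mulmxA V) (mulmxA (V *m h)) -BE.
  by rewrite !mulmxA mulVmx// mul1mx -trmx_mul mulVmx// trmx1.
apply: (@le_trans _ _ (\det B)); first by rewrite ler_piMr// ltW.
by rewrite -BE; exact: det_le_trace.
Qed.

(** With [A *m A^T = g], the rows of [invmx A] are a [g]-orthonormal frame, so [invmx A *m D] falls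
    under the Euclidean case; the factor [\det A] split off by alternation is
    [Num.sqrt (\det g)]. *)
Lemma calibration_inequality k n (g : 'M[R]_k) (h : 'M[R]_n)
    (w : 'M[R]_(k, n) -> R) (D : 'M[R]_(k, n)) :
  (0 < k)%N -> posdef g -> posdef h -> multilinear w -> alternating w ->
  (forall e, e *m h *m e^T = 1%:M -> w e <= 1) ->
  w D <= (Num.sqrt k%:R ^+ k)^-1 *
    Num.sqrt (\tr (invmx g *m (D *m h *m D^T))) ^+ k * Num.sqrt (\det g).
Proof.
move=> k0 pg ph wl wa wcal; have [A [tA dA AE]] := cholesky pg.
have detA : 0 < \det A by rewrite det_trig// prodr_gt0.
have uA : A \in unitmx by rewrite unitmxE unitfE gt_eqF.
have -> : Num.sqrt (\det g) = \det A.
  by rewrite -AE det_mulmx det_tr -expr2 sqrtr_sqr gtr0_norm.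
have -> : invmx g = (invmx A)^T *m invmx A.
  apply: invmx_unique; rewrite -AE -mulmxA (mulmxA A^T) -trmx_mul mulVmx//.
  by rewrite trmx1 mul1mx mulmxV.
rewrite -{1}(mulKVmx uA D) (alternating_mulmx _ _ wl wa) mulrC ler_pM2r//.
rewrite (_ : \tr _ = \tr (invmx A *m D *m h *m (invmx A *m D)^T)).
  exact: calibration_le_trace.
by rewrite trmx_mul !mulmxA [RHS]mxtrace_mulC !mulmxA.
Qed.

Lemma posdef_det_gt0 k (S : 'M[R]_k) : posdef S -> 0 < \det S.
Proof.
move=> /cholesky[B [tB dB <-]]; rewrite det_mulmx det_tr mulr_gt0//.
  by rewrite det_trig// prodr_gt0.
by rewrite det_trig// prodr_gt0.
Qed.

End Calibration.

(** * Pullback of closed forms and homotopy invariance of the integral *)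

Section Stokes.
Context {R : realType}.

Lemma derive_sym_rV (V : normedModType R) n (U : set V) (f : V -> 'rV[R]_n) x v w :
  open U -> diff_class 2 U f -> U x -> 'D_v ('D_w f) x = 'D_w ('D_v f) x.
Proof.
move=> oU df Ux.
have E v' w' : 'D_v' ('D_w' f) x = \row_j 'D_v' ('D_w' (fun y => f y 0 j)) x.
  have d1 := diff_class_derivable (diff_class_derive w' df) Ux (v := v').
  rewrite (derive_mx d1); apply/rowP => j; rewrite !mxE; apply: near_eq_derive.
  apply: near_eq_in_open oU _ Ux => y Uy.
  by rewrite (derive_mx (diff_class_derivable df Uy (v := w'))) mxE.
apply: etrans (E v w) _; apply: etrans _ (esym (E w v)).
apply/rowP => j; rewrite [LHS]mxE [RHS]mxE.
by apply: (derive_sym v w oU _ Ux); move/diff_class_mxP: df; apply.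
Qed.

Lemma col_mx_ord0 k n (X : 'rV[R]_n) (W : 'M[R]_(k, n)) l :
  (col_mx X W : 'M[R]_(k.+1, n)) ord0 l = X 0 l.
Proof.
rewrite (_ : ord0 = lshift k (0 : 'I_1)); last exact: val_inj.
exact: col_mxEu.
Qed.

Lemma col_mx_lift k n (X : 'rV[R]_n) (W : 'M[R]_(k, n)) i l :
  (col_mx X W : 'M[R]_(k.+1, n)) (lift ord0 i) l = W i l.
Proof.
rewrite (_ : lift ord0 i = rshift 1 i); last exact: val_inj.
exact: col_mxEd.
Qed.

(** Deleting row [j + 1] leaves [X] on top of [W] without its row [j]; bringing [X] down to position
    [j] is a cycle of sign [(-1) ^+ j]. *)
Lemma row'_lift_col_mx k n (X : 'rV[R]_n) (W : 'M[R]_(k, n)) (w : 'M[R]_(k, n) -> R) j :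
  multilinear w -> alternating w ->
  w (row' (lift ord0 j) (col_mx X W : 'M[R]_(k.+1, n))) = (-1) ^+ j * w (setrow W j X).
Proof.
case: k => [|k] in W w j *; first by case: j.
move=> wl wa; pose s : 'S_k.+1 := lift_perm ord0 j 1.
have -> : row' (lift ord0 j) (col_mx X W : 'M[R]_(k.+2, n)) =
    row_perm s (setrow W j X) :> 'M[R]_(k.+1, n).
  apply/matrixP => a l; rewrite [LHS]mxE [RHS]mxE [RHS]mxE.
  case: (unliftP ord0 a) => [a'|] ->.
    rewrite lift_perm_lift perm1 eq_sym (negbTE (neq_lift _ _)).
    rewrite (_ : lift (lift _ _) _ = lift ord0 (lift j a')) ?col_mx_lift//.
    by apply: val_inj => /=; rewrite /bump !leq0n !add1n ltnS addnS.
  by rewrite lift_perm_id eqxx (_ : lift (lift _ _) _ = ord0) ?col_mx_ord0//; exact: val_inj.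
by rewrite (alternating_row_perm wl wa) odd_lift_perm odd_perm1 addbF/= signr_odd.
Qed.

(** The formula of [ext_d] on a coordinate space: the exterior derivative of [w] at [z], evaluated
    on constant fields. *)
Definition closed_at k n (w : 'rV[R]_n -> 'M[R]_(k, n) -> R) (z : 'rV[R]_n) :=
  forall A : 'M[R]_(k.+1, n),
    \sum_(i < k.+1) (-1) ^+ i * 'D_(row i A) (fun y => w y (row' i A)) z = 0.

Let eq_oppr0 (x : R) : x = - x -> x = 0.
Proof. by lra. Qed.

Section PullbackClosed.
Variables (V : normedModType R) (k n : nat) (w : 'rV[R]_n -> 'M[R]_(k, n) -> R).
Variables (O : set 'rV[R]_n) (U : set V) (Phi : V -> 'rV[R]_n).
Variables (t : V) (e : 'I_k -> V) (p : V).
Hypotheses (oO : open O) (oU : open U) (Up : U p).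
Hypothesis wl : forall z, multilinear (w z).
Hypothesis wa : forall z, alternating (w z).
Hypothesis dw : forall A, diff_class 1 O (w ^~ A).
Hypothesis PhiO : forall q, U q -> O (Phi q).
Hypothesis dPhi : diff_class 2 U Phi.

Definition frame (q : V) : 'M[R]_(k, n) := \matrix_i 'D_(e i) Phi q.

Lemma diff_class_frame : diff_class 1 U frame.
Proof.
apply/diff_class_mxP => // i j.
have /diff_class_mxP/(_ 0 j) := diff_class_derive (e i) dPhi.
by move/(_ oU); apply: eq_diff_class => // q _; rewrite [RHS]mxE.
Qed.

Lemma diff_class_setrow_frame j :
  diff_class 1 U (fun q => setrow (frame q) j ('D_t Phi q)).
Proof.
apply/diff_class_mxP => // a b.
have [aj|aj] := eqVneq a j.
  have /diff_class_mxP/(_ 0 b) := diff_class_derive t dPhi.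
  by move/(_ oU); apply: eq_diff_class => // q _; rewrite [RHS]mxE aj eqxx.
have /diff_class_mxP/(_ a b) := diff_class_frame.
by move/(_ oU); apply: eq_diff_class => // q _; rewrite [RHS]mxE (negbTE aj).
Qed.

(* Cartan's formula [L_t w = d (i_t w)] for closed [w]: after expanding both sides, the second
   derivatives of [Phi] cancel by symmetry. *)
Lemma pullback_closed : closed_at w (Phi p) ->
  'D_t (fun q => w (Phi q) (frame q)) p =
  \sum_j 'D_(e j) (fun q => w (Phi q) (setrow (frame q) j ('D_t Phi q))) p.
Proof.
move=> wc.
have dP v : derivable Phi p v by exact: (diff_class_derivable dPhi Up).
have dDP v v' : derivable ('D_v Phi) p v'.
  exact: (diff_class_derivable (diff_class_derive v dPhi) Up).
have dF v : derivable frame p v by exact: (diff_class_derivable diff_class_frame Up).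
have dS j v : derivable (fun q => setrow (frame q) j ('D_t Phi q)) p v.
  exact: (diff_class_derivable (diff_class_setrow_frame j) Up).
have rowF v i : row i ('D_v frame p) = 'D_v ('D_(e i) Phi) p.
  apply/rowP => l; rewrite (derive_mx (dF v)) (derive_mx (dDP _ _)) !mxE.
  by congr ('D_v _ p); apply/funext => q; rewrite mxE.
have rowSj v j : row j ('D_v (fun q => setrow (frame q) j ('D_t Phi q)) p) =
    'D_v ('D_t Phi) p.
  apply/rowP => l; rewrite (derive_mx (dS j v)) (derive_mx (dDP _ _)) !mxE.
  by congr ('D_v _ p); apply/funext => q; rewrite !mxE eqxx.
have rowSi v i j : i != j ->
    row i ('D_v (fun q => setrow (frame q) j ('D_t Phi q)) p) = 'D_v ('D_(e i) Phi) p.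
  move=> ij; apply/rowP => l; rewrite (derive_mx (dS j v)) (derive_mx (dDP _ _)) !mxE.
  by congr ('D_v _ p); apply/funext => q; rewrite !mxE (negbTE ij).
have [_ ->] := is_derive_form oO wl dw (PhiO Up) (dP t) (dF t).
under eq_bigr do rewrite rowF.
set W := frame p; set X := 'D_t Phi p; set z := Phi p.
have rowW j : row j W = 'D_(e j) Phi p by rewrite /W /frame rowK.
pose Z i j := 'D_(e i) ('D_(e j) Phi) p.
(* The second-derivative terms: row [j] is the velocity, and row [i] has been differentiated along
   [e j]. As [Z] is symmetric and [w] alternating, [A] is antisymmetric and its double sum
   vanishes. *)
pose A j i := if i == j then 0 else w z (setrow (setrow W j X) i (Z j i)).
have RHSj j : 'D_(e j) (fun q => w (Phi q) (setrow (frame q) j ('D_t Phi q))) p =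
    'D_(row j W) (w ^~ (setrow W j X)) z + w z (setrow W j ('D_t ('D_(e j) Phi) p)) +
    \sum_i A j i.
  have [_ ->] := is_derive_form oO wl dw (PhiO Up) (dP (e j)) (dS j (e j)).
  rewrite -/W -/X -/z rowW (bigD1 j)//= [X in _ = _ + X](bigD1 j)//=.
  rewrite [X in _ = _ + (X + _)]/A eqxx add0r addrA rowSj setrow_setrow.
rewrite (derive_sym_rV (e j) t oU dPhi Up); congr (_ + _).
  by apply: eq_bigr => i ij; rewrite /A (negbTE ij) rowSi.
under [RHS]eq_bigr do rewrite RHSj.
rewrite !big_split/=.
have -> : \sum_j \sum_i A j i = 0.
  set S := \sum_j _; apply: eq_oppr0.
  rewrite {1}/S exchange_big/= -sumrN; apply: eq_bigr => i _.
  rewrite -sumrN; apply: eq_bigr => j _; rewrite /A eq_sym.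
  have [_|ij] := eqVneq j i; first by rewrite oppr0.
  have -> : Z j i = Z i j by exact: (derive_sym_rV (e j) (e i) oU dPhi Up).
  exact: (alternating_cross (wl z) (wa z) W X (Z i j) ij).
rewrite addr0; congr (_ + _).
(* Closedness on the [k + 1] vectors made of the velocity and the frame trades the derivative along
   [X] for derivatives along the frame. *)
have := wc (col_mx X W : 'M[R]_(k.+1, n)).
rewrite big_ord_recl expr0 mul1r.
have -> : row ord0 (col_mx X W : 'M[R]_(k.+1, n)) = X.
  by apply/rowP => l; rewrite mxE col_mx_ord0.
have -> : row' ord0 (col_mx X W : 'M[R]_(k.+1, n)) = W.
  by apply/matrixP => i l; rewrite mxE col_mx_lift.
move/eqP; rewrite addr_eq0 => /eqP ->; rewrite -sumrN; apply: eq_bigr => j _.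
have -> : row (lift ord0 j) (col_mx X W : 'M[R]_(k.+1, n)) = row j W.
  by apply/rowP => l; rewrite mxE col_mx_lift [RHS]mxE.
have -> : (fun y => w y (row' (lift ord0 j) (col_mx X W : 'M[R]_(k.+1, n)))) =
    (-1) ^+ j *: (w ^~ (setrow W j X)).
  by apply/funext => y; rewrite (row'_lift_col_mx X W j (wl y) (wa y)).
have dd : derivable (w ^~ (setrow W j X)) z (row j W).
  by apply: diff_derivable; exact: (diff_class1_differentiable_real oO (dw _) (PhiO Up)).
rewrite -/z (deriveZ _ dd); move: ('D_(row j W) _ z) => c.
rewrite [_ *: c](_ : _ = (-1) ^+ j * c)//.
by rewrite mulrA lift0 exprS mulN1r mulNr -signr_odd -signr_odd -expr2 sqrr_sign mulN1r opprK.
Qed.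

End PullbackClosed.

Lemma diff_class_setU r (V W : normedModType R) (U1 U2 : set V) (f : V -> W) :
  diff_class r U1 f -> diff_class r U2 f -> diff_class r (U1 `|` U2) f.
Proof.
elim: r f => [|r IH] f [c1 d1] [c2 d2]; split=> //.
- by move=> x []; [exact: c1|exact: c2].
- by move=> x []; [exact: c1|exact: c2].
move=> v; have [? ?] := d1 v; have [? ?] := d2 v; split; last exact: IH.
by move=> x []; auto.
Qed.

(** Regularity is local: the extension by zero agrees with [f] on [U] and with [0] off [K], and
    these two open sets cover the space. *)
Lemma diff_class_patch r (V : normedModType R) (U K : set V) (f : V -> R) :
  open U -> closed K -> K `<=` U -> diff_class r U f ->
  (forall x, U x -> ~ K x -> f x = 0) -> diff_class r setT (f \_ U).
Proof.
move=> oU cK KU df f0.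
apply: (@diff_class_sub _ _ _ _ (U `|` ~` K)).
  by move=> x _; have [Kx|] := pselect (K x); [left; exact: KU|right].
apply: diff_class_setU.
  by apply: eq_diff_class df => // x Ux; rewrite patchE mem_set.
apply: (@eq_diff_class _ _ _ _ _ (fun=> 0 : R)); last exact: diff_class_cst.
  exact: closed_openC.
move=> x Kx; rewrite patchE; case: ifPn => // xU.
by rewrite f0//; exact: set_mem.
Qed.

Lemma diff_class_partial_C1 (V : normedModType R) (S : set V) (f : V -> R) p v :
  open S -> diff_class 1 S f -> S p -> partial_C1 v f p.
Proof.
move=> oS df Sp; have : nbhs p S by exact: open_nbhs_nbhs.
apply: filterS => q Sq; split.
- exact: (diff_class_derivable df Sq).
- exact: (diff_class_continuous df Sq).
exact: (diff_class_continuous (diff_class_derive v df) Sq).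
Qed.

Lemma compact_norm_le k (K : set 'rV[R]_k) : compact K ->
  exists2 r, 0 < r & forall y, K y -> `|y| <= r.
Proof.
move=> /compact_bounded[M [_ KM]]; exists (Num.max (M + 1) 1).
  by rewrite lt_max ltr01 orbT.
by move=> y Ky; apply: (KM _ _ y Ky); rewrite lt_max ltrDl ltr01.
Qed.

Lemma derive_lin_sum k (f : 'rV[R]_k -> R) z v : differentiable f z ->
  'D_v f z = \sum_l v 0 l * 'D_(delta_mx 0 l) f z.
Proof.
move=> df; rewrite deriveE// [in LHS](row_sum_delta v) linear_sum.
by apply: eq_bigr => l _; rewrite linearZ deriveE.
Qed.

(** The alternating sum is the expansion along the first column of [row_mx (A *m G) A], with [G] the
    gradient of [f]. That column is a combination of the others, so the matrix is singular: a
    nonzero alternating form of degree [k + 1] does not exist in dimension [k]. *)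
Lemma det_closed_at k (f : 'rV[R]_k -> R) z : differentiable f z ->
  closed_at (fun y (A : 'M[R]_k) => f y * \det A) z.
Proof.
move=> df A; pose G : 'cV[R]_k := \col_l 'D_(delta_mx 0 l) f z.
pose B : 'M[R]_(k.+1) := row_mx (A *m G) A.
have B0 i : B i ord0 = 'D_(row i A) f z.
  rewrite (derive_lin_sum _ df) /B (_ : ord0 = lshift k (0 : 'I_1)); last exact: val_inj.
  apply: etrans (row_mxEl _ _ _ _) _; rewrite mxE.
  by apply: eq_bigr => l _; rewrite !mxE.
have Bl i l : B i (lift ord0 l) = A i l.
  rewrite /B (_ : lift ord0 l = rshift 1 l); last exact: val_inj.
  exact: row_mxEr.
have detB : \det B = 0.
  apply/eqP; rewrite -det_tr; apply/det0P.
  exists (row_mx (1%:M : 'M[R]_1) (- G^T)).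
    apply/eqP => E.
    have /rowP/(_ (lshift k (0 : 'I_1))) :
      (row_mx (1%:M : 'M[R]_1) (- G^T) : 'rV[R]_(1 + k)) = 0 := E.
    by rewrite row_mxEl !mxE eqxx; move/eqP; rewrite oner_eq0.
  rewrite /B; apply: etrans (_ : _ = row_mx (1%:M : 'M[R]_1) (- G^T) *m (row_mx (A *m G) A)^T) _ => //.
  rewrite tr_row_mx mul_row_col mul1mx mulNmx trmx_mul.
  by rewrite subrr.
rewrite -[RHS]detB (expand_det_col _ ord0); apply: eq_bigr => i _.
have -> : 'D_(row i A) (fun y => f y * \det (row' i A)) z = \det (row' i A) * 'D_(row i A) f z.
  have dd : derivable f z (row i A) by exact: diff_derivable.
  rewrite (deriveM dd (derivable_cst (\det (row' i A)) _ _)) derive_cst.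
  by rewrite [_ *: (0 : R)]mulr0 add0r.
have -> : cofactor B i ord0 = (-1) ^+ i * \det (row' i A).
  rewrite /cofactor addn0; congr (_ * \det _).
  by apply/matrixP => a l; rewrite [LHS]mxE [LHS]mxE Bl [RHS]mxE.
by rewrite B0 [RHS]mulrC mulrA.
Qed.

Lemma open_between (a b : R) : open [set s : R | a < s < b].
Proof.
rewrite (_ : [set _ | _] = [set s | a < s] `&` [set s | s < b]).
  by apply: openI; [exact: open_gt|exact: open_lt].
by apply/seteqP; split=> s /=; [move=> /andP[]|move=> [? ?]; apply/andP].
Qed.

(** * Homotopy invariance of the integral of a pulled-back top-degree form *)

Section Homotopy.
Variables (k : nat) (Phi : R * 'rV[R]_k -> 'rV[R]_k) (f : 'rV[R]_k -> R).
Variables (U K : set 'rV[R]_k) (d : R).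

(** A positive margin [d] makes the time interval an open neighbourhood of [[0, 1]], so that time
    derivatives are available at the end points too. *)
Definition homotopy_domain := [set q : R * 'rV[R]_k | (- d < q.1 < 1 + d) /\ U q.2].
Local Notation S := homotopy_domain.

Definition space_dir (i : 'I_k) : R * 'rV[R]_k := (0, delta_mx 0 i).

Hypotheses (oU : open U) (cK : compact K) (KU : K `<=` U) (d0 : 0 < d).
Hypothesis dPhi : diff_class 2 S Phi.
Hypothesis df : diff_class 1 setT f.
Hypothesis f_supp : forall q, S q -> ~ K q.2 -> f (Phi q) = 0.

(** [w] is the top-degree form with coefficient [f], [G] the coefficient of its pullback at each
    time, [F] the extension of [G] by zero, and [B j] the flux in direction [j] obtained by
    contracting with the time velocity. *)
Let w (y : 'rV[R]_k) (A : 'M[R]_k) := f y * \det A.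
Let G (q : R * 'rV[R]_k) := w (Phi q) (frame Phi space_dir q).
Let F (q : R * 'rV[R]_k) := ((fun y => G (q.1, y)) \_ U) q.2.
Let B j (q : R * 'rV[R]_k) := w (Phi q) (setrow (frame Phi space_dir q) j ('D_(1, 0) Phi q)).

Lemma open_homotopy_domain : open S.
Proof.
rewrite (_ : S = fst @^-1` [set s | - d < s < 1 + d] `&` snd @^-1` U)//.
apply: openI; apply: open_comp; [|exact: open_between| |exact: oU].
  by move=> q _; exact: cvg_fst.
by move=> q _; exact: cvg_snd.
Qed.

Let wl z : multilinear (w z).
Proof.
move=> A A1 A2 i b c AE E1 E2.
by rewrite /w (determinant_multilinear AE E1 E2) mulrDr !(mulrCA (f z)).
Qed.

Let wa z : alternating (w z).
Proof. by move=> A i j ij AE; rewrite /w (det_alternating ij AE) mulr0. Qed.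

Let dw A : diff_class 1 setT (w ^~ A).
Proof.
have := diff_classM openT df (@diff_class_cst R 1 'rV[R]_k R setT (\det A)).
by apply.
Qed.

Let dG : diff_class 1 S G.
Proof.
exact: (diff_class_form openT wl open_homotopy_domain (fun _ _ => I) dw
  (diff_class_pred dPhi) (diff_class_frame _ open_homotopy_domain dPhi)).
Qed.

Let dB j : diff_class 1 S (B j).
Proof.
exact: (diff_class_form openT wl open_homotopy_domain (fun _ _ => I) dw
  (diff_class_pred dPhi) (diff_class_setrow_frame _ _ open_homotopy_domain dPhi j)).
Qed.

Let FG q : S q -> G q = F q.
Proof. by case: q => s y [_ Uy]; rewrite /F patchE mem_set. Qed.

Let closedK : closed K.
Proof. exact: compact_closed. Qed.

Let slice r (H : R * 'rV[R]_k -> R) (s : R) : - d < s < 1 + d -> diff_class r S H ->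
  diff_class r U (fun y => H (s, y)).
Proof.
move=> sd dH; apply: (@diff_class_sub _ _ _ _ ((fun y => (s, y)) @^-1` S)) => //.
apply: (@diff_class_affine _ _ _ _ _ S H (fun y => (s, y)) (fun v => (0, v))) => //.
  move=> x v a; rewrite -[RHS]/(a * 0 + s, a *: v + x).
  by rewrite mulr0 add0r.
by move=> y; exact: pair_continuousr.
Qed.

Let time_dom (s : R) : 0 <= s <= 1 -> - d < s < 1 + d.
Proof. by move: d0; lra. Qed.

Let B0 j (s : R) y : - d < s < 1 + d -> U y -> ~ K y -> B j (s, y) = 0.
Proof. by move=> sd Uy Ky; rewrite /B /w f_supp ?mul0r. Qed.

Let db j (s : R) : 0 <= s <= 1 -> diff_class 1 setT ((fun y => B j (s, y)) \_ U).
Proof.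
move=> /time_dom sd; apply: (diff_class_patch oU closedK KU).
  exact: (slice sd (dB j)).
by move=> y Uy Ky; exact: B0.
Qed.

(** On [U] this is Cartan's formula for [w], closed by degree. Off [U] both sides vanish, the right
    one because a neighbourhood of [y] misses [K]. *)
Let DF (s : R) y : 0 <= s <= 1 ->
  'D_(1, 0) F (s, y) = \sum_j 'D_(delta_mx 0 j) ((fun y => B j (s, y)) \_ U) y.
Proof.
move=> s01; have sd := time_dom s01; have [Uy|Uy] := pselect (U y).
  have Sq : S (s, y) by [].
  have -> : 'D_(1, 0) F (s, y) = 'D_(1, 0) G (s, y).
    by apply: near_eq_derive; apply: near_eq_in_open open_homotopy_domain _ Sq => q /FG.
  have dfP : differentiable f (Phi (s, y)).
    exact: (diff_class1_differentiable_real openT df).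
  rewrite [LHS](pullback_closed ((1, 0) : R * 'rV[R]_k) space_dir openT open_homotopy_domain Sq wl wa dw
    (fun _ _ => I) dPhi (det_closed_at dfP)).
  apply: eq_bigr => j _; rewrite -(@derive_affine _ _ _ _ (B j) (fun y => (s, y)) y (delta_mx 0 j)).
      apply: near_eq_derive; apply: near_eq_in_open oU _ Uy => z Uz.
      by rewrite patchE mem_set.
    move=> a; rewrite -[RHS]/(a * 0 + s, a *: delta_mx 0 j + y).
    by rewrite mulr0 add0r.
rewrite -(@derive_affine _ _ _ _ F (fun s => (s, y)) s 1); last first.
  by move=> a; rewrite -[RHS]/(a *: 1 + s, a *: 0 + y) scaler0 add0r.
rewrite (_ : _ \o _ = fun=> 0); last first.
  by apply/funext => a; rewrite /F /= patchE memNset.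
rewrite derive_cst big1// => j _.
rewrite (near_eq_derive (g := fun=> 0 : R)) ?derive_cst//.
have : nbhs y (~` K).
  by apply: open_nbhs_nbhs; split; [exact: closed_openC|move=> /KU].
apply: filterS => z Kz; rewrite patchE; case: ifPn => // /set_mem Uz.
by rewrite B0.
Qed.

Let dI (s : R) : 0 <= s <= 1 -> is_derive s (1 : R) (fun s => iterated_integral (fun y => F (s, y))) 0.
Proof.
move=> s01; have sd := time_dom s01; have [r r0 Kr] := compact_norm_le cK.
have D : is_derive s (1 : R) (fun s => iterated_integral (fun y => F (s, y)))
    (iterated_integral (fun y => 'D_(1, 0) F (s, y))).
  apply: (is_derive_iterated_integral r0 cK Kr).
    have : nbhs s `]- d, 1 + d[%classic.
      by apply: open_nbhs_nbhs; split; [exact: itv_open|rewrite /= in_itv].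
    apply: filterS => a /=; rewrite in_itv/= => ad y Ky.
    by rewrite /F patchE/=; case: ifPn => // /set_mem Uy; rewrite /G /w f_supp ?mul0r.
  move=> y Ky; apply: (diff_class_partial_C1 _ open_homotopy_domain).
    by apply: eq_diff_class dG; [exact: open_homotopy_domain|exact: FG].
  by split=> //; exact: KU.
apply: (is_derive_eq D).
rewrite (_ : (fun y => _) = fun y => \sum_j 'D_(delta_mx 0 j) ((fun y => B j (s, y)) \_ U) y);
  last by apply/funext => y; rewrite DF.
have b0 j y : r < `|y| -> ((fun y => B j (s, y)) \_ U) y = 0.
  move=> ry; rewrite patchE; case: ifPn => // /set_mem Uy; rewrite B0// => /Kr.
  by rewrite leNgt ry.
rewrite (@iterated_integral_sum _ _ _ _ _ r).
  by rewrite big1// => j _; apply: (iterated_integral_derive j r0 (db j s01)); exact: b0.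
move=> j _; apply: (diff_class_csupp (diff_class_derive _ (db j s01))).
by apply: diff_class_derive_supp; exact: b0.
Qed.

(** The time derivative of the integral is the integral of a divergence supported in the fixed
    compact [K], hence zero, and the mean value theorem makes the integral constant on [[0, 1]]. *)
Lemma homotopy_integral :
  iterated_integral ((fun y => f (Phi (1, y)) * \det (frame Phi space_dir (1, y))) \_ U) =
  iterated_integral ((fun y => f (Phi (0, y)) * \det (frame Phi space_dir (0, y))) \_ U).
Proof.
pose H s := iterated_integral (fun y => F (s, y)).
suff : H 1 = H 0 by [].
have [||s _] := @MVT_segment R H (fun=> 0) 0 1 ler01.
- by move=> s; rewrite in_itv/= => /andP[s0 s1]; apply: dI; rewrite !ltW.
- by apply: derivable_within_continuous => s; rewrite in_itv/= => /dI[].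
by move/eqP; rewrite mul0r subr_eq0 => /eqP.
Qed.

End Homotopy.

Lemma diff_class_id r (V : normedModType R) (U : set V) : diff_class r U (@id V).
Proof.
case: r => [|r]; split=> //; try by move=> x _; exact: cvg_id.
move=> v; split; first by move=> x _; exact: derivable_id.
rewrite (_ : 'D_v id = fun=> v); first exact: diff_class_cst.
by apply/funext => x; rewrite derive_id.
Qed.

Lemma diff_class_affine_map r (V W : normedModType R) (U : set V) (l l0 : V -> W) :
  (forall x v (t : R), l (t *: v + x) = t *: l0 v + l x) -> continuous l ->
  diff_class r U l.
Proof.
move=> ll cl; apply: (@diff_class_sub _ _ _ _ (l @^-1` setT)) => //.
exact: (diff_class_affine ll cl (diff_class_id r setT)).
Qed.

Lemma derive_affine_map (V W : normedModType R) (l : V -> W) x v w :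
  (forall t : R, l (t *: v + x) = t *: w + l x) -> 'D_v l x = w.
Proof. by move=> ll; have := derive_affine id ll; rewrite derive_id. Qed.

Lemma diff_class_coord r k (U : set 'rV[R]_k) j : diff_class r U (fun y => y 0 j : R).
Proof.
apply: (@diff_class_affine_map _ _ R _ (fun y : 'rV[R]_k => y 0 j) (fun y => y 0 j)).
  by move=> x v t; rewrite !mxE.
exact: coord_continuous.
Qed.

Lemma diff_class_fst r k (U : set (R * 'rV[R]_k)) : diff_class r U (fun q => q.1).
Proof.
apply: (@diff_class_affine_map _ _ _ _ (fun q => q.1) (fun q => q.1)) => //.
by move=> q; exact: cvg_fst.
Qed.

Lemma diff_class_snd r k (U : set (R * 'rV[R]_k)) j :
  diff_class r U (fun q => q.2 0 j : R).
Proof.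
apply: (@diff_class_affine_map _ _ R _ (fun q : R * 'rV[R]_k => q.2 0 j) (fun q => q.2 0 j)).
  by move=> x v t; rewrite /= !mxE.
move=> q; apply: (@continuous_comp _ _ _ snd (fun y : 'rV[R]_k => y 0 j)).
  exact: cvg_snd.
exact: coord_continuous.
Qed.

(** * Linear changes of variables *)

Lemma mulmx_norm_le m n (x : 'rV[R]_m) (A : 'M[R]_(m, n)) :
  `|x *m A| <= m%:R * `|A| * `|x|.
Proof.
apply: mx_norm_le => [|i j]; first by rewrite !mulr_ge0.
rewrite !mxE (le_trans (ler_norm_sum _ _ _))//.
apply: (@le_trans _ _ (\sum_(l < m) `|A| * `|x|)).
  by apply: ler_sum => l _; rewrite normrM mulrC ler_pM// le_mx_norm.
by rewrite sumr_const card_ord -[X in X <= _]mulr_natl mulrA.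
Qed.

Definition test_function k (f : 'rV[R]_k -> R) :=
  diff_class 1 setT f /\ exists r, forall y, r < `|y| -> f y = 0.

(** The homotopy is [x *m (1%:M + s *: N) + s *: b]. The bound [c], uniform in [s], confines the
    points sent into the support of [f] to one ball for all times. *)
Lemma affine_homotopy k (N : 'M[R]_k) (b : 'rV[R]_k) (c d : R) f :
  0 < c -> 0 < d ->
  (forall (s : R) (x : 'rV[R]_k), - d < s < 1 + d ->
    c * `|x| <= `|x *m (1%:M + s *: N)|) ->
  test_function f ->
  iterated_integral (fun x => f (x *m (1%:M + N) + b) * \det (1%:M + N)) =
  iterated_integral f.
Proof.
move=> c0 d0 cN [df [r fr]].
pose Phi (q : R * 'rV[R]_k) := q.2 *m (1%:M + q.1 *: N) + q.1 *: b.
(* If [|Phi (s, x)| <= r] then [c * |x| <= r + |s| * |b|], and [|s| <= 1 + d]. *)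
pose K := [set y : 'rV[R]_k | `|y| <= (r + (1 + d) * `|b|) / c].
have oS : open (homotopy_domain (@setT 'rV[R]_k) d) by apply: open_homotopy_domain; exact: openT.
have dPhi : diff_class 2 (homotopy_domain setT d) Phi.
  apply/diff_class_mxP => // i j; rewrite ord1.
  have d1 := @diff_class_fst 2 k (homotopy_domain setT d).
  have cst (a : R) := @diff_class_cst R 2 (R * 'rV[R]_k)%type R (homotopy_domain setT d) a.
  have D : diff_class 2 (homotopy_domain setT d)
      (fun q => \sum_l q.2 0 l * ((1%:M : 'M[R]_k) l j + q.1 * N l j) + q.1 * b 0 j).
    apply: (diff_classD oS); last exact: (diff_classM oS d1 (cst _)).
    apply: (diff_class_sum _ oS) => l _; apply: (diff_classM oS (diff_class_snd _ _ _)).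
    exact: (diff_classD oS (cst _) (diff_classM oS d1 (cst _))).
  apply: (eq_diff_class oS _ D) => q _; rewrite /Phi [RHS]mxE [in RHS]mxE [in RHS]mxE.
  by congr (_ + _); apply: eq_bigr => l _; rewrite !mxE.
have fr_supp q : homotopy_domain setT d q -> ~ K q.2 -> f (Phi q) = 0.
  move=> [qd _] /negP; rewrite -ltNge ltr_pdivrMr// => Kq; apply: fr.
  have := cN q.1 q.2 qd; have : `|q.1 *: b| <= (1 + d) * `|b|.
    by rewrite normrZ ler_wpM2r// ler_norml; move: qd; lra.
  have := ler_normB (Phi q) (q.1 *: b); rewrite {1}/Phi addrK.
  by move: Kq; rewrite mulrC; lra.
have frameE q : frame Phi (@space_dir k) q = 1%:M + q.1 *: N.
  apply/row_matrixP => i; rewrite rowK.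
  rewrite (derive_affine_map (w := row i (1%:M + q.1 *: N)))// => t.
  have -> : t *: space_dir i + q = (q.1, t *: delta_mx 0 i + q.2).
    by case: q => s x; rewrite -[LHS]/(t * 0 + s, t *: delta_mx 0 i + x) mulr0 add0r.
  rewrite /Phi/= mulmxDl -scalemxAl -rowE.
  by rewrite addrA.
have E (h : 'rV[R]_k -> R) : h \_ setT = h.
  by apply/funext => y; rewrite patchE mem_set.
have F1 : (fun y => f (Phi (1, y)) * \det (frame Phi (@space_dir k) (1, y))) =
    (fun x => f (x *m (1%:M + N) + b) * \det (1%:M + N)).
  by apply/funext => x; rewrite frameE /Phi /= !scale1r.
have F0 : (fun y => f (Phi (0, y)) * \det (frame Phi (@space_dir k) (0, y))) = f.
  by apply/funext => x; rewrite frameE /Phi/= !scale0r !addr0 mulmx1 det1 mulr1.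
have H := homotopy_integral (@openT 'rV[R]_k) (@closed_ball0_compact R k _) (fun _ _ => I)
  d0 dPhi df fr_supp.
apply: (etrans (esym (congr1 (@iterated_integral R k) (etrans (E _) F1)))).
apply: (etrans H); exact: (congr1 (@iterated_integral R k) (etrans (E _) F0)).
Qed.

Lemma test_function_translate k (b : 'rV[R]_k) f : test_function f ->
  iterated_integral (fun x => f (x + b)) = iterated_integral f.
Proof.
move=> tf; rewrite -(affine_homotopy (N := 0) b ltr01 ltr01 _ tf).
  congr iterated_integral; apply/funext => x.
  by rewrite addr0 mulmx1 det1 mulr1.
by move=> s x _; rewrite scaler0 addr0 mulmx1 mul1r.
Qed.

(** The determinant is signed, as for top-degree forms; the rule is established for positive
    determinants, the case that orientation provides. *)
Definition linear_cov k (A : 'M[R]_k) := forall f, test_function f ->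
  iterated_integral (fun x => f (x *m A)) * \det A = iterated_integral f.

Lemma unitmx_norm_ge k (A : 'M[R]_k) : A \in unitmx ->
  exists2 c, 0 < c & forall x : 'rV[R]_k, c * `|x| <= `|x *m A|.
Proof.
move=> uA; pose M := k%:R * `|invmx A| + 1.
have M0 : 0 < M by rewrite ltr_wpDl// mulr_ge0.
exists M^-1; first by rewrite invr_gt0.
move=> x; rewrite mulrC ler_pdivrMr// mulrC.
rewrite -{1}(mulmxK uA x); apply: (le_trans (mulmx_norm_le _ _)).
by rewrite ler_wpM2r// lerDl.
Qed.

Lemma test_function_affine k (A : 'M[R]_k) b f : A \in unitmx -> test_function f ->
  test_function (fun x => f (x *m A + b)).
Proof.
move=> uA [df [r fr]]; have [c c0 cA] := unitmx_norm_ge uA; split.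
  apply: (@diff_class_affine _ _ _ _ _ setT f (fun x => x *m A + b) (fun x => x *m A)) => //.
    by move=> x v t; rewrite mulmxDl -scalemxAl addrA.
  have : diff_class 0 setT (fun x : 'rV[R]_k => x *m A + b).
    apply/(diff_class_mxP _ _ openT) => i j.
    apply: (@eq_diff_class _ _ _ _ _ (fun x : 'rV[R]_k => \sum_l x 0 l * A l j + b 0 j)); first exact: openT.
      by move=> y _; rewrite ord1 [RHS]mxE [X in _ = X + _]mxE.
    apply: (diff_classD openT _ (diff_class_cst _ _ _)).
    apply: (diff_class_sum _ openT) => l _; apply: (diff_classM openT).
      exact: diff_class_coord.
    exact: diff_class_cst.
  by move=> /diff_class_continuous H x; exact: H.
exists ((r + `|b|) / c) => y; rewrite ltr_pdivrMr// => ry; apply: fr.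
have := cA y; have := ler_normB (y *m A + b) b; rewrite addrK.
by move: ry; rewrite mulrC; lra.
Qed.

Lemma test_function_linear k (A : 'M[R]_k) f : A \in unitmx -> test_function f ->
  test_function (fun x => f (x *m A)).
Proof.
move=> uA /(test_function_affine 0 uA).
by congr test_function; apply/funext => x; rewrite addr0.
Qed.

Lemma linear_covM k (A B : 'M[R]_k) : B \in unitmx ->
  linear_cov A -> linear_cov B -> linear_cov (A *m B).
Proof.
move=> uB lA lB f tf; rewrite -(lB f tf) -(lA _ (test_function_linear uB tf)).
rewrite det_mulmx mulrA; congr (_ * _ * _); congr iterated_integral.
by apply/funext => x; rewrite mulmxA.
Qed.

Lemma test_function_csupp k (f : 'rV[R]_k -> R) : test_function f ->
  exists2 r, 0 < r & csupp r f.
Proof.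
move=> [df [r fr]]; exists (Num.max r 1); first by rewrite lt_max ltr01 orbT.
split=> [y|y]; first exact: (diff_class_continuous df).
by rewrite gt_max => /andP[/fr].
Qed.

(** Since [N] squares to zero, [1%:M + s *: N] has inverse [1%:M - s *: N] for every [s], which
    bounds the whole path below uniformly. The factor 2 in [M] bounds [|s|] for [s] between -1 and
    2. *)
Lemma linear_cov_shear k (N : 'M[R]_k) : N *m N = 0 -> linear_cov (1%:M + N).
Proof.
move=> NN f tf.
have [r r0 cf] : exists2 r, 0 < r & csupp r (fun x => f (x *m (1%:M + N))).
  apply/test_function_csupp/test_function_linear => //.
  have /mulmx1_unit[] : (1%:M + N) *m (1%:M - N) = 1%:M; last by [].
  by rewrite mulmxBr mulmx1 mulmxDl mul1mx NN addr0 addrK.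
rewrite mulrC -(iterated_integralZ _ cf).
pose M := k%:R * (`|1%:M : 'M[R]_k| + 2 * `|N|) + 1.
have M0 : 0 < M by rewrite ltr_wpDl// mulr_ge0// addr_ge0// mulr_ge0.
rewrite -(@affine_homotopy _ N 0 M^-1 1 f _ ltr01 _ tf) ?invr_gt0//.
  by congr iterated_integral; apply/funext => x; rewrite addr0 mulrC.
move=> s x sd; rewrite mulrC ler_pdivrMr// mulrC.
have {1}-> : x = (x *m (1%:M + s *: N)) *m (1%:M - s *: N).
  rewrite -mulmxA mulmxBr mulmx1 mulmxDl mul1mx -scalemxAl -scalemxAr NN !scaler0 addr0.
  by rewrite addrK mulmx1.
apply: (le_trans (mulmx_norm_le _ _)); rewrite ler_wpM2r// /M.
rewrite (@le_trans _ _ (k%:R * (`|1%:M : 'M[R]_k| + 2 * `|N|)))// ?lerDl//.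
rewrite ler_wpM2l// (le_trans (ler_normB _ _))// lerD2l normrZ ler_wpM2r//.
by rewrite ler_norml; move: sd; lra.
Qed.

Let scale_bound (a m d s : R) : m <= 1 -> m <= a -> d * `|a - 1| <= m / 2 -> 0 < m ->
  - d < s < 1 + d -> m / 2 <= 1 + s * (a - 1).
Proof.
move=> m1 ma; have [a1|a1] := leP 0 (a - 1).
  by rewrite ger0_norm// => dm m0 /andP[s1 s2]; have := ler_wpM2r a1 (ltW s1); lra.
rewrite ltr0_norm// => dm m0 /andP[s1 s2].
have a1' : 0 <= - (a - 1) by lra.
by have := ler_wpM2r a1' (ltW s2); lra.
Qed.

(** For [s] in [[0, 1]] the factors [1 + s * (a - 1)] lie between 1 and [a], so they are at least
    [m]; [d] is chosen so that the margin costs at most half of that. *)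
Lemma linear_cov_scale (a : R) : 0 < a -> linear_cov (a%:M : 'M[R]_1).
Proof.
move=> a0 f tf.
have ua : a%:M \in @unitmx R 1 by rewrite unitmxE det_scalar1 unitfE gt_eqF.
have [r r0 cf] := test_function_csupp (test_function_linear ua tf).
rewrite mulrC -(iterated_integralZ _ cf).
pose m := Num.min 1 a; have m0 : 0 < m by rewrite lt_min ltr01.
pose d := m / 2 / (`|a - 1| + 1).
have a1 : 0 < `|a - 1| + 1 by rewrite ltr_wpDl.
have m2 : 0 < m / 2 by rewrite divr_gt0.
have d0 : 0 < d by rewrite divr_gt0.
have E : a%:M = 1%:M + (a - 1)%:M :> 'M[R]_1 by rewrite -raddfD/= addrC subrK.
have dm : d * `|a - 1| <= m / 2.
  by rewrite /d mulrAC ler_pdivrMr// ler_pM2l// lerDl.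
rewrite -(@affine_homotopy _ ((a - 1)%:M) 0 (m / 2) d f m2 d0 _ tf).
  by congr iterated_integral; apply/funext => x; rewrite addr0 mulrC -E.
move=> s x sd; rewrite scale_scalar_mx -raddfD/= mul_mx_scalar normrZ ler_wpM2r//.
apply: le_trans (ler_norm _); apply: scale_bound dm m0 sd.
  by rewrite ge_min lexx.
by rewrite ge_min lexx orbT.
Qed.

Lemma test_function_slice k s (f : 'rV[R]_k.+1 -> R) : test_function f ->
  test_function (fun y => f (rV_cons s y)).
Proof.
move=> [df [r fr]]; split; last first.
  by exists r => y ry; apply: fr; exact: lt_le_trans ry (rV_cons_normr _ _).
apply: (@diff_class_affine _ _ _ _ _ setT f (rV_cons s) (rV_cons 0)) => //.
  by move=> x v t; rewrite -rV_cons_linear mulr0 add0r.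
move=> y; apply: (@continuous_comp _ _ _ (fun y => (s, y))
  (fun p : R * 'rV[R]_k => rV_cons p.1 p.2)); first exact: pair_continuousr.
exact: rV_cons_continuous.
Qed.

(** The first coordinate is untouched, so the rule for [B] applies in each slice of the outermost
    integral. *)
Lemma linear_cov_block k (B : 'M[R]_k) : B \in unitmx -> linear_cov B ->
  linear_cov (block_mx (1%:M : 'M[R]_1) 0 0 B : 'M[R]_k.+1).
Proof.
move=> uB lB f tf; rewrite (det_ublock (1%:M : 'M[R]_1) 0 B : \det _ = _) det1 mul1r.
rewrite !iterated_integralS.
have uA : block_mx (1%:M : 'M[R]_1) 0 0 B \in @unitmx R k.+1.
  by rewrite unitmxE (det_ublock (1%:M : 'M[R]_1) 0 B : \det _ = _) det1 mul1r -unitmxE.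
have [r r0 cf] := test_function_csupp (test_function_linear uA tf).
rewrite mulrC -(csupp_RintegralZ _ (csupp_iterated_integral r0 cf)).
congr Rintegral; apply/funext => s.
rewrite -[RHS](lB _ (test_function_slice s tf)) mulrC; congr (iterated_integral _ * _).
apply/funext => y; congr (f _); rewrite /rV_cons.
have := mul_row_block (s%:M : 'M[R]_1) y (1%:M : 'M[R]_1) 0 0 B.
by rewrite mulmx1 !mulmx0 addr0 add0r.
Qed.

Lemma mx11_1Dblock k (b : 'rV[R]_k) (c : 'cV[R]_k) :
  block_mx (1%:M : 'M[R]_1) b c 1%:M = 1%:M + block_mx 0 b c 0 :> 'M[R]_(1 + k).
Proof. by rewrite scalar_mx_block add_block_mx !addr0 !add0r. Qed.

Lemma linear_cov_ublock k (b : 'rV[R]_k) :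
  linear_cov (block_mx (1%:M : 'M[R]_1) b 0 1%:M : 'M[R]_(1 + k)).
Proof.
rewrite mx11_1Dblock; apply: linear_cov_shear.
by rewrite mulmx_block !mulmx0 !mul0mx !addr0 block_mx0.
Qed.

Lemma linear_cov_lblock k (c : 'cV[R]_k) :
  linear_cov (block_mx (1%:M : 'M[R]_1) 0 c 1%:M : 'M[R]_(1 + k)).
Proof.
rewrite mx11_1Dblock; apply: linear_cov_shear.
by rewrite mulmx_block !mulmx0 !mul0mx !addr0 block_mx0.
Qed.

(* Block elimination writes [A] as a product of shears and scalings, each joined to the
   identity by a homotopy of invertible maps. *)
Lemma linear_cov_det_gt0 k (A : 'M[R]_k) : 0 < \det A -> linear_cov A.
Proof.
elim: k A => [|[|k] IH] A dA.
- move=> f tf; rewrite det_mx00 mulr1; congr iterated_integral.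
  by apply/funext => x; congr f; apply/rowP => -[].
- rewrite [A]mx11_scalar; apply: linear_cov_scale.
  by move: dA; rewrite {1}[A]mx11_scalar det_scalar1.
have uu (b : 'rV[R]_k.+1) : block_mx (1%:M : 'M[R]_1) b 0 1%:M \in @unitmx R (1 + k.+1).
  by rewrite unitmxE det_ublock !det1 mul1r unitr1.
have ul (c : 'cV[R]_k.+1) : block_mx (1%:M : 'M[R]_1) 0 c 1%:M \in @unitmx R (1 + k.+1).
  by rewrite unitmxE det_lblock !det1 mul1r unitr1.
(* With pivot 1, two shears reduce the matrix to its Schur complement [C], which has the same
   determinant and falls under the induction hypothesis. *)
have pivot1 (b : 'rV[R]_k.+1) (c : 'cV[R]_k.+1) B :
    0 < \det (block_mx (1%:M : 'M[R]_1) b c B) ->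
    linear_cov (block_mx (1%:M : 'M[R]_1) b c B : 'M[R]_(1 + k.+1)).
  move=> dB; pose C := B - c *m b.
  have E : block_mx (1%:M : 'M[R]_1) b c B =
      block_mx (1%:M : 'M[R]_1) 0 c 1%:M *m block_mx (1%:M : 'M[R]_1) 0 0 C *m
      block_mx (1%:M : 'M[R]_1) b 0 1%:M :> 'M[R]_(1 + k.+1).
    rewrite !mulmx_block !mulmx0 !mul0mx !mulmx1 !mul1mx !addr0 !add0r.
    by rewrite !mul1mx /C addrC subrK.
  have dC : 0 < \det C.
    move: dB; rewrite E !det_mulmx det_lblock !det_ublock !det1 !mul1r.
    by rewrite mulr1.
  have uC : C \in unitmx by rewrite unitmxE unitfE gt_eqF.
  have uD : block_mx (1%:M : 'M[R]_1) 0 0 C \in @unitmx R (1 + k.+1).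
    by rewrite unitmxE det_ublock det1 mul1r -unitmxE.
  rewrite E; apply: linear_covM => //; last exact: linear_cov_ublock.
  apply: linear_covM => //; first exact: linear_cov_lblock.
  by apply: linear_cov_block => //; exact: IH.
(* A combination of the other columns, with coefficients [e], is added to the first column to turn
   the corner into 1. Shears do this whatever the sign of [a], so no scaling by a negative factor
   arises. *)
have pivot2 (a : R) (b : 'rV[R]_k.+1) (c : 'cV[R]_k.+1) B : b != 0 ->
    0 < \det (block_mx (a%:M : 'M[R]_1) b c B) ->
    linear_cov (block_mx (a%:M : 'M[R]_1) b c B : 'M[R]_(1 + k.+1)).
  move=> b0 dB.
  have /existsP[j bj] : [exists j, b 0 j != 0].
    apply: contraR b0; rewrite negb_exists => /forallP b0.
    by apply/eqP/rowP => j; rewrite mxE; apply/eqP; have := b0 j; rewrite negbK.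
  pose e : 'cV[R]_k.+1 := ((1 - a) / b 0 j) *: delta_mx j 0.
  have be : b *m e = (1 - a)%:M.
    rewrite -scalemxAr -colE; apply/matrixP => i l; rewrite !ord1 !mxE.
    by rewrite divfK// eqxx.
  have E : block_mx (a%:M : 'M[R]_1) b c B =
      block_mx (1%:M : 'M[R]_1) b (c + B *m e) B *m block_mx (1%:M : 'M[R]_1) 0 (- e) 1%:M
      :> 'M[R]_(1 + k.+1).
    rewrite mulmx_block !mulmx0 !mulmx1 !add0r !mulmxN be addrK.
    by congr block_mx; rewrite -raddfB/= opprB addrC subrK.
  rewrite E; apply: linear_covM => //; last exact: linear_cov_lblock.
  by apply: pivot1; move: dB; rewrite E det_mulmx det_lblock !det1 !mulr1.
move: A dA; suff H (A : 'M[R]_(1 + k.+1)) : 0 < \det A -> linear_cov A by [].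
rewrite -(submxK A) [ulsubmx A]mx11_scalar.
move: (ulsubmx A 0 0) (ursubmx A) (dlsubmx A) (drsubmx A) => a b c B.
(* If [b = 0], the first column is added to the second; the new [b] is [a *: e], nonzero because [a]
   is. *)
have [->|b0] := eqVneq b 0; last exact: pivot2.
move=> dB; have a0 : a != 0.
  by apply: contraTneq dB => ->; rewrite det_lblock det_scalar1 mul0r ltxx.
pose e : 'rV[R]_k.+1 := delta_mx 0 0.
have E : block_mx (a%:M : 'M[R]_1) 0 c B =
    block_mx (a%:M : 'M[R]_1) (a *: e) c (B + c *m e) *m block_mx (1%:M : 'M[R]_1) (- e) 0 1%:M
    :> 'M[R]_(1 + k.+1).
  rewrite mulmx_block !mulmx0 !mulmx1 !addr0 !mulmxN mul_scalar_mx addNr.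
  by rewrite addrC addrK.
rewrite E; apply: linear_covM => //; last exact: linear_cov_ublock.
apply: pivot2; last by move: dB; rewrite E det_mulmx det_ublock !det1 !mulr1.
rewrite scaler_eq0 negb_or a0; apply/eqP => /rowP/(_ 0).
by rewrite !mxE eqxx => /eqP; rewrite oner_eq0.
Qed.

End Stokes.

(** * Change of variables *)

Section ChangeOfVariables.
Context {R : realType} (k : nat).
Implicit Types (U V K : set 'rV[R]_k) (f : 'rV[R]_k -> R).

Lemma frame_slice n (Phi : R * 'rV[R]_k -> 'rV[R]_n) s x :
  frame Phi (@space_dir R k) (s, x) = \matrix_i 'D_(delta_mx 0 i) (fun y => Phi (s, y)) x.
Proof.
apply/row_matrixP => i; rewrite !rowK.
rewrite -(@derive_affine _ _ _ _ Phi (fun y => (s, y)) x (delta_mx 0 i))//.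
by move=> a; rewrite -[RHS]/(a * 0 + s, a *: delta_mx 0 i + x) mulr0 add0r.
Qed.

Lemma jacobian_rows n (phi : 'rV[R]_k -> 'rV[R]_n) x : differentiable phi x ->
  jacobian phi x = \matrix_i 'D_(delta_mx 0 i) phi x.
Proof.
by move=> dphi; apply/row_matrixP => i; rewrite rowK deriveEjacobian// -rowE.
Qed.

Lemma closed_ball_compact (p : 'rV[R]_k) (r : R) : compact [set x | `|x - p| <= r].
Proof.
apply: bounded_closed_compact.
  exists (r + `|p|); split; [exact: num_real|move=> M rM x /= xr].
  have := ler_normD (x - p) p; rewrite subrK => /le_trans -> //.
  by rewrite (le_trans _ (ltW rM))// lerD2r.
apply: (@closed_comp _ _ (fun y : 'rV[R]_k => `|y - p|) [set x : R | x <= r]).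
  move=> y _; have c1 : {for y, continuous (fun y : 'rV[R]_k => y - p)}.
    by apply: continuousB; [exact: cvg_id|exact: cst_continuous].
  exact: (continuous_comp c1 (@norm_continuous _ _ (y - p))).
exact: closed_le.
Qed.

Lemma differentiable_near n (phi : 'rV[R]_k -> 'rV[R]_n) p (e : R) :
  differentiable phi p -> 0 < e ->
  \forall h \near (0 : 'rV[R]_k), `|phi (h + p) - phi p - h *m jacobian phi p| <= e * `|h|.
Proof.
move=> dphi e0; have /eqaddoP/(_ e e0) := diff_locally dphi.
by apply: filterS => h; rewrite !fctE /= /jacobian mul_rV_lin1 opprD addrA.
Qed.

Lemma diff_class1_real (D : set R) (f df : R -> R) : open D ->
  (forall t, D t -> is_derive t (1 : R) f (df t)) ->
  (forall t, D t -> {for t, continuous df}) -> diff_class 1 D f.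
Proof.
move=> oD fd cdf.
have dff t : D t -> differentiable f t by move=> /fd[? _]; exact/derivable1_diffP.
split; first by move=> t Dt; exact: (differentiable_continuous (dff t Dt)).
move=> v; split; first by move=> t Dt; exact: (diff_derivable (dff t Dt)).
apply: (@eq_diff_class _ _ _ _ _ (fun t => v * df t) _ oD) => [t Dt|].
  have [_ <-] := fd t Dt.
  by rewrite !deriveE; [rewrite -[in RHS](mulr1 v) [RHS]linearZ|exact: dff|exact: dff].
by split=> // t Dt; apply: continuousM; [exact: cst_continuous|exact: cdf].
Qed.

(** Scalars are viewed as rows of length one, because [diff_class_comp] is stated for row
    vectors. *)
Lemma diff_class_comp_real r (W : normedModType R) (O : set W) (D : set R) (f : R -> R)
    (g : W -> R) : open O -> open D -> (forall x, O x -> D (g x)) ->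
  diff_class r D f -> diff_class r O g -> diff_class r O (f \o g).
Proof.
move=> oO oD gD df dg.
have df' : diff_class r ((fun y : 'rV[R]_1 => y 0 0) @^-1` D) (fun y : 'rV[R]_1 => f (y 0 0)).
  apply: (@diff_class_affine _ _ _ _ _ D f (fun y : 'rV[R]_1 => y 0 0) (fun y => y 0 0)) => //.
    by move=> x v t; rewrite !mxE.
  exact: coord_continuous.
have oD' : open ((fun y : 'rV[R]_1 => y 0 0) @^-1` D).
  by apply: open_comp => // y _; exact: coord_continuous.
have dg' : diff_class r O (fun x => (g x)%:M : 'rV[R]_1).
  apply/(diff_class_mxP _ _ oO) => i j; apply: (eq_diff_class oO _ dg) => x _.
  by rewrite mxE !ord1 eqxx.
have gD' x : O x -> ((fun y : 'rV[R]_1 => y 0 0) @^-1` D) (g x)%:M.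
  by rewrite /= mxE eqxx; exact: gD.
have := diff_class_comp oO oD' gD' dg' df'.
by apply: eq_diff_class => // x _ /=; rewrite mxE eqxx.
Qed.

(** Cut-offs need only be C^1, so the squared positive part is a sufficient building block; [bump1]
    composes two copies to pass from 1 to 0 on the interval from 1 to 2. *)
Definition sq_pos (t : R) : R := Num.max t 0 ^+ 2.

Lemma sq_pos_le0 t : t <= 0 -> sq_pos t = 0.
Proof. by move=> t0; rewrite /sq_pos max_r// expr0n. Qed.

Lemma sq_pos_ge0 t : 0 <= t -> sq_pos t = t ^+ 2.
Proof. by move=> t0; rewrite /sq_pos max_l. Qed.

Lemma diff_class_sq_pos : diff_class 1 setT sq_pos.
Proof.
apply: (@diff_class1_real setT _ (fun t => 2 * Num.max t 0) openT); last first.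
  move=> t _; apply: cvgM; first exact: cvg_cst.
  by apply: continuous_max; [exact: cvg_id|exact: cst_continuous].
move=> t _; have [t0|t0|->] := ltgtP t 0.
- rewrite mulr0; apply: (@near_eq_is_derive _ _ _ (fun=> 0 : R)).
    have : nbhs t [set s : R | s < 0] by apply: open_nbhs_nbhs; split=> //; exact: open_lt.
    by apply: filterS => s /= s0; rewrite sq_pos_le0// ltW.
- apply: (@near_eq_is_derive _ _ _ (fun s : R => s ^+ 2)).
    have : nbhs t [set s : R | 0 < s] by apply: open_nbhs_nbhs; split=> //; exact: open_gt.
    by apply: filterS => s /= s0; rewrite sq_pos_ge0// ltW.
  apply: DeriveDef; first exact: exprn_derivable.
  by rewrite exp_derive [_ *: 1]mulr1 expr1 -mulr_natl.
rewrite mulr0; apply: is_derive_remainder => e e0.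
apply/nbhs_ballP; exists e => //= h; rewrite -ball_normE /= sub0r normrN => he.
rewrite addr0 (@sq_pos_le0 0)// mulr0 !subr0.
have [h0|h0] := leP h 0; first by rewrite sq_pos_le0// normr0 mulr_ge0// ltW.
rewrite (sq_pos_ge0 (ltW h0)) expr2 normrM; exact: (ler_wpM2r (normr_ge0 h) (ltW he)).
Qed.

Definition bump1 (t : R) : R := sq_pos (1 - sq_pos (t - 1)).

Lemma bump1_1 t : t <= 1 -> bump1 t = 1.
Proof.
move=> t1; rewrite /bump1 (@sq_pos_le0 (t - 1)) ?subr_le0// subr0.
by rewrite sq_pos_ge0// expr1n.
Qed.

Lemma bump1_0 t : 2 <= t -> bump1 t = 0.
Proof.
move=> t2; have t1 : 1 <= t - 1 by lra.
rewrite /bump1 (@sq_pos_ge0 (t - 1)) ?(le_trans _ t1)//.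
by rewrite sq_pos_le0// subr_le0 exprn_ege1.
Qed.

Lemma diff_class_bump1 : diff_class 1 setT bump1.
Proof.
have dB (f : R -> R) c : diff_class 1 setT f -> diff_class 1 setT (fun t => f t - c).
  move=> df; apply: (diff_classB openT df); exact: diff_class_cst.
apply: (diff_class_comp_real openT openT (fun _ _ => I) diff_class_sq_pos).
apply: (diff_classB openT); first exact: diff_class_cst.
apply: (diff_class_comp_real openT openT (fun _ _ => I) diff_class_sq_pos).
by apply: dB; exact: diff_class_id.
Qed.

(** Balls of the sup norm are cubes, hence the product over coordinates. The square removes the sign
    smoothly; with [rho / 2] as unit, the value is 1 on the half ball and 0 from radius [rho] on,
    where some squared ratio reaches 4. *)
Definition bump (q : 'rV[R]_k) (rho : R) (x : 'rV[R]_k) : R :=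
  \prod_j bump1 (((x 0 j - q 0 j) / (rho / 2)) ^+ 2).

Lemma diff_class_bump q rho : diff_class 1 setT (bump q rho).
Proof.
apply: (diff_class_prod _ openT) => j.
apply: (diff_class_comp_real openT openT (fun _ _ => I) diff_class_bump1).
have d1 : diff_class 1 setT (fun x : 'rV[R]_k => (x 0 j - q 0 j) / (rho / 2)).
  apply: (diff_classM openT); last exact: diff_class_cst.
  by apply: (diff_classB openT); [exact: diff_class_coord|exact: diff_class_cst].
exact: (diff_classM openT d1 d1).
Qed.

Lemma bump_1 q rho x : 0 < rho -> `|x - q| <= rho / 2 -> bump q rho x = 1.
Proof.
move=> r0 xq; rewrite /bump big1// => j _; apply: bump1_1.
have := le_trans (le_mx_norm (x - q) 0 j) xq; rewrite !mxE => xj.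
have r2 : 0 < rho / 2 by rewrite divr_gt0.
rewrite -real_normK ?num_real// exprn_ile1// normrM normfV (gtr0_norm r2).
by rewrite ler_pdivrMr// mul1r.
Qed.

Lemma bump_0 q rho x : 0 < rho -> rho <= `|x - q| -> bump q rho x = 0.
Proof.
move=> r0 xq; have r2 : 0 < rho / 2 by rewrite divr_gt0.
(* The slack 9/10 yields a coordinate by contradiction and keeps the squared ratio at least
   [(18 / 10) ^+ 2], above the threshold 2 of [bump1]. *)
have [j xj] : exists j, rho * (9 / 10) < `|x 0 j - q 0 j|.
  apply: contrapT => /forallNP H.
  have : `|x - q| <= rho * (9 / 10).
    apply: mx_norm_le => [|i j]; first by rewrite mulr_ge0 ?ltW// divr_ge0.
    by rewrite ord1 !mxE leNgt; apply/negP; exact: H.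
  by move=> /(le_trans xq); lra.
rewrite /bump (bigD1 j)//= bump1_0 ?mul0r//.
rewrite -real_normK ?num_real// normrM normfV (gtr0_norm r2).
have : 18 / 10 <= `|x 0 j - q 0 j| / (rho / 2) by rewrite ler_pdivlMr//; lra.
move: (`|x 0 j - q 0 j| / (rho / 2)) => z z1; have p : 0 <= 18 / 10 :> R by lra.
by rewrite expr2; have := ler_pM p p z1 z1; lra.
Qed.

(** * Change of variables for a diffeomorphism, locally and then globally *)

Section Diffeo.
Variables (U V : set 'rV[R]_k) (phi psi : 'rV[R]_k -> 'rV[R]_k).
Hypotheses (oU : open U) (oV : open V).
Hypothesis phiV : forall x, U x -> V (phi x).
Hypothesis psiU : forall y, V y -> U (psi y).
Hypothesis phiK : forall x, U x -> psi (phi x) = x.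
Hypothesis psiK : forall y, V y -> phi (psi y) = y.
Hypothesis dphi : diff_class 2 U phi.
Hypothesis cpsi : forall y, V y -> {for y, continuous psi}.
Hypothesis jphi : forall x, U x -> 0 < \det (jacobian phi x).

Let dfphi x : U x -> differentiable phi x.
Proof.
by move=> Ux; exact: (diff_class1_differentiable oU (diff_class_pred dphi) Ux).
Qed.

Section Straighten.
Variables (p q : 'rV[R]_k) (A : 'M[R]_k).

(* With [q = phi p] and [A] the Jacobian at [p], this joins the linearization of [phi] to [phi]. *)
Definition straighten (z : R * 'rV[R]_k) :=
  (1 - z.1) *: (q + (z.2 - p) *m A) + z.1 *: phi z.2.

Lemma diff_class_straighten U' d : open U' -> U' `<=` U ->
  diff_class 2 (homotopy_domain U' d) straighten.
Proof.
move=> oU' U'U; have oS : open (homotopy_domain U' d) by exact: open_homotopy_domain.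
apply/(diff_class_mxP _ _ oS) => i j; rewrite ord1.
have d1 := @diff_class_fst R 2 k (homotopy_domain U' d).
have cst (a : R) := @diff_class_cst R 2 (R * 'rV[R]_k)%type R (homotopy_domain U' d) a.
have dp : diff_class 2 (homotopy_domain U' d) (fun z => phi z.2 0 j).
  apply: (@diff_class_sub _ _ _ _ (snd @^-1` U)); first by move=> z [_ /U'U].
  apply: (@diff_class_affine _ _ _ _ _ U (fun x => phi x 0 j) snd snd) => //.
    by move=> z; exact: cvg_snd.
  by have /(diff_class_mxP _ _ oU) := dphi; apply.
have D : diff_class 2 (homotopy_domain U' d) (fun z =>
    (1 - z.1) * (q 0 j + \sum_l (z.2 0 l - p 0 l) * A l j) + z.1 * phi z.2 0 j).
  apply: (diff_classD oS); last exact: (diff_classM oS d1 dp).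
  apply: (diff_classM oS); first exact: (diff_classB oS (cst 1) d1).
  apply: (diff_classD oS (cst _)); apply: (diff_class_sum _ oS) => l _.
  apply: (diff_classM oS _ (cst _)); apply: (diff_classB oS _ (cst _)).
  exact: diff_class_snd.
apply: (eq_diff_class oS _ D) => z _; rewrite /straighten [RHS]mxE; congr (_ + _).
  rewrite [RHS]mxE [X in _ = _ * X]mxE; congr (_ * (_ + _)).
  by rewrite [RHS]mxE; apply: eq_bigr => l _; rewrite !mxE.
by rewrite [RHS]mxE.
Qed.

Lemma straighten0 x : straighten (0, x) = q + (x - p) *m A.
Proof. by rewrite /straighten /= subr0 scale1r scale0r addr0. Qed.

Lemma straighten1 x : straighten (1, x) = phi x.
Proof. by rewrite /straighten /= subrr scale0r scale1r add0r. Qed.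

Lemma frame_straighten0 x : frame straighten (@space_dir R k) (0, x) = A.
Proof.
rewrite frame_slice; apply/row_matrixP => i; rewrite rowK.
under eq_fun do rewrite straighten0.
rewrite (derive_affine_map (w := row i A))// => t.
rewrite -addrA mulmxDl -scalemxAl -rowE; exact: addrCA.
Qed.

Lemma frame_straighten1 x : U x -> frame straighten (@space_dir R k) (1, x) = jacobian phi x.
Proof.
move=> Ux; rewrite frame_slice jacobian_rows; last exact: dfphi.
have -> // : (fun y => straighten (1, y)) = phi.
by apply/funext => y; exact: straighten1.
Qed.

End Straighten.

Let straighten_bound (c x e s n : R) : c * x <= n + s * e -> s <= 2 -> 0 <= e ->
  e <= c / 4 * x -> c / 2 * x <= n.
Proof. by move=> H s2 e0 ex; have := ler_wpM2r e0 s2; lra. Qed.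

(* Near [p] the homotopy [straighten] moves points at distance comparable to [|x - p|], so it
   keeps the support of [f] inside a ball and the claim reduces to the linear case. *)
Lemma local_change_of_variables q : V q ->
  exists2 rho, 0 < rho & forall f, diff_class 1 setT f ->
    (forall y, rho <= `|y - q| -> f y = 0) ->
    iterated_integral ((fun x => f (phi x) * \det (jacobian phi x)) \_ U) =
    iterated_integral f.
Proof.
move=> Vq; pose p := psi q; have Up : U p by exact: psiU.
pose A := jacobian phi p; have dA : 0 < \det A by exact: jphi.
have uA : A \in unitmx by rewrite unitmxE unitfE gt_eqF.
have [c c0 cA] := unitmx_norm_ge uA.
(* The homotopy multiplies the linearization error by [|s| <= 2], so a relative error of [c / 4]
   costs at most half of the lower bound [c]. *)
have c4 : 0 < c / 4 by rewrite divr_gt0.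
have /nbhs_ballP[r1 /= r10 Br1] : nbhs p U by exact: open_nbhs_nbhs.
have /nbhs_ballP[r2 /= r20 Br2] := differentiable_near (dfphi Up) c4.
pose r := Num.min r1 r2.
have r0 : 0 < r by rewrite lt_min r10.
have approx x : `|x - p| < r -> U x /\ `|phi x - q - (x - p) *m A| <= c / 4 * `|x - p|.
  rewrite lt_min => /andP[xr1 xr2]; split.
    by apply: Br1; rewrite -ball_normE /= distrC.
  have := Br2 (x - p); rewrite -ball_normE /= sub0r normrN subrK psiK//.
  by apply.
have /nbhs_ballP[r3 /= r30 Br3] : nbhs q V by exact: open_nbhs_nbhs.
have r2' : 0 < r / 2 by rewrite divr_gt0.
have /cvgrPdist_le/(_ _ r2')/nbhs_ballP[r4 /= r40 Br4] := cpsi Vq.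
have psi_near y : `|y - q| < r4 -> `|psi y - p| <= r / 2.
  by move=> yr; rewrite distrC; apply: Br4; rewrite -ball_normE /= distrC.
(* By [c * r / 4], [straighten] sends points at distance between [r / 2] and [r] from [p] at least
   [rho] away from [q]; by [r4], every point of [U] that [phi] sends within [rho] of [q] is within
   [r / 2] of [p]. *)
pose rho := Num.min (c * r / 4) (Num.min r3 r4).
have rho0 : 0 < rho by rewrite !lt_min r30 r40 divr_gt0// mulr_gt0.
exists rho => // f df fr.
pose U' := [set x | `|x - p| < r].
have oU' : open U'.
  rewrite (_ : U' = ball p r); first exact: ball_open.
  by apply/seteqP; split=> x; rewrite -ball_normE /= distrC.
have U'U : U' `<=` U by move=> x /approx[].
pose K := [set x | `|x - p| <= r / 2].
have KU' : K `<=` U' by move=> x /= /le_lt_trans; apply; lra.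
have cr x : r / 2 <= `|x - p| -> rho <= c / 2 * `|x - p|.
  move=> xr; rewrite /rho ge_min; apply/orP; left.
  by have := ler_wpM2l (ltW c0) xr; lra.
have cr' x : r <= `|x - p| -> rho <= c * `|x - p|.
  move=> xr; have r2r : r / 2 <= r by rewrite ler_pdivrMr// ler_peMr ?ler1n// ltW.
  apply: (le_trans (cr x (le_trans r2r xr))).
  by rewrite ler_wpM2r// ler_pdivrMr// ler_peMr ?ler1n// ltW.
have tf : test_function f.
  split; first exact: df.
  exists (rho + `|q|) => y; rewrite -ltrBrDr => ry; apply: fr.
  exact: le_trans (ltW ry) (lerB_dist _ _).
have f_supp z : homotopy_domain U' 1 z -> ~ K z.2 -> f (straighten p q A z) = 0.
  move=> [/andP[s1 s2] U'x] /negP; rewrite -ltNge => Kx; apply: fr.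
  apply: (le_trans (cr _ (ltW Kx))).
  have [_ ax] := approx _ U'x.
  apply: (straighten_bound (e := `|phi z.2 - q - (z.2 - p) *m A|) (s := `|z.1|)) ax => //.
    apply: (le_trans (cA _)); rewrite -normrZ.
    have E : (z.2 - p) *m A = straighten p q A z - q -
        z.1 *: (phi z.2 - q - (z.2 - p) *m A).
      rewrite /straighten; move: (_ *m A) (phi z.2) => a b.
      rewrite -addrA -opprD scalerBl scale1r !scalerBr scalerDr.
      by apply/matrixP => i j; rewrite !mxE; ring.
    by rewrite {1}E; exact: ler_normB.
  by rewrite ler_norml; lra.
have H := homotopy_integral oU' (@closed_ball_compact p (r / 2)) KU' ltr01
  (diff_class_straighten p q A 1 oU' U'U) df f_supp.
have E1 : (fun x => f (straighten p q A (1, x)) *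
      \det (frame (straighten p q A) (@space_dir R k) (1, x))) \_ U' =
    (fun x => f (phi x) * \det (jacobian phi x)) \_ U.
  apply/funext => x; rewrite !patchE; case: ifPn => [/set_mem U'x|/negP U'x].
    have Ux := U'U _ U'x.
    by rewrite straighten1 (frame_straighten1 _ _ _ Ux) mem_set.
  case: ifPn => [/set_mem Ux|_]; last by [].
  suff frx : f (phi x) = 0 by rewrite frx mul0r.
  apply: fr; rewrite leNgt; apply/negP; rewrite !lt_min => /and3P[_ _ xr].
  apply: U'x; apply/mem_set; apply: KU'.
  by have := psi_near _ xr; rewrite (phiK Ux).
have E0 : (fun x => f (straighten p q A (0, x)) *
      \det (frame (straighten p q A) (@space_dir R k) (0, x))) \_ U' =
    (fun x => f (x *m A + (q - p *m A)) * \det A).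
  apply/funext => x; rewrite !patchE; case: ifPn => [/set_mem U'x|/negP U'x].
    rewrite straighten0 frame_straighten0; congr (f _ * _).
    by rewrite mulmxBl addrCA.
  suff frx : f (x *m A + (q - p *m A)) = 0 by rewrite frx mul0r.
  apply: fr.
  have -> : x *m A + (q - p *m A) - q = (x - p) *m A.
    by rewrite mulmxBl addrA addrAC addrK.
  apply: le_trans (cA _).
  have xr : r <= `|x - p|.
    by rewrite leNgt; apply/negP => xr; apply: U'x; exact/mem_set.
  exact: cr'.
apply: (etrans (esym (congr1 (@iterated_integral R k) E1))); apply: (etrans H).
apply: (etrans (congr1 (@iterated_integral R k) E0)).
have u1 : (1%:M : 'M[R]_k) \in unitmx by exact: unitmx1.
have tf' : test_function (fun x => f (x + (q - p *m A))).
  have := test_function_affine (q - p *m A) u1 tf.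
  by congr test_function; apply/funext => x; rewrite mulmx1.
rewrite -(test_function_translate (q - p *m A) tf).
rewrite -(linear_cov_det_gt0 dA tf').
have [r' r'0 cf] := test_function_csupp (test_function_linear uA tf').
by rewrite mulrC -(iterated_integralZ _ cf); congr iterated_integral;
  apply/funext => x; rewrite mulrC.
Qed.

Definition pull f := (fun x => f (phi x) * \det (jacobian phi x)) \_ U.

Section Globalize.
Variable K : set 'rV[R]_k.
Hypotheses (cK : compact K) (KV : K `<=` V).

Let K' := psi @` K.

Let cK' : compact K'.
Proof.
apply: continuous_compact => //; apply: continuous_in_subspaceT => y /set_mem Ky.
by apply: cpsi; exact: KV.
Qed.

Let K'U : K' `<=` U.
Proof. by move=> _ [y Ky <-]; apply: psiU; exact: KV. Qed.

(** One radius serves all [f] supported in [K], because their pullbacks are supported in the compact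
    image of [K] under [psi]; integrals of the pieces of a decomposition can then be added. *)
Lemma pull_csupp : exists2 r, 0 < r & forall f, diff_class 1 setT f ->
  (forall y, ~ K y -> f y = 0) -> csupp r f /\ csupp r (pull f).
Proof.
have [r1 r10 K1] := compact_norm_le cK; have [r2 r20 K2] := compact_norm_le cK'.
exists (Num.max r1 r2); first by rewrite lt_max r10.
move=> f df f0; split.
  apply: (diff_class_csupp df) => y; rewrite gt_max => /andP[yr _].
  by apply: f0 => /K1; rewrite leNgt yr.
have dU : diff_class 1 U (fun x => f (phi x) * \det (jacobian phi x)).
  have dF := diff_class_frame (fun i => delta_mx 0 i) oU dphi.
  have wl z : multilinear (fun A : 'M[R]_k => f z * \det A).
    move=> A A1 A2 i b c AE E1 E2.
    by rewrite (determinant_multilinear AE E1 E2) mulrDr !(mulrCA (f z)).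
  have dw (A : 'M[R]_k) : diff_class 1 setT (fun z => f z * \det A).
    exact: (diff_classM openT df (@diff_class_cst R 1 'rV[R]_k R setT (\det A))).
  have := diff_class_form openT wl oU (fun _ _ => I) dw (diff_class_pred dphi) dF.
  by apply: (eq_diff_class oU) => x Ux; rewrite /frame -(jacobian_rows (dfphi Ux)).
have K'0 x : U x -> ~ K' x -> f (phi x) * \det (jacobian phi x) = 0.
  move=> Ux K'x; rewrite f0 ?mul0r// => Kx; apply: K'x; exists (phi x) => //.
  exact: phiK.
apply: (diff_class_csupp (diff_class_patch oU (compact_closed (@norm_hausdorff _ _) cK') K'U dU K'0)).
move=> y; rewrite gt_max => /andP[_ yr]; rewrite patchE; case: ifPn => [/set_mem Uy|_]; last by [].
by rewrite K'0// => /K2; rewrite leNgt yr.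
Qed.

(** Finitely many balls of half the local radius cover [K]. For each center, [bump] splits off a
    piece settled by the local statement; the remainder vanishes on that half ball, so one ball
    fewer is needed and no partition of unity has to be built. *)
Lemma change_of_variables f : diff_class 1 setT f -> (forall y, ~ K y -> f y = 0) ->
  iterated_integral (pull f) = iterated_integral f.
Proof.
have /choice[rad radP] : forall q, exists rho : R, V q -> 0 < rho /\
    forall f, diff_class 1 setT f -> (forall y, rho <= `|y - q| -> f y = 0) ->
    iterated_integral (pull f) = iterated_integral f.
  move=> q; have [Vq|Vq] := pselect (V q); last by exists 0.
  by have [rho r0 H] := local_change_of_variables Vq; exists rho.
have [r r0 cs] := pull_csupp.
suff H (s : seq 'rV[R]_k) (F : 'rV[R]_k -> R) : {in s, forall q, V q} -> diff_class 1 setT F ->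
    (forall y, ~ K y -> F y = 0) ->
    (forall y, F y != 0 -> exists2 q, q \in s & `|y - q| <= rad q / 2) ->
    iterated_integral (pull F) = iterated_integral F.
  move=> df f0; have := cK; rewrite compact_cover.
  move=> /(_ _ V (fun q => ball q (rad q / 2)))[].
  - by move=> q Vq; apply: ball_open; have [rq _] := radP q Vq; rewrite divr_gt0.
  - move=> y Ky; exists y; first exact: KV.
    by apply: ballxx; have [rq _] := radP y (KV Ky); rewrite divr_gt0.
  move=> D DV KD; apply: (H (finmap.enum_fset D)) => //.
    by move=> q qD; have := DV q qD; rewrite inE.
  move=> y fy; have Ky : K y by apply: contrapT => /f0 /eqP; rewrite (negbTE fy).
  have [q /= qD] := KD y Ky; rewrite -ball_normE /= distrC => yq.
  by exists q => //; exact: ltW.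
elim: s F => [|q s IH] F sV dF F0 Fs.
  have E : F = fun=> 0.
    by apply/funext => y; apply/eqP; apply: contraT => /Fs[].
  rewrite E; congr iterated_integral; apply/funext => x.
  by rewrite /pull patchE mul0r; case: ifP.
have Vq : V q by apply: sV; rewrite inE eqxx.
have [rq lq] := radP q Vq.
pose f1 y := bump q (rad q) y * F y; pose f2 y := (1 - bump q (rad q) y) * F y.
have db := diff_class_bump q (rad q).
have d1 : diff_class 1 setT f1 by exact: (diff_classM openT db dF).
have d2 : diff_class 1 setT f2.
  exact: (diff_classM openT (diff_classB openT (@diff_class_cst R 1 'rV[R]_k R setT 1) db) dF).
have f10 y : ~ K y -> f1 y = 0 by move=> Ky; rewrite /f1 F0// mulr0.
have f20 y : ~ K y -> f2 y = 0 by move=> Ky; rewrite /f2 F0// mulr0.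
have [c1 p1] := cs f1 d1 f10; have [c2 p2] := cs f2 d2 f20.
have E : F = fun y => f1 y + f2 y.
  by apply/funext => y; rewrite /f1 /f2 -mulrDl addrCA subrr addr0 mul1r.
have Ep : pull F = fun x => pull f1 x + pull f2 x.
  apply/funext => x; rewrite /pull !patchE; case: ifP => _; last exact: (esym (addr0 _)).
  by rewrite -mulrDl -/(f1 (phi x)) {1}E.
rewrite Ep (iterated_integralD p1 p2) [in RHS]E (iterated_integralD c1 c2); congr (_ + _).
  by apply: (lq _ d1) => y yq; rewrite /f1 bump_0// mul0r.
apply: (IH _ _ d2 f20) => [z zs|y]; first by apply: sV; rewrite inE zs orbT.
rewrite mulf_eq0 negb_or => /andP[b1 Fy]; have [z] := Fs y Fy.
rewrite inE => /orP[/eqP->|zs yz]; last by exists z.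
by move=> yq; move: b1; rewrite bump_1// subrr eqxx.
Qed.

End Globalize.

End Diffeo.

End ChangeOfVariables.

(** * Smoothness of the energy integrand *)

Section RealFunctions.
Context {R : realType}.

Lemma diff_class_inv : diff_class 1 [set x : R | 0 < x] (fun x => x^-1).
Proof.
apply: (@diff_class1_real _ _ _ (fun x => - x ^- 2)); first exact: open_gt.
  move=> x x0; have := @is_deriveV _ id x (1 : R) 1 (negbT (gt_eqF x0)) (is_derive_id _ _).
  by rewrite [_ *: 1]mulr1.
move=> x x0; have x2 : x ^+ 2 != 0 by rewrite gt_eqF// exprn_gt0.
by apply: cvgN; apply: (cvgV x2); exact: exprn_continuous.
Qed.

Lemma diff_class_sqrt : diff_class 1 [set x : R | 0 < x] Num.sqrt.
Proof.
apply: (@diff_class1_real _ _ _ (fun x => (2 * Num.sqrt x)^-1)); first exact: open_gt.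
move=> x x0; have x2 : 2 * Num.sqrt x != 0 by rewrite gt_eqF// mulr_gt0// sqrtr_gt0.
by apply: (cvgV x2); apply: cvgM; [exact: cvg_cst|exact: sqrt_continuous].
Qed.

(* The odd extension of [s |-> sqrt s ^+ j.+2] is continuously differentiable, also at 0. *)
Definition sqrt_pow (j : nat) (s : R) : R := s * Num.sqrt `|s| ^+ j.

Lemma sqrt_powE j s : 0 <= s -> sqrt_pow j s = Num.sqrt s ^+ j.+2.
Proof.
by move=> s0; rewrite /sqrt_pow ger0_norm// !exprS mulrA -expr2 sqr_sqrtr.
Qed.

Lemma sqrt_powN j s : sqrt_pow j (- s) = - sqrt_pow j s.
Proof. by rewrite /sqrt_pow normrN mulNr. Qed.

Let continuous_sqrt_norm j : continuous (fun s : R => Num.sqrt `|s| ^+ j).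
Proof.
move=> s; apply: (@continuous_comp _ _ _ (fun s : R => Num.sqrt `|s|) (fun t => t ^+ j)).
  by apply: (@continuous_comp _ _ _ (fun s : R => `|s|) Num.sqrt);
    [exact: norm_continuous|exact: sqrt_continuous].
exact: exprn_continuous.
Qed.

Let is_derive_sqrt_pow_gt0 j (s : R) : 0 < s ->
  is_derive s (1 : R) (sqrt_pow j) (j.+2%:R / 2 * Num.sqrt `|s| ^+ j).
Proof.
move=> s0; apply: (@near_eq_is_derive R R R (fun s : R => Num.sqrt s ^+ j.+2)).
  have : nbhs s [set t : R | 0 < t] by apply: open_nbhs_nbhs; split=> //; exact: open_gt.
  by apply: filterS => t /= t0; rewrite sqrt_powE// ltW.
have E : j.+2%:R / 2 * Num.sqrt `|s| ^+ j =
    (j.+2%:R *: Num.sqrt s ^+ j.+1) *: (2 * Num.sqrt s)^-1.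
  rewrite gtr0_norm// exprSr invfM /GRing.scale /=.
  have : Num.sqrt s != 0 by rewrite gt_eqF// sqrtr_gt0.
  by move: (Num.sqrt s) (_ ^+ j) (j.+2%:R) => a b c a0; field.
have ds : is_derive s (1 : R) (Num.sqrt : R -> R) (2 * Num.sqrt s)^-1.
  by have H := is_derive1_sqrt s0; exact H.
have F : (fun t : R => Num.sqrt t ^+ j.+2) = (Num.sqrt : R -> R) ^+ j.+2.
  by apply/funext => t; rewrite fctE.
by rewrite E; have H := is_deriveX j.+2 ds; rewrite -F in H; exact H.
Qed.

Lemma diff_class_sqrt_pow j : diff_class 1 setT (sqrt_pow j).
Proof.
apply: (@diff_class1_real _ _ _ (fun s => j.+2%:R / 2 * Num.sqrt `|s| ^+ j) openT); last first.
  by move=> s _; apply: cvgM; [exact: cvg_cst|exact: continuous_sqrt_norm].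
move=> s _; have [s0|s0|->] := ltgtP s 0; last 1 first.
- apply: is_derive_remainder => e e0.
  (* At 0 the claimed derivative is 1 for [j = 0] and 0 otherwise; in both cases it is the limit of
     the quotient [Num.sqrt |h| ^+ j]. *)
  have E : j.+2%:R / 2 * Num.sqrt `|0 : R| ^+ j = Num.sqrt `|0 : R| ^+ j.
    rewrite normr0 sqrtr0; case: j => [|j]; last by rewrite exprS !mul0r mulr0.
    by rewrite divff ?mul1r.
  rewrite E; have /cvgrPdist_le/(_ e e0) := @continuous_sqrt_norm j 0.
  apply: filterS => h he; rewrite addr0 /sqrt_pow mul0r subr0 -mulrBr normrM mulrC.
  by rewrite ler_wpM2r// distrC.
- have sN : 0 < - s by rewrite oppr_gt0.
  have H := is_deriveN (@is_derive1_comp _ (sqrt_pow j) -%R s _ _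
    (is_derive_sqrt_pow_gt0 j sN) (is_deriveN (is_derive_id s (1 : R)))).
  have -> : sqrt_pow j = - (sqrt_pow j \o -%R).
    by apply/funext => t; rewrite fctE /= sqrt_powN opprK.
  apply: (is_derive_eq H).
  by rewrite normrN mulrN1 opprK.
exact: is_derive_sqrt_pow_gt0.
Qed.

End RealFunctions.

Section MatrixFunctions.
Context {R : realType} {V : normedModType R} (r : nat) (U : set V).
Hypothesis oU : open U.

Lemma diff_class_mulmx m n p (A : V -> 'M[R]_(m, n)) (B : V -> 'M[R]_(n, p)) :
  diff_class r U A -> diff_class r U B -> diff_class r U (fun q => A q *m B q).
Proof.
move=> /(diff_class_mxP _ _ oU) dA /(diff_class_mxP _ _ oU) dB.
apply/(diff_class_mxP _ _ oU) => i j.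
apply: (@eq_diff_class _ _ _ _ _ (fun q => \sum_l A q i l * B q l j) _ oU) => [q _|].
  by rewrite mxE.
by apply: (diff_class_sum _ oU) => l _; exact: (diff_classM oU).
Qed.

Lemma diff_class_trmx m n (A : V -> 'M[R]_(m, n)) :
  diff_class r U A -> diff_class r U (fun q => (A q)^T).
Proof.
move=> /(diff_class_mxP _ _ oU) dA; apply/(diff_class_mxP _ _ oU) => i j.
by apply: (eq_diff_class oU _ (dA j i)) => q _; rewrite mxE.
Qed.

Lemma diff_class_trace n (A : V -> 'M[R]_n) :
  diff_class r U A -> diff_class r U (fun q => \tr (A q)).
Proof.
move=> /(diff_class_mxP _ _ oU) dA.
by apply: (diff_class_sum _ oU) => l _; exact: dA.
Qed.

Lemma diff_class_det n (A : V -> 'M[R]_n) :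
  diff_class r U A -> diff_class r U (fun q => \det (A q)).
Proof.
move=> dA; have d0 := @diff_class_cst R r V 'rV[R]_n U 0.
have dw B := @diff_class_cst R r 'rV[R]_n R setT (\det (B : 'M[R]_n)).
exact: (diff_class_form (w := fun=> determinant) openT (fun _ => @det_multilinear R n) oU
  (fun _ _ => I) dw d0 dA).
Qed.

Lemma diff_class_adj n (A : V -> 'M[R]_n) :
  diff_class r U A -> diff_class r U (fun q => \adj (A q)).
Proof.
move=> dA; apply/(diff_class_mxP _ _ oU) => i j.
pose f q := (-1) ^+ (j + i) * \det (row' j (col' i (A q))).
apply: (@eq_diff_class _ _ _ _ _ f _ oU) => [q _|]; first by rewrite mxE.
apply: (diff_classM oU); first exact: diff_class_cst.
apply: diff_class_det; apply/(diff_class_mxP _ _ oU) => a b.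
move: dA => /(diff_class_mxP _ _ oU)/(_ (lift j a) (lift i b)).
by apply: (eq_diff_class oU) => q _; rewrite !mxE.
Qed.

End MatrixFunctions.

Lemma diff_class_invmx {R : realType} {V : normedModType R} (U : set V) n
    (A : V -> 'M[R]_n) : open U -> (forall q, U q -> 0 < \det (A q)) ->
  diff_class 1 U A -> diff_class 1 U (fun q => invmx (A q)).
Proof.
move=> oU A0 dA; apply/(diff_class_mxP _ _ oU) => i j.
have /(diff_class_mxP _ _ oU)/(_ i j) dj := diff_class_adj oU dA.
have dd := diff_class_comp_real oU (@open_gt _ 0) A0 diff_class_inv (diff_class_det oU dA).
apply: (eq_diff_class oU _ (diff_classM oU dd dj)) => q Uq.
rewrite /invmx unitmxE unitfE gt_eqF/=; last exact: A0.
by rewrite [RHS]mxE.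
Qed.

(** Needed because a target chart containing [F t x] is available only near a given point. *)
Lemma diff_class_local {R : realType} r (V W : normedModType R) (U : set V) (f : V -> W) :
  (forall x, U x -> exists S, S x /\ diff_class r S f) -> diff_class r U f.
Proof.
elim: r f => [|r IH] f H; split=> //.
- by move=> x /H[S [Sx df]]; exact: (diff_class_continuous df Sx).
- by move=> x /H[S [Sx df]]; exact: (diff_class_continuous df Sx).
move=> v; split=> [x /H[S [Sx df]]|]; first exact: (diff_class_derivable df Sx).
by apply: IH => x /H[S [Sx df]]; exists S; split=> //; exact: diff_class_derive.
Qed.

Lemma jacobian_comp {R : realType} l m n (f : 'rV[R]_l -> 'rV[R]_m)
    (g : 'rV[R]_m -> 'rV[R]_n) (h : 'rV[R]_l -> 'rV[R]_n) p :
  differentiable f p -> differentiable g (f p) -> differentiable h p ->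
  (\near p, h p = g (f p)) -> jacobian h p = jacobian f p *m jacobian g (f p).
Proof.
move=> df dg dh hgf; apply/row_matrixP => i; rewrite !rowE mulmxA -deriveEjacobian//.
rewrite (near_eq_derive _ hgf) -(deriveEjacobian _ df) -(deriveEjacobian _ dg).
have H := is_derive_comp_diff (diff_derivable (v := 'e_i) df) dg.
by case: H.
Qed.

(** * Charts and local representatives *)

Lemma open_setI_preimage (T S : topologicalType) (A : set T) (B : set S) (f : T -> S) :
  open A -> open B -> (forall x, A x -> {for x, continuous f}) ->
  open [set x | A x /\ B (f x)].
Proof.
move=> oA oB cf; rewrite openE => x [Ax Bx]; apply: filterI.
  exact: open_nbhs_nbhs (conj oA Ax).
exact: (cf x Ax _ (open_nbhs_nbhs (conj oB Bx))).
Qed.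

Section Charts.
Context {R : realType} (n : nat) (M : manifold R n).
Implicit Types (c d e : chart R n M) (x : M).

Lemma open_overlap c d : open [set y | img c y /\ dom d (inv c y)].
Proof.
by apply: open_setI_preimage; [exact: open_img|exact: open_dom|exact: inv_continuous].
Qed.

Lemma overlap_to c d x : dom c x -> dom d x -> [set y | img c y /\ dom d (inv c y)] (c x).
Proof. by move=> cx dx; split; [exact: to_img|rewrite toK]. Qed.

Lemma transition_differentiable c d x : atlas c -> atlas d -> dom c x -> dom d x ->
  differentiable (d \o inv c) (c x).
Proof.
move=> ac ad cx dx; apply: (diff_class1_differentiable (@open_overlap c d)).
  exact: (atlas_smooth ac ad 1).
exact: overlap_to.
Qed.

Lemma transition_comp c d e x : atlas c -> atlas d -> atlas e ->
  dom c x -> dom d x -> dom e x ->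
  transition c e x = transition c d x *m transition d e x.
Proof.
move=> ac ad ae cx dx ex.
have dE : (d \o inv c) (c x) = d x by rewrite /= toK.
rewrite /transition -dE; apply: jacobian_comp.
- exact: transition_differentiable.
- by rewrite dE; exact: transition_differentiable.
- exact: transition_differentiable.
apply: (near_eq_in_open (@open_overlap c d)); last exact: overlap_to.
by move=> y [_ dy] /=; rewrite toK.
Qed.

Lemma transition_self c x : atlas c -> dom c x -> transition c c x = 1%:M.
Proof.
move=> ac cx; apply/row_matrixP => i; rewrite rowE row1 /transition -deriveEjacobian.
  rewrite (@near_eq_derive _ _ _ _ id); first exact: derive_id.
  apply: (near_eq_in_open (@open_img _ _ _ c)); last exact: to_img.
  by move=> y cy /=; exact: invK.
exact: transition_differentiable.
Qed.

Lemma transitionK c d x : atlas c -> atlas d -> dom c x -> dom d x ->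
  transition c d x *m transition d c x = 1%:M.
Proof. by move=> ac ad cx dx; rewrite -transition_comp// transition_self. Qed.

Definition metric_in_chart (g : riem_metric M) c (y : 'rV[R]_n) : 'M[R]_n :=
  let x := inv c y in
  let J := transition c (chart_at x) x in J *m g x *m J^T.

Lemma posdef_metric (g : riem_metric M) x : posdef (g x).
Proof. by split; [exact: metric_sym|move=> v; exact: metric_pos]. Qed.

Lemma posdef_metric_in_chart (g : riem_metric M) c y : atlas c -> img c y ->
  posdef (metric_in_chart g c y).
Proof.
move=> ac cy; rewrite /metric_in_chart; set x := inv c y; set J := transition _ _ _.
have JK : J *m transition (chart_at x) c x = 1%:M.
  by apply: transitionK => //; [exact: chart_at_atlas|exact: inv_dom|exact: chart_at_dom].
split; first by rewrite !trmx_mul trmxK metric_sym mulmxA.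
move=> v v0; have -> : v *m (J *m g x *m J^T) *m v^T = (v *m J) *m g x *m (v *m J)^T.
  by rewrite trmx_mul !mulmxA.
apply: metric_pos; apply: contra_neq v0 => vJ.
by rewrite -(mulmx1 v) -JK mulmxA vJ mul0mx.
Qed.

Lemma det_metric_in_chart (g : riem_metric M) c y :
  \det (metric_in_chart g c y) =
  \det (transition c (chart_at (inv c y)) (inv c y)) ^+ 2 * \det (g (inv c y)).
Proof. by rewrite /metric_in_chart !det_mulmx det_tr mulrAC -expr2. Qed.

Lemma invmx_congr k (J g : 'M[R]_k) : J \in unitmx -> g \in unitmx ->
  invmx (J *m g *m J^T) = invmx J^T *m invmx g *m invmx J.
Proof.
move=> uJ ug; apply: invmx_unique.
by rewrite -!mulmxA mulKVmx ?unitmx_tr// mulKVmx// mulmxV.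
Qed.

(** The factors [J] cancel by cyclicity of the trace; this makes [|du|^2] independent of the source
    chart. *)
Lemma trace_invmx_congr k m (J g : 'M[R]_k) (D : 'M[R]_(k, m)) (h : 'M[R]_m) :
  J \in unitmx -> g \in unitmx ->
  \tr (invmx (J *m g *m J^T) *m ((J *m D) *m h *m (J *m D)^T)) =
  \tr (invmx g *m (D *m h *m D^T)).
Proof.
move=> uJ ug; rewrite invmx_congr// trmx_mul -!mulmxA mulKmx// mxtrace_mulC.
by rewrite -!mulmxA mulmxV ?unitmx_tr// mulmx1.
Qed.

Lemma in_chart_multilinear k (a : kform k M) c y : multilinear (in_chart a c y).
Proof. exact/multilinear_mulmxl/form_multilinear. Qed.

Lemma in_chart_alternating k (a : kform k M) c y : alternating (in_chart a c y).
Proof. exact/alternating_mulmxl/form_alternating. Qed.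

Lemma in_chart_calibration k (h : riem_metric M) (a : kform k M) c y (e : 'M[R]_(k, n)) :
  calibration h a -> e *m metric_in_chart h c y *m e^T = 1%:M -> in_chart a c y e <= 1.
Proof.
by move=> cal E; apply: cal; rewrite trmx_mul !mulmxA; move: E; rewrite /metric_in_chart !mulmxA.
Qed.

Lemma in_chart_closed_at k (a : kform k M) z : (forall x V, ext_d a x V = 0) ->
  closed_at (in_chart a (chart_at z)) (chart_at z z).
Proof. by move=> da A; exact: da. Qed.

End Charts.

Section Family.
Context {R : realType} (k n : nat) (L : manifold R k) (M : manifold R n).
Variables (eps : R) (F : R -> L -> M).
Hypothesis sF : smooth_family eps F.
Implicit Types (c : chart R k L) (d : chart R n M) (p : R * 'rV[R]_k).

Definition chart_cylinder c := [set p : R * 'rV[R]_k | `|p.1| < eps /\ img c p.2].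

Definition local_dom c d := [set p : R * 'rV[R]_k |
  [/\ `|p.1| < eps, img c p.2 & dom d (F p.1 (inv c p.2))]].

Definition local_rep c d p : 'rV[R]_n := d (F p.1 (inv c p.2)).

Lemma open_chart_cylinder c : open (chart_cylinder c).
Proof.
rewrite (_ : chart_cylinder c = fst @^-1` [set s | `|s| < eps] `&` snd @^-1` img c)//.
apply: openI; apply: open_comp.
- by move=> q _; exact: cvg_fst.
- apply: (@open_comp _ _ (fun s : R => `|s|) [set s | s < eps]); last exact: open_lt.
  by move=> s _; exact: norm_continuous.
- by move=> q _; exact: cvg_snd.
- exact: open_img.
Qed.

Lemma family_continuous c p : chart_cylinder c p ->
  {for p, continuous (fun q : R * 'rV[R]_k => F q.1 (inv c q.2))}.
Proof.
move=> [pe cp]; case: sF => /(_ p.1 (inv c p.2) pe) cF _.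
apply: (@continuous_comp _ _ _ (fun p : R * 'rV[R]_k => (p.1, inv c p.2))
  (fun q : R * L => F q.1 q.2)); last exact: cF.
have c1 : {for p, continuous (fun q : R * 'rV[R]_k => inv c q.2)}.
  by apply: (@continuous_comp _ _ _ snd (inv c)); [exact: cvg_snd|exact: inv_continuous].
exact: (cvg_pair (@cvg_fst _ _ _ _ _) c1).
Qed.

Lemma open_local_dom c d : open (local_dom c d).
Proof.
have := open_setI_preimage (@open_chart_cylinder c) (@open_dom _ _ _ d) (@family_continuous c).
by congr open; apply/seteqP; split=> p; [case=> -[]|case].
Qed.

Lemma local_rep_img c d p : local_dom c d p -> img d (local_rep c d p).
Proof. by case=> _ _; exact: to_img. Qed.

Lemma local_repK c d p : local_dom c d p -> inv d (local_rep c d p) = F p.1 (inv c p.2).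
Proof. by case=> _ _; exact: toK. Qed.

Lemma diff_class_local_rep r c d : atlas c -> atlas d ->
  diff_class r (local_dom c d) (local_rep c d).
Proof. by move=> ac ad; case: sF => _ /(_ c d ac ad)/(_ r). Qed.

Lemma space_slice_continuous (t : R) : continuous (fun y : 'rV[R]_k => (t, y)).
Proof. exact: pair_continuousr. Qed.

Lemma diff_class_space_slice r (W : normedModType R) (S : set (R * 'rV[R]_k)) (f : _ -> W)
    (t : R) : diff_class r S f -> diff_class r [set y | S (t, y)] (fun y => f (t, y)).
Proof.
apply: (@diff_class_affine _ _ _ _ _ S f (fun y => (t, y)) (fun y => (0, y))).
  by move=> x v a; rewrite -[RHS]/(a * 0 + t, a *: v + x) mulr0 add0r.
exact: space_slice_continuous.
Qed.

Lemma diff_class_comp_snd r (W : normedModType R) (S : set 'rV[R]_k) (f : 'rV[R]_k -> W) :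
  diff_class r S f -> diff_class r (snd @^-1` S) (fun p : R * 'rV[R]_k => f p.2).
Proof.
apply: (@diff_class_affine R r 'rV[R]_k (R * 'rV[R]_k)%type W S f snd snd).
  by move=> [x1 x2] [v1 v2] t.
by move=> p; exact: cvg_snd.
Qed.

Lemma local_rep_differentiable c d p : atlas c -> atlas d -> local_dom c d p ->
  differentiable (fun y => local_rep c d (p.1, y)) p.2.
Proof.
move=> ac ad pd; have dS := diff_class_space_slice p.1 (diff_class_local_rep 1 ac ad).
apply: (diff_class1_differentiable _ dS); last exact: pd.
apply: (@open_comp _ _ (fun y => (p.1, y)) (local_dom c d)); last exact: open_local_dom.
by move=> y _; exact: space_slice_continuous.
Qed.

Lemma jacobian_local_rep c d p : atlas c -> atlas d -> local_dom c d p ->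
  jacobian (d \o F p.1 \o inv c) p.2 = frame (local_rep c d) (@space_dir R k) p.
Proof.
move=> ac ad pd; case: p pd => t y pd.
by rewrite frame_slice -jacobian_rows//; exact: local_rep_differentiable pd.
Qed.

(** Both sides are the Jacobian of one map, read from [c] to the preferred chart at the image point,
    factored through the source transition on the left and through the target transition on the
    right. *)
Lemma differential_local c d p : atlas c -> atlas d -> local_dom c d p ->
  let x := inv c p.2 in let z := F p.1 x in
  transition c (chart_at x) x *m differential (F p.1) x =
  frame (local_rep c d) (@space_dir R k) p *m transition d (chart_at z) z.
Proof.
move=> ac ad pd x z; have [pe cp dp] := pd.
have cx : dom c x by exact: inv_dom.
have px : c x = p.2 by exact: invK.
pose c' := chart_at x; pose d' := chart_at z.
have ac' : atlas c' by exact: chart_at_atlas.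
have ad' : atlas d' by exact: chart_at_atlas.
have c'x : dom c' x by exact: chart_at_dom.
have d'z : dom d' z by exact: chart_at_dom.
have pd' : local_dom c d' p by [].
have pd'' : local_dom c' d' (p.1, c' x) by split=> //=; [exact: to_img|rewrite toK].
have dh := local_rep_differentiable ac ad' pd'.
have dh' := local_rep_differentiable ac' ad' pd''.
have xE : (c' \o inv c) p.2 = c' x by [].
rewrite -(jacobian_local_rep ac ad pd) /transition px.
transitivity (jacobian (d' \o F p.1 \o inv c) p.2); last first.
  apply: jacobian_comp.
  - exact: (local_rep_differentiable ac ad pd).
  - exact: (transition_differentiable ad ad' dp d'z).
  - exact: dh.
  have oS : open [set y | local_dom c d (p.1, y)].
    apply: (@open_comp _ _ (fun y => (p.1, y)) (local_dom c d)); last exact: open_local_dom.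
    by move=> y _; exact: space_slice_continuous.
  apply: (near_eq_in_open oS); last exact: pd.
  by move=> y /local_repK /= yE; rewrite /local_rep /= in yE; rewrite yE.
apply/esym; apply: jacobian_comp.
- by rewrite -px; exact: transition_differentiable.
- exact: dh'.
- exact: dh.
rewrite -px; apply: (near_eq_in_open (@open_overlap _ _ L c c')); last exact: overlap_to.
by move=> y [_ c'y] /=; rewrite toK.
Qed.

(** The chart is frozen at [F t x] while [s] varies, so the result is expressed in the coordinates
    that [form_at] uses at that point. *)
Definition velocity (t : R) (x : L) : 'rV[R]_n :=
  'D_(1 : R) (fun s => chart_at (F t x) (F s x)) t.

Lemma velocity_local c d p : atlas c -> atlas d -> local_dom c d p ->
  let x := inv c p.2 in let z := F p.1 x in
  velocity p.1 x = 'D_((1, 0) : R * 'rV[R]_k) (local_rep c d) p *m transition d (chart_at z) z.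
Proof.
case: p => t y ac ad pd x z; have [pe cp dp] := pd.
pose d' := chart_at z; have ad' : atlas d' by exact: chart_at_atlas.
have d'z : dom d' z by exact: chart_at_dom.
have line (a : R) : (fun s : R => (s, y)) (a *: 1 + t) = a *: ((1, 0) : R * 'rV[R]_k) + (t, y).
  by rewrite -[RHS]/(a *: 1 + t, a *: 0 + y) scaler0 add0r.
have oS : open [set s | local_dom c d (s, y)].
  apply: (@open_comp _ _ (fun s => (s, y)) (local_dom c d)); last exact: open_local_dom.
  by move=> s _; exact: pair_continuousl.
have dg : derivable (fun s : R => local_rep c d (s, y)) t 1.
  apply: (derivable_affine line).
  exact: (diff_class_derivable (diff_class_local_rep 1 ac ad) pd).
have dt := transition_differentiable ad ad' dp d'z.
have gE : 'D_(1 : R) (fun s : R => local_rep c d (s, y)) t =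
    'D_((1, 0) : R * 'rV[R]_k) (local_rep c d) (t, y).
  exact: (@derive_affine _ _ _ _ (local_rep c d) (fun s : R => (s, y)) t 1 ((1, 0) : R * 'rV[R]_k) line).
have H := is_derive_comp_diff dg dt.
have E : \forall s \near t, d' (F s x) = (d' \o inv d) (local_rep c d (s, y)).
  apply: (near_eq_in_open oS); last exact: pd.
  by move=> s /local_repK /= sE; rewrite sE.
rewrite /velocity (near_eq_derive _ E); case: H => _ ->.
by rewrite (deriveEjacobian _ dt) gE.
Qed.

End Family.

(** * Energy and pullback densities *)

Section Algebra.
Context {R : realType}.

Lemma setrow_mulmx k m n (A : 'M[R]_(k, m)) (T : 'M[R]_(m, n)) j v :
  setrow A j v *m T = setrow (A *m T) j (v *m T).
Proof.
apply/row_matrixP => i; rewrite row_mul; have [->|ij] := eqVneq i j.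
  by rewrite !row_setrow.
by rewrite !row_setrow_neq// row_mul.
Qed.

(** The trace is a sum of squared [h]-lengths of the images of a [g]-orthonormal frame.
    Nonnegativity is what identifies [sqrt_pow] with a power of the square root. *)
Lemma trace_invmx_ge0 k n (g : 'M[R]_k) (h : 'M[R]_n) (D : 'M[R]_(k, n)) :
  posdef g -> posdef h -> 0 <= \tr (invmx g *m (D *m h *m D^T)).
Proof.
move=> pg [_ ph]; have [A [tA dA AE]] := cholesky pg.
have uA : A \in unitmx by rewrite unitmxE unitfE gt_eqF// det_trig// prodr_gt0.
have -> : invmx g = (invmx A)^T *m invmx A.
  apply: invmx_unique; rewrite -AE -mulmxA (mulmxA A^T) -trmx_mul mulVmx//.
  by rewrite trmx1 mul1mx mulmxV.
have -> : \tr ((invmx A)^T *m invmx A *m (D *m h *m D^T)) =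
    \tr (invmx A *m D *m h *m (invmx A *m D)^T).
  by rewrite trmx_mul !mulmxA [RHS]mxtrace_mulC !mulmxA.
set B := invmx A *m D; apply: sumr_ge0 => i _.
have -> : (B *m h *m B^T) i i = (row i B *m h *m (row i B)^T) 0 0.
  by rewrite -row_mul [LHS]mxE [RHS]mxE; apply: eq_bigr => l _; rewrite !mxE.
have [->|B0] := eqVneq (row i B) 0; last exact: ltW (ph _ B0).
by rewrite !mul0mx mxE.
Qed.

(* Both sides are the derivative at 0 of [w (J *m (W + s *: (v *m X)))] in [s]. *)
Lemma alternating_contraction k n (w : 'M[R]_(k, n) -> R) (J : 'M[R]_k) (v : 'cV[R]_k)
    (W : 'M[R]_(k, n)) (X : 'rV[R]_n) : multilinear w -> alternating w ->
  \sum_j (J *m v) j 0 * w (setrow (J *m W) j X) = \det J * \sum_j v j 0 * w (setrow W j X).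
Proof.
move=> wl wa.
have D (u : 'cV[R]_k) (A : 'M[R]_(k, n)) :
    is_derive (0 : R) (1 : R) (fun s : R => w (A + s *: (u *m X)))
    (\sum_j u j 0 * w (setrow A j X)).
  have line (t : R) : (fun s : R => A + s *: (u *m X)) (t *: 1 + 0) =
      t *: (u *m X) + (fun s : R => A + s *: (u *m X)) 0.
    by rewrite addr0 scale0r addr0 [_ *: 1]mulr1 addrC.
  have dA : 'D_(1 : R) (fun s : R => A + s *: (u *m X)) (0 : R) = u *m X.
    exact: (derive_affine_map line).
  have ddA : derivable (fun s : R => A + s *: (u *m X)) (0 : R) (1 : R).
    apply: (@derivable_affine _ _ _ _ id _ _ _ _ line).
    exact: derivable_id.
  have H := is_derive_form openT (w := fun _ : 'rV[R]_n => w) (fun _ => wl)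
    (fun B => @diff_class_cst R 1 'rV[R]_n R setT (w B)) I
    (@derivable_cst R R 'rV[R]_n 0 0 1) ddA.
  apply: (is_derive_eq H).
  rewrite derive_cst add0r dA scale0r addr0; apply: eq_bigr => j _.
  rewrite -(multilinear_setrowZ wl); congr (w (setrow _ _ _)).
  by apply/rowP => l; rewrite !mxE big_ord1.
have [_ <-] := D (J *m v) (J *m W).
have [dv <-] := D v W.
have -> : (fun s : R => w (J *m W + s *: (J *m v *m X))) =
    \det J *: (fun s : R => w (W + s *: (v *m X))).
  apply/funext => s; rewrite fctE -[RHS](alternating_mulmx J _ wl wa).
  by rewrite mulmxDr -scalemxAr mulmxA.
exact: deriveZ.
Qed.

End Algebra.

Section Densities.
Context {R : realType} (k n : nat) (L : manifold R k) (M : manifold R n).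
Hypothesis L_oriented : oriented L.
Variables (g : riem_metric L) (h : riem_metric M) (a : kform k M).
Variables (eps : R) (F : R -> L -> M).
Hypothesis sF : smooth_family eps F.
Implicit Types (c : chart R k L) (d : chart R n M) (p : R * 'rV[R]_k).

Definition energy_density c p : R :=
  in_chart (fun x V => du_norm g h (F p.1) x ^+ k * vol g x V) c p.2 1%:M.

Definition pull_density c p : R := in_chart (pull_form (F p.1) a) c p.2 1%:M.

(** Components of the pullback of the calibration contracted with the velocity. Replacing row [j] in
    place absorbs the usual signs, so the exterior derivative becomes the plain divergence of these
    components. *)
Definition flux c (j : 'I_k) (y : 'rV[R]_k) : R := let x := inv c y in
  a (F 0 x) (setrow (transition c (chart_at x) x *m differential (F 0) x) j (velocity F 0 x)).

Let energy_form c d p : R :=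
  let W := frame (local_rep F c d) (@space_dir R k) p in
  \tr (invmx (metric_in_chart g c p.2) *m
    (W *m metric_in_chart h d (local_rep F c d p) *m W^T)).

Lemma local_domP c p : chart_cylinder eps c p ->
  local_dom eps F c (chart_at (F p.1 (inv c p.2))) p.
Proof. by case=> pe cp; split=> //; exact: chart_at_dom. Qed.

(** All transition factors cancel: the trace is invariant, and orientation makes [\det T] positive,
    hence equal to the root of its square. *)
Lemma energy_density_local c d p : atlas c -> atlas d -> local_dom eps F c d p ->
  energy_density c p =
  Num.sqrt (energy_form c d p) ^+ k * Num.sqrt (\det (metric_in_chart g c p.2)).
Proof.
move=> ac ad pd; have [pe cp dp] := pd; rewrite /energy_density /in_chart /vol.
set x := inv c p.2; set z := F p.1 x; set T := transition c _ x.
have T0 : 0 < \det T.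
  by apply: L_oriented => //; [exact: chart_at_atlas|exact: inv_dom|exact: chart_at_dom].
have uT : T \in unitmx by rewrite unitmxE unitfE gt_eqF.
have ug : g x \in unitmx by rewrite unitmxE unitfE gt_eqF// posdef_det_gt0//; exact: posdef_metric.
rewrite mul1mx det_metric_in_chart -/x -/T sqrtrM ?sqr_ge0// sqrtr_sqr (gtr0_norm T0).
congr (Num.sqrt _ ^+ k * _); last exact: mulrC.
rewrite -(trace_invmx_congr _ _ uT ug) /energy_form /metric_in_chart -/x -/T.
congr (\tr (invmx _ *m _)).
rewrite (differential_local sF ac ad pd) (local_repK pd) -/x -/z trmx_mul !mulmxA.
by [].
Qed.

Lemma energy_form_ge0 c d p : atlas c -> atlas d -> local_dom eps F c d p ->
  0 <= energy_form c d p.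
Proof.
move=> ac ad pd; have [_ cp _] := pd; apply: trace_invmx_ge0.
  exact: posdef_metric_in_chart.
apply: posdef_metric_in_chart => //; exact: (local_rep_img pd).
Qed.

Lemma pull_density_local c d p : atlas c -> atlas d -> local_dom eps F c d p ->
  pull_density c p = in_chart a d (local_rep F c d p) (frame (local_rep F c d) (@space_dir R k) p).
Proof.
move=> ac ad pd; rewrite /pull_density /in_chart /pull_form mul1mx (differential_local sF ac ad pd).
by rewrite (local_repK pd).
Qed.

Lemma flux_local c d j y : atlas c -> atlas d -> local_dom eps F c d (0, y) ->
  flux c j y = in_chart a d (local_rep F c d (0, y))
    (setrow (frame (local_rep F c d) (@space_dir R k) (0, y)) j
      ('D_((1, 0) : R * 'rV[R]_k) (local_rep F c d) (0, y))).
Proof.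
move=> ac ad pd; rewrite /flux /in_chart (local_repK pd) /=.
have -> := differential_local sF ac ad pd.
have /= -> := velocity_local sF ac ad pd.
by rewrite setrow_mulmx.
Qed.

Lemma pull_density_le c p : calibration h a -> (0 < k)%N -> atlas c -> chart_cylinder eps c p ->
  pull_density c p <= (Num.sqrt k%:R ^+ k)^-1 * energy_density c p.
Proof.
move=> cal k0 ac cp; have pd := local_domP cp; set d := chart_at _ in pd.
have ad : atlas d by exact: chart_at_atlas.
rewrite (pull_density_local ac ad pd) (energy_density_local ac ad pd) mulrA.
apply: calibration_inequality => //.
- by apply: posdef_metric_in_chart => //; case: cp.
- by apply: posdef_metric_in_chart => //; exact: local_rep_img pd.
- exact: in_chart_multilinear.
- exact: in_chart_alternating.
by move=> e; exact: in_chart_calibration.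
Qed.

Let diff_class_frame_rep c d : atlas c -> atlas d ->
  diff_class 1 (local_dom eps F c d) (frame (local_rep F c d) (@space_dir R k)).
Proof.
move=> ac ad; apply: diff_class_frame; first exact: open_local_dom.
exact: (diff_class_local_rep sF 2 ac ad).
Qed.

(** Where [du] vanishes, [Num.sqrt] has no derivative. For [2 <= k], however, [|du|^k] is
    [sqrt_pow k.-2] applied to [|du|^2], and [sqrt_pow] is C^1 on the whole line. *)
Lemma diff_class_energy_density c : (2 <= k)%N -> atlas c ->
  diff_class 1 (chart_cylinder eps c) (energy_density c).
Proof.
move=> k2 ac; apply: diff_class_local => p cp; have pd := local_domP cp.
set d := chart_at _ in pd; have ad : atlas d by exact: chart_at_atlas.
exists (local_dom eps F c d); split=> //.
have oO : open (local_dom eps F c d) by exact: open_local_dom.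
have dW := diff_class_frame_rep ac ad.
have dG : diff_class 1 (local_dom eps F c d) (fun q => metric_in_chart g c q.2).
  apply: (@diff_class_sub _ _ _ _ (snd @^-1` img c)); first by move=> q [].
  exact: diff_class_comp_snd (metric_smooth g ac 1).
have G0 q : local_dom eps F c d q -> 0 < \det (metric_in_chart g c q.2).
  by case=> _ cq _; apply: posdef_det_gt0; exact: posdef_metric_in_chart.
have dH : diff_class 1 (local_dom eps F c d)
    (fun q => metric_in_chart h d (local_rep F c d q)).
  apply/(diff_class_mxP _ _ oO) => i j.
  have dij : diff_class 1 (img d) (fun z => metric_in_chart h d z i j).
    by have /(diff_class_mxP _ _ (@open_img _ _ _ d)) := metric_smooth h ad 1; exact.
  have rd q : local_dom eps F c d q -> img d (local_rep F c d q) by exact: local_rep_img.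
  exact: (diff_class_comp oO (@open_img _ _ _ d) rd (diff_class_local_rep sF 1 ac ad) dij).
have dq : diff_class 1 (local_dom eps F c d) (energy_form c d).
  apply: (diff_class_trace oO); apply: (diff_class_mulmx oO).
    exact: (diff_class_invmx oO G0 dG).
  apply: (diff_class_mulmx oO); last exact: (diff_class_trmx oO dW).
  exact: (diff_class_mulmx oO dW dH).
have ds := diff_class_comp_real oO openT (fun _ _ => I) (diff_class_sqrt_pow k.-2) dq.
have dd := diff_class_comp_real oO (@open_gt _ 0) G0 diff_class_sqrt (diff_class_det oO dG).
apply: (eq_diff_class oO _ (diff_classM oO ds dd)) => q qd.
rewrite (energy_density_local ac ad qd) /= sqrt_powE ?energy_form_ge0//.
by congr (Num.sqrt _ ^+ _ * _); case: (k) k2 => [|[]].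
Qed.

Let diff_class_form_rep c d (W : _ -> 'M[R]_(k, n)) : atlas c -> atlas d ->
  diff_class 1 (local_dom eps F c d) W ->
  diff_class 1 (local_dom eps F c d) (fun q => in_chart a d (local_rep F c d q) (W q)).
Proof.
move=> ac ad dW; apply: (diff_class_form (@open_img _ _ _ d)) => //.
- by move=> z; exact: in_chart_multilinear.
- exact: open_local_dom.
- by move=> q; exact: local_rep_img.
- by move=> A; exact: (form_smooth a ad A 1).
exact: (diff_class_local_rep sF 1 ac ad).
Qed.

Lemma diff_class_pull_density c : atlas c ->
  diff_class 1 (chart_cylinder eps c) (pull_density c).
Proof.
move=> ac; apply: diff_class_local => p cp; have pd := local_domP cp.
set d := chart_at _ in pd; have ad : atlas d by exact: chart_at_atlas.
exists (local_dom eps F c d); split=> //.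
apply: (eq_diff_class (open_local_dom sF (c := c) (d := d))); last first.
  exact: (diff_class_form_rep ac ad (diff_class_frame_rep ac ad)).
by move=> q qd; rewrite (pull_density_local ac ad qd).
Qed.

Hypothesis eps0 : 0 < eps.

Let cylinder0 c y : img c y -> chart_cylinder eps c (0, y).
Proof. by move=> cy; split; rewrite //= normr0. Qed.

Lemma diff_class_flux c j : atlas c -> diff_class 1 (img c) (flux c j).
Proof.
move=> ac; apply: diff_class_local => y cy; have pd := local_domP (cylinder0 cy).
set d := chart_at _ in pd; have ad : atlas d by exact: chart_at_atlas.
exists [set y | local_dom eps F c d (0, y)]; split=> //.
have oS : open [set y | local_dom eps F c d (0, y)].
  apply: (@open_comp _ _ (fun y => (0, y)) (local_dom eps F c d)); last exact: open_local_dom.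
  by move=> z _; exact: space_slice_continuous.
have dW := diff_class_form_rep ac ad (diff_class_setrow_frame ((1, 0) : R * 'rV[R]_k)
  (@space_dir R k) (open_local_dom sF (c := c) (d := d)) (diff_class_local_rep sF 2 ac ad) j).
apply: (eq_diff_class oS _ (diff_class_space_slice 0 dW)) => z zd.
by rewrite (flux_local _ ac ad zd).
Qed.

(** [ext_d] is given at each point only in the preferred chart of that point. So the target chart is
    taken at the image of the point under [F 0], and closedness is used at that single point, as
    [pullback_closed] permits. *)
Lemma pull_density_derive c y : (forall x V, ext_d a x V = 0) -> atlas c -> img c y ->
  'D_((1, 0) : R * 'rV[R]_k) (pull_density c) (0, y) = \sum_j 'D_('e_j) (flux c j) y.
Proof.
move=> da ac cy; have pd := local_domP (cylinder0 cy).
set d := chart_at _ in pd; have ad : atlas d by exact: chart_at_atlas.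
have oO : open (local_dom eps F c d) by exact: open_local_dom.
rewrite (@near_eq_derive _ _ _ _ (fun q => in_chart a d (local_rep F c d q)
    (frame (local_rep F c d) (@space_dir R k) q))); last first.
  by apply: (near_eq_in_open oO) => // q qd; rewrite (pull_density_local ac ad qd).
rewrite (pullback_closed _ _ (@open_img _ _ _ d) oO pd).
- apply: eq_bigr => j _; set f := fun q => _.
  have line (t : R) : (fun y : 'rV[R]_k => ((0 : R), y)) (t *: 'e_j + y) =
      t *: space_dir j + (0, y).
    by rewrite -[RHS]/(t * 0 + 0, t *: 'e_j + y) mulr0 add0r.
  rewrite -(@derive_affine _ _ _ _ f (fun y : 'rV[R]_k => (0, y)) y 'e_j (space_dir j) line).
  have oS : open [set y | local_dom eps F c d (0, y)].
    apply: (@open_comp _ _ (fun y => (0, y)) (local_dom eps F c d)) => //.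
    by move=> z _; exact: space_slice_continuous.
  by apply: near_eq_derive; apply: (near_eq_in_open oS) => // z zd; rewrite (flux_local _ ac ad zd).
- by move=> z; exact: in_chart_multilinear.
- by move=> z; exact: in_chart_alternating.
- by move=> A; exact: (form_smooth a ad A 1).
- by move=> q; exact: local_rep_img.
- exact: (diff_class_local_rep sF 2 ac ad).
exact: in_chart_closed_at.
Qed.

Hypothesis smith : smith_immersion g h a (F 0).

Lemma pull_density_smith c y :
  pull_density c (0, y) = (Num.sqrt k%:R ^+ k)^-1 * energy_density c (0, y).
Proof.
by case: smith => _ /(_ (inv c y))[H _]; rewrite /pull_density /energy_density /in_chart H -mulrA.
Qed.

(* The calibrated pullback lies below the energy density and touches it at time 0, so their
   time derivatives agree there. *)
Lemma energy_density_derive c y : closed_calibration h a -> (2 <= k)%N -> atlas c -> img c y ->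
  'D_((1, 0) : R * 'rV[R]_k) (energy_density c) (0, y) =
  (Num.sqrt k%:R ^+ k) * \sum_j 'D_('e_j) (flux c j) y.
Proof.
move=> [cal da] k2 ac cy; have k0 : (0 < k)%N by apply: leq_trans k2.
set K := Num.sqrt k%:R ^+ k.
have K0 : 0 < K by rewrite exprn_gt0// sqrtr_gt0 ltr0n.
have le_eq0 (u v : R) : u = 0 -> 0 <= v -> u <= v by move=> ->.
rewrite -(pull_density_derive da ac cy).
have line (t s : R) : (fun s : R => (s, y)) (t *: 1 + s) =
    t *: ((1, 0) : R * 'rV[R]_k) + (s, y).
  by rewrite -[RHS]/(t *: 1 + s, t *: 0 + y) scaler0 add0r.
have cyl (t : R) : `|t| < eps -> chart_cylinder eps c (t, y) by move=> te; split.
have dE t : `|t| < eps -> derivable (fun s : R => energy_density c (s, y)) t 1.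
  move=> te; apply: (derivable_affine (fun a => line a t)).
  exact: (diff_class_derivable (diff_class_energy_density k2 ac) (cyl t te)).
have dP t : `|t| < eps -> derivable (fun s : R => pull_density c (s, y)) t 1.
  move=> te; apply: (derivable_affine (fun a => line a t)).
  exact: (diff_class_derivable (diff_class_pull_density ac) (cyl t te)).
have e0 : `|0 : R| < eps by rewrite normr0.
rewrite -(@derive_affine _ _ _ _ (energy_density c) (fun s : R => (s, y)) 0 1 _ (fun a => line a 0)).
rewrite -(@derive_affine _ _ _ _ (pull_density c) (fun s : R => (s, y)) 0 1 _ (fun a => line a 0)).
have dB t : `|t| < eps ->
    derivable (fun s : R => K^-1 *: energy_density c (s, y) - pull_density c (s, y)) t 1.
  by move=> te; apply: derivableB (dP t te); exact: derivableZ (dE t te).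
have H : is_derive (0 : R) (1 : R)
    (fun s : R => K^-1 *: energy_density c (s, y) - pull_density c (s, y)) 0.
  apply: (@derive1_at_min _ _ (- eps) eps); first by rewrite ge0_cp// ltW.
  - by move=> t; rewrite in_itv /= -ltr_norml; exact: dB.
  - by rewrite in_itv /= -ltr_norml.
  move=> t; rewrite in_itv /= -ltr_norml => te.
  have E0 : K^-1 *: energy_density c (0, y) - pull_density c (0, y) = 0.
    apply/eqP; rewrite subr_eq0 eq_sym; apply/eqP; exact: pull_density_smith.
  have Et : 0 <= K^-1 *: energy_density c (t, y) - pull_density c (t, y).
    by rewrite subr_ge0; exact: (pull_density_le cal k0 ac (cyl t te)).
  exact: (le_eq0 _ _ E0 Et).
case: H => _; rewrite deriveB; [|exact: derivableZ (dE 0 e0)|exact: dP].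
rewrite (deriveZ _ (dE 0 e0)) => /eqP; rewrite subr_eq0 => /eqP <-.
by rewrite [RHS]mulrA mulfV ?gt_eqF// mul1r.
Qed.

(* The top-degree form [d rho /\ i_X alpha] pulled back by [F 0], with [X] the velocity. *)
Definition boundary_density c (rho : L -> R) (y : 'rV[R]_k) : R :=
  \sum_j 'D_('e_j) (rho \o inv c) y * flux c j y.

(** The gradient of [rho] transforms by [J] through the chain rule, the frame rows by the same [J],
    and [alternating_contraction] extracts the determinant. *)
Lemma boundary_density_transition c c' rho x : atlas c -> atlas c' ->
  dom c x -> dom c' x -> (forall e, atlas e -> smooth_on (img e) (rho \o inv e)) ->
  boundary_density c rho (c x) = \det (transition c c' x) * boundary_density c' rho (c' x).
Proof.
move=> ac ac' cx c'x drho; set J := transition c c' x.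
have ach := chart_at_atlas x; have chx := chart_at_dom x.
pose v : 'cV[R]_k := \col_l 'D_('e_l) (rho \o inv c') (c' x).
have dr : differentiable (rho \o inv c') (c' x).
  exact: (diff_class1_differentiable_real (@open_img _ _ _ c') (drho c' ac' 1) (to_img c'x)).
have dt := transition_differentiable ac ac' cx c'x.
have c'E : (c' \o inv c) (c x) = c' x by rewrite /= toK.
have rhoE j : 'D_('e_j) (rho \o inv c) (c x) = (J *m v) j 0.
  rewrite (@near_eq_derive _ _ _ _ ((rho \o inv c') \o (c' \o inv c))); last first.
    apply: (near_eq_in_open (@open_overlap _ _ L c c')); last exact: overlap_to.
    by move=> y [_ c'y] /=; rewrite toK.
  have dr' : differentiable (rho \o inv c') ((c' \o inv c) (c x)) by rewrite c'E.
  have H := is_derive_comp_diff (diff_derivable (v := 'e_j) dt) dr'.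
  case: H => _ ->; rewrite c'E (deriveEjacobian _ dt) -rowE (derive_lin_sum _ dr) [RHS]mxE.
  by apply: eq_bigr => l _; rewrite /v !mxE.
rewrite /boundary_density /flux !toK//; set w := a (F 0 x).
rewrite (transition_comp ac ac' ach cx c'x chx) -/J.
under eq_bigr do rewrite rhoE -mulmxA.
rewrite alternating_contraction; [|exact: form_multilinear|exact: form_alternating].
by congr (_ * _); apply: eq_bigr => l _; rewrite mxE.
Qed.

End Densities.

(** * First variation of the energy *)

Section Assembly.
Context {R : realType} (k n : nat) (L : manifold R k) (M : manifold R n).
Hypothesis L_oriented : oriented L.
Hypothesis L_compact : compact [set: L].
Implicit Types (c : chart R k L) (S : set L) (rho : L -> R).

Definition smooth_function rho := forall c, atlas c -> smooth_on (img c) (rho \o inv c).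

Definition support rho : set L := closure [set x | rho x != 0].

Lemma support_out rho x : ~ support rho x -> rho x = 0.
Proof.
by move=> Sx; apply: contrapT => /eqP r0; apply: Sx; exact: subset_closure.
Qed.

Lemma closed_support rho : closed (support rho).
Proof. exact: closed_closure. Qed.

Lemma chart_image_compact c S : closed S -> S `<=` dom c -> compact (c @` S).
Proof.
move=> cS Sd; apply: continuous_compact.
  by apply: continuous_in_subspaceT => x /set_mem Sx; apply: to_continuous; exact: Sd.
by apply: (subclosed_compact cS L_compact).
Qed.

Lemma chart_image_out c S y : img c y -> ~ (c @` S) y -> ~ S (inv c y).
Proof. by move=> cy H Sy; apply: H; exists (inv c y) => //; exact: invK. Qed.

(** The radius depends on [S] alone, so all functions supported there can be integrated over one
    cube. *)
Lemma chart_patch c S : closed S -> S `<=` dom c -> exists2 r : R, 0 < r &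
  forall s (f : 'rV[R]_k -> R), diff_class s (img c) f ->
    (forall y, img c y -> ~ S (inv c y) -> f y = 0) ->
    diff_class s setT (f \_ (img c)) /\ (forall y, r < `|y| -> (f \_ (img c)) y = 0).
Proof.
move=> cS Sd; have cK := chart_image_compact cS Sd.
have [r r0 Kr] := compact_norm_le cK; exists r => // s f df f0.
have KI : c @` S `<=` img c by move=> _ [x Sx <-]; apply: to_img; exact: Sd.
have f0' y : img c y -> ~ (c @` S) y -> f y = 0.
  by move=> cy /(chart_image_out cy); exact: f0.
split.
  exact: (diff_class_patch (@open_img _ _ _ c) (compact_closed (@norm_hausdorff _ _) cK) KI df f0').
move=> y ry; rewrite patchE; case: ifPn => [/set_mem cy|_]; last by [].
by apply: f0' => // /Kr; rewrite leNgt ry.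
Qed.

Lemma derive_support_out c rho y (v : 'rV[R]_k) : img c y -> ~ support rho (inv c y) ->
  'D_v (rho \o inv c) y = 0.
Proof.
move=> cy Sy; rewrite (@near_eq_derive _ _ _ _ (fun=> 0)); first exact: derive_cst.
have oC : open (~` support rho) by apply: closed_openC; exact: closed_support.
have : nbhs y (inv c @^-1` (~` support rho)).
  exact: (inv_continuous cy (open_nbhs_nbhs (conj oC Sy))).
by apply: filterS => z /=; exact: support_out.
Qed.

Variables (g : riem_metric L) (h : riem_metric M) (a : kform k M).
Variables (eps : R) (F : R -> L -> M).
Hypotheses (sF : smooth_family eps F) (eps0 : 0 < eps).
Local Notation fluxF := (flux a F).
Local Notation boundaryF := (boundary_density a F).

Lemma boundary_density_out c rho y : img c y -> ~ support rho (inv c y) ->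
  boundaryF c rho y = 0.
Proof.
move=> cy Sy; rewrite /boundary_density big1// => j _.
by rewrite (derive_support_out _ cy Sy) mul0r.
Qed.

Lemma diff_class_boundary_density c rho : atlas c -> smooth_function rho ->
  diff_class 1 (img c) (boundaryF c rho).
Proof.
move=> ac sr; apply: (diff_class_sum _ (@open_img _ _ _ c)) => j _.
apply: (diff_classM (@open_img _ _ _ c)); last exact: (diff_class_flux a sF eps0 j ac).
exact: (diff_class_derive 'e_j (sr c ac 2)).
Qed.

Lemma diff_class_chart_function r c rho : atlas c -> smooth_function rho ->
  diff_class r (img c) (fun y => rho (inv c y)).
Proof. by move=> ac sr; exact: (sr c ac r). Qed.

(** The field [rho] times flux, extended by zero, has compact support, so its divergence integrates
    to zero; the Leibniz rule splits that divergence into the two integrands. *)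
Lemma integration_by_parts c rho : atlas c -> smooth_function rho -> support rho `<=` dom c ->
  iterated_integral ((fun y => rho (inv c y) * \sum_j 'D_('e_j) (fluxF c j) y) \_ (img c)) =
  - iterated_integral (boundaryF c rho \_ (img c)).
Proof.
move=> ac sr Sd; have oI := @open_img _ _ _ c.
have [r r0 pr] := chart_patch (closed_support (rho := rho)) Sd.
have dr s := diff_class_chart_function s ac sr.
have df j := diff_class_flux a sF eps0 j ac.
pose A j y := rho (inv c y) * fluxF c j y.
have dA j : diff_class 1 (img c) (A j) by exact: (diff_classM oI (dr 1%N) (df j)).
have A0 j y : img c y -> ~ support rho (inv c y) -> A j y = 0.
  by move=> _ /support_out; rewrite /A => ->; exact: mul0r.
pose D y := \sum_j 'D_('e_j) (fluxF c j) y.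
have dD : diff_class 0 (img c) (fun y => rho (inv c y) * D y).
  apply: (diff_classM oI (dr 0%N)); apply: (diff_class_sum _ oI) => j _.
  exact: (diff_class_derive 'e_j (df j)).
have D0 y : img c y -> ~ support rho (inv c y) -> rho (inv c y) * D y = 0.
  by move=> _ /support_out ->; exact: mul0r.
have dB := diff_class_boundary_density ac sr.
have [d1 s1] := pr _ _ dD D0; have [d2 s2] := pr _ _ dB (boundary_density_out (rho := rho) (c := c)).
have c1 := diff_class_csupp d1 s1; have c2 := diff_class_csupp d2 s2.
have AE y : \sum_j 'D_('e_j) (A j \_ (img c)) y =
    ((fun y => rho (inv c y) * D y) \_ (img c)) y + (boundaryF c rho \_ (img c)) y.
  rewrite !patchE; case: ifPn => [/set_mem cy|/negP cy].
    rewrite /D mulr_sumr -big_split; apply: eq_bigr => j _.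
    rewrite (@near_eq_derive _ _ _ _ ((rho \o inv c) * fluxF c j)); last first.
      by apply: (near_eq_in_open oI _ cy) => z cz; rewrite patchE mem_set.
    rewrite deriveM.
    - by apply: (congr1 (fun z => _ + z)); exact: mulrC.
    - exact: (diff_class_derivable (sr c ac 1%N) cy).
    - exact: (diff_class_derivable (df j) cy).
  rewrite [RHS](addr0 _) big1// => j _.
  have Ky : ~ (c @` support rho) y.
    by move=> [x Sx xy]; apply: cy; apply/mem_set; rewrite -xy; apply: to_img; exact: Sd.
  have oK : open (~` (c @` support rho)).
    apply: closed_openC; apply: (compact_closed (@norm_hausdorff _ _)).
    exact: (chart_image_compact (closed_support (rho := rho)) Sd).
  rewrite (@near_eq_derive _ _ _ _ (fun=> 0)); first exact: derive_cst.
  apply: (near_eq_in_open oK _ Ky) => z Kz; rewrite patchE; case: ifPn => [/set_mem cz|_ //].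
  by apply: A0 => //; exact: (chart_image_out cz).
have sA j : csupp r ('D_('e_j) (A j \_ (img c))).
  have [d3 s3] := pr _ _ (dA j) (A0 j).
  exact: (diff_class_csupp (diff_class_derive 'e_j d3) (diff_class_derive_supp 'e_j s3)).
apply/eqP; rewrite -addr_eq0 -(iterated_integralD c1 c2); apply/eqP.
rewrite (_ : (fun y => _ + _) = fun y => \sum_j 'D_('e_j) (A j \_ (img c)) y); last first.
  by apply/funext => y; rewrite AE.
rewrite (iterated_integral_sum _ (fun j _ => sA j)) big1// => j _.
have [d3 s3] := pr _ _ (dA j) (A0 j).
exact: (iterated_integral_derive j r0 d3 s3).
Qed.

(** The integrand lives on the intersection of the two supports, compact and inside both charts. On
    the overlap it transforms by the Jacobian determinant, positive by orientation; off the overlap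
    a cut-off vanishes. *)
Lemma boundary_chart_change c c' rho rho' : atlas c -> atlas c' ->
  smooth_function rho -> smooth_function rho' ->
  support rho `<=` dom c -> support rho' `<=` dom c' ->
  iterated_integral ((fun y => rho' (inv c y) * boundaryF c rho y) \_ (img c)) =
  iterated_integral ((fun y => rho' (inv c' y) * boundaryF c' rho y) \_ (img c')).
Proof.
move=> ac ac' sr sr' Sd Sd'.
pose U := [set y | img c y /\ dom c' (inv c y)].
pose V := [set y | img c' y /\ dom c (inv c' y)].
have oU : open U by exact: open_overlap.
have oV : open V by exact: open_overlap.
pose S := support rho `&` support rho'.
have cS : closed S by apply: closedI; exact: closed_support.
have Sc : S `<=` dom c by move=> x [/Sd].
have Sc' : S `<=` dom c' by move=> x [_ /Sd'].
pose f := (fun y => rho' (inv c' y) * boundaryF c' rho y) \_ (img c').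
have f0 y : img c' y -> ~ S (inv c' y) -> rho' (inv c' y) * boundaryF c' rho y = 0.
  move=> cy Sy; have [Sr|Sr] := pselect (support rho (inv c' y)); last first.
    by rewrite (boundary_density_out cy Sr) mulr0.
  by rewrite support_out ?mul0r// => Sr'; apply: Sy.
have df : diff_class 1 setT f.
  have [r _ pr] := chart_patch cS Sc'.
  have dB := diff_class_boundary_density ac' sr.
  by have [] := pr 1%N _ (diff_classM (@open_img _ _ _ c') (diff_class_chart_function 1 ac' sr') dB) f0.
pose K := c' @` S.
have fK y : ~ K y -> f y = 0.
  move=> Ky; rewrite /f patchE; case: ifPn => [/set_mem cy|_ //].
  by apply: f0 => //; exact: (chart_image_out cy).
have KV : K `<=` V.
  by move=> _ [x Sx <-]; split; [apply: to_img; exact: Sc'|rewrite toK; [exact: Sc|exact: Sc']].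
have jphi x : U x -> 0 < \det (jacobian (c' \o inv c) x).
  move=> [cx c'x]; have := L_oriented ac ac' (inv_dom cx) c'x.
  by rewrite /transition invK.
have := change_of_variables (phi := c' \o inv c) (psi := c \o inv c') oU oV _ _ _ _ _ jphi
  (chart_image_compact cS Sc') KV df fK.
move=> H; apply: (etrans (congr1 (@iterated_integral R k) _)); last first.
  apply: H.
  - by move=> y [cy c'y]; split=> /=; [exact: to_img|rewrite toK//; exact: inv_dom].
  - by move=> y [cy c'y] /=; rewrite toK// invK.
  - by move=> y [cy c'y] /=; rewrite toK// invK.
  - exact: (atlas_smooth ac ac' 2).
  - move=> y [cy c'y]; apply: continuous_comp; first exact: inv_continuous.
    exact: to_continuous.
apply/funext => y; rewrite /pull [LHS]patchE [RHS]patchE.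
case: ifPn => [/set_mem cy|/negP cy]; last first.
  by case: ifPn => // /set_mem[/mem_set].
case: ifPn => [/set_mem Uy|/negP Uy].
  have [_ c'y] := Uy; have xd := inv_dom cy.
  rewrite /f patchE mem_set /=; last exact: to_img.
  rewrite toK//.
  have := boundary_density_transition a F ac ac' xd c'y sr.
  by rewrite (invK cy) /transition (invK cy) => ->; rewrite mulrAC mulrA.
rewrite support_out ?mul0r// => Sr'; apply: Uy; apply/mem_set; split=> //.
exact: Sd'.
Qed.

Variable P : unity_partition L.
Local Notation c_ i := (pu_chart i).
Local Notation rho_ i := (pu_fun i).

Let ac (i : 'I_(pu_size P)) : atlas (c_ i) := pu_atlas i.
Let sr (i : 'I_(pu_size P)) : smooth_function (rho_ i) := fun c => @pu_smooth _ _ _ P i c.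
Let Sd (i : 'I_(pu_size P)) : support (rho_ i) `<=` dom (c_ i) := @pu_support _ _ _ P i.

Lemma boundary_density_sum c y : atlas c -> img c y ->
  \sum_(i < pu_size P) boundaryF c (rho_ i) y = 0.
Proof.
move=> acc cy; rewrite exchange_big big1// => j _; rewrite -mulr_suml.
suff -> : \sum_(i < pu_size P) 'D_('e_j) (rho_ i \o inv c) y = 0 by exact: mul0r.
have H (i : 'I_(pu_size P)) : is_derive y 'e_j (rho_ i \o inv c) ('D_('e_j) (rho_ i \o inv c) y).
  have d1 : diff_class 1 (img c) (rho_ i \o inv c) by exact: (sr i acc 1%N).
  exact: (DeriveDef (diff_class_derivable d1 cy) erefl).
have [_ <-] := is_derive_sum H.
rewrite (_ : \sum_i _ = fun=> 1); first exact: derive_cst.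
by apply/funext => z; rewrite fct_sumE; exact: pu_sum.
Qed.

Lemma boundary_integral_sum :
  \sum_(i < pu_size P) iterated_integral (boundaryF (c_ i) (rho_ i) \_ (img (c_ i))) = 0.
Proof.
pose G (i l : 'I_(pu_size P)) c y := rho_ l (inv c y) * boundaryF c (rho_ i) y.
have dG i l c : atlas c -> diff_class 1 (img c) (G i l c).
  move=> acc; apply: (diff_classM (@open_img _ _ _ c) (diff_class_chart_function 1 acc (sr l))).
  exact: diff_class_boundary_density.
transitivity (\sum_i \sum_l iterated_integral (G i l (c_ i) \_ (img (c_ i)))).
  apply: eq_bigr => i _.
  have [r r0 pr] := chart_patch (closed_support (rho := rho_ i)) (@Sd i).
  have sG l : csupp r (G i l (c_ i) \_ (img (c_ i))).
    have [|d s] := pr _ _ (dG i l _ (ac i)); last exact: (diff_class_csupp d s).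
    by move=> y cy Sy; rewrite /G (boundary_density_out cy Sy) mulr0.
  rewrite -(iterated_integral_sum _ (fun l _ => sG l)); congr iterated_integral.
  apply/funext => y; rewrite patchE; case: ifPn => [cy|cy].
    under eq_bigr do rewrite patchE cy.
    by rewrite -mulr_suml pu_sum mul1r.
  by rewrite big1// => l _; rewrite patchE (negbTE cy).
rewrite exchange_big big1// => l _.
(* Once moved, all terms with the same [l] share one chart, so the sum over [i] can be taken under
   the integral. *)
transitivity (\sum_i iterated_integral (G i l (c_ l) \_ (img (c_ l)))).
  by apply: eq_bigr => i _; exact: boundary_chart_change.
have [r r0 pr] := chart_patch (closed_support (rho := rho_ l)) (@Sd l).
have sG i : csupp r (G i l (c_ l) \_ (img (c_ l))).
  have [|d s] := pr _ _ (dG i l _ (ac l)); last exact: (diff_class_csupp d s).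
  by move=> y cy /support_out Sy; rewrite /G Sy mul0r.
rewrite -(iterated_integral_sum _ (fun i _ => sG i)) -[RHS](@iterated_integral0 R k).
congr iterated_integral; apply/funext => y; have [cy|cy] := boolP (y \in img (c_ l)).
  under eq_bigr do rewrite patchE cy.
  by rewrite -mulr_sumr boundary_density_sum ?mulr0//; exact: set_mem.
by rewrite big1// => i _; rewrite patchE (negbTE cy).
Qed.

Hypothesis k2 : (2 <= k)%N.
Hypothesis cal : closed_calibration h a.
Hypothesis smith : smith_immersion g h a (F 0).

(** At every time the integrand is supported in the chart image of the support of [rho_ i], the
    fixed compact set that differentiation under the integral requires. The sign comes from
    integration by parts. *)
Lemma local_energy_derive (i : 'I_(pu_size P)) :
  is_derive (0 : R) (1 : R) (fun t => iterated_integral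
    ((fun y => rho_ i (inv (c_ i) y) * energy_density g h F (c_ i) (t, y)) \_ (img (c_ i))))
  (- (Num.sqrt k%:R ^+ k * iterated_integral (boundaryF (c_ i) (rho_ i) \_ (img (c_ i))))).
Proof.
set c := c_ i; set rho := rho_ i; set kk := Num.sqrt k%:R ^+ k.
pose f (q : R * 'rV[R]_k) :=
  ((fun y => rho (inv c y) * energy_density g h F c (q.1, y)) \_ (img c)) q.2.
have cS := closed_support (rho := rho).
have cK := chart_image_compact cS (@Sd i).
have [r r0 Kr] := compact_norm_le cK.
have oS : open (chart_cylinder eps c) by exact: open_chart_cylinder.
have dE := diff_class_energy_density L_oriented g h sF k2 (ac i).
have drho : diff_class 1 (chart_cylinder eps c) (fun q => rho (inv c q.2)).
  apply: (@diff_class_sub _ _ _ _ (snd @^-1` img c)); first by move=> q [].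
  exact: diff_class_comp_snd (diff_class_chart_function 1 (ac i) (sr i)).
have df : diff_class 1 (chart_cylinder eps c) f.
  apply: (eq_diff_class oS _ (diff_classM oS drho dE)) => q [_ cq].
  by rewrite /f patchE mem_set//; case: (q).
have f_supp' (t : R) y : ~ (c @` support rho) y -> f (t, y) = 0.
  move=> Ky; rewrite /f patchE; case: ifPn => [/set_mem cy|_ //].
  by rewrite (support_out (chart_image_out cy Ky)) mul0r.
have f_supp := filterE (nbhs_filter (0 : R)) f_supp'.
have f_C1 y : (c @` support rho) y -> partial_C1 ((1, 0) : R * 'rV[R]_k) f (0, y).
  move=> [x Sx <-]; apply: (diff_class_partial_C1 _ oS df).
  by split; [rewrite /= normr0|apply: to_img; exact: Sd].
have H := is_derive_iterated_integral r0 cK Kr f_supp f_C1.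
apply: (is_derive_eq H).
have line y (t : R) : (fun s : R => (s, y)) (t *: 1 + 0) =
    t *: ((1, 0) : R * 'rV[R]_k) + (0, y).
  by rewrite -[RHS]/(t *: 1 + 0, t *: 0 + y) scaler0 add0r.
have E : (fun y => 'D_((1, 0) : R * 'rV[R]_k) f (0, y)) =
    fun y => kk * ((fun y => rho (inv c y) * \sum_j 'D_('e_j) (fluxF c j) y) \_ (img c)) y.
  apply/funext => y.
  rewrite -(@derive_affine _ _ _ _ f (fun s : R => (s, y)) 0 1 _ (line y)) patchE.
  case: ifPn => [cy|cy]; last first.
    rewrite mulr0 (_ : _ \o _ = fun=> 0); first exact: derive_cst.
    by apply/funext => s; rewrite /f /= patchE (negbTE cy).
  have {}E : f \o (fun s : R => (s, y)) =
      rho (inv c y) *: (energy_density g h F c \o (fun s : R => (s, y))).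
    by apply/funext => s; rewrite /f /= patchE cy.
  have cyl : chart_cylinder eps c (0, y) by split; [rewrite /= normr0|exact: set_mem].
  rewrite E deriveZ; last first.
    apply: (derivable_affine (line y)).
    exact: (diff_class_derivable dE cyl).
  rewrite (@derive_affine _ _ _ _ (energy_density g h F c) (fun s : R => (s, y)) 0 1 _ (line y)).
  rewrite (energy_density_derive L_oriented sF eps0 smith cal k2 (ac i) (set_mem cy)).
  exact: mulrCA.
apply: (etrans (congr1 (@iterated_integral R k) E)).
have [r' _ pr] := chart_patch cS (@Sd i).
have oI := @open_img _ _ _ c.
have dD : diff_class 0 (img c) (fun y => rho (inv c y) * \sum_j 'D_('e_j) (fluxF c j) y).
  apply: (diff_classM oI (diff_class_chart_function 0 (ac i) (sr i))).
  apply: (diff_class_sum _ oI) => j _.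
  exact: (diff_class_derive 'e_j (diff_class_flux a sF eps0 j (ac i))).
have [|d1 s1] := pr _ _ dD; first by move=> y _ /support_out ->; exact: mul0r.
rewrite (iterated_integralZ _ (diff_class_csupp d1 s1)).
by rewrite (integration_by_parts (ac i) (sr i) (@Sd i)) mulrN.
Qed.

Lemma k_energy_derive : is_derive (0 : R) (1 : R) (fun t => k_energy P g h (F t)) (0 : R).
Proof.
have H := is_derive_sum (fun i => local_energy_derive i).
pose K := (Num.sqrt k%:R ^+ k)^-1 : R.
have HZ := is_deriveZ K H.
have E : (fun t => k_energy P g h (F t)) = K *: \sum_(i < pu_size P) (fun t => iterated_integral
    ((fun y => rho_ i (inv (c_ i) y) * energy_density g h F (c_ i) (t, y)) \_ (img (c_ i)))).
  by apply/funext => t; rewrite [RHS]/(K * _) fct_sumE.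
rewrite E; apply: (is_derive_eq HZ).
by rewrite sumrN -mulr_sumr boundary_integral_sum mulr0 oppr0 scaler0.
Qed.

End Assembly.

Theorem theorem3p4 (R : realType) (k n : nat) (hk : (2 <= k <= n)%N)
    (L : manifold R k) (M : manifold R n)
    (L_oriented : oriented L) (M_oriented : oriented M)
    (L_compact : compact [set: L])
    (g : riem_metric L) (h : riem_metric M)
    (a : kform k M) (a_calib : closed_calibration h a)
    (u : L -> M) (u_smith : smith_immersion g h a u)
    (P : unity_partition L) :
  k_harmonic P g h u.
Proof.
move=> eps F eps0 sF F0; have [k2 _] := andP hk.
by apply: (k_energy_derive L_oriented L_compact sF eps0 P k2 a_calib); rewrite F0.
Qed.
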